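(* Suppose that Assumptions 1–4 (stated in the context) hold. Let $\{x_k\}$ be the sequence generated by Algorithm 2 (stated in the context) with $m_k=\Theta(\varepsilon^{-2}d^{2})$ for all $k\in\{0,\dots,T\}$, $\mu_{\min}=\Theta(\varepsilon d^{-3/2})$, $\mu_0=\Theta(\varepsilon d^{-3/2})$ such that $\mu_0\ge\mu_{\min}$, and $$\beta:=\min\left(\frac{1}{12(d+4)H_F},\ \frac{1}{(T+1)^{1/2}d^{3/4}}\right).$$ Let $\hat x:=x_{k'}$, where $k'$ is chosen from a uniform distribution over $\{0,\dots,T\}$. Then, for any $x_0\in\mathbb{R}^d$ and $\gamma\in(0,1)$, the iteration complexity required to obtain $\mathbb{E}[\|\nabla F(\hat x)\|^2]\le\varepsilon^2$ is $O(d^{5/2}\varepsilon^{-4})$. Moreover, the sample complexity is $O(d^{9/2}\varepsilon^{-6})$.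
   Context: Setting. The problem is to minimize over $x\in\mathbb{R}^d$ the (generally non-convex) function $F(x):=\mathbb{E}_{\xi\sim D(x)}[f(x,\xi)]$, where $f$ is real valued and the probability distribution $D(x)$ of the random vector $\xi$ depends on $x$. $\|\cdot\|$ is the Euclidean norm and $\mathcal N(0,I_d)$ the standard normal distribution in dimension $d$. Assumption 1: there exists a constant $\sigma\ge 0$ such that $\mathbb{E}_{\xi\sim D(x)}[(F(x)-f(x,\xi))^2]\le\sigma^2$ for any $x\in\mathbb{R}^d$. Assumption 2: there exists a constant $\alpha\ge0$ such that $W(D(x),D(x'))\le\alpha\|x-x'\|$ for any $x,x'\in\mathbb{R}^d$, where $W$ is the Wasserstein-1 distance. Assumption 3: $f(x,\xi)$ is $L_\xi$-Lipschitz continuous in $\xi$ and $L_x$-Lipschitz continuous in $x$. Assumption 4: $F$ is $H_F$-smooth (its gradient is $H_F$-Lipschitz continuous). Two-point gradient estimator: $g_2(x,\mu,u,\xi^1,\xi^2):=\frac{f(x+\mu u,\xi^1)-f(x-\mu u,\xi^2)}{2\mu}u$. Algorithm 2 (inputs $x_0$, $\mu_0$, $\mu_{\min}$, $\beta$, $\gamma$, $\{m_k\}_{k=0}^T$, $T$). For $k=0,1,\dots,T$: (1) sample $u_k$ from $\mathcal N(0,I_d)$, $\{\xi_k^{1,j}\}_{j=1}^{m_k}$ from $D(x_k+\mu_ku_k)$, and $\{\xi_k^{2,j}\}_{j=1}^{m_k}$ from $D(x_k-\mu_ku_k)$; (2) $g_k:=\frac1{m_k}\sum_{j=1}^{m_k}g_2(x_k,\mu_k,u_k,\xi_k^{1,j},\xi_k^{2,j})$;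 (3) $x_{k+1}:=x_k-\beta g_k$; (4) $\mu_{k+1}:=\max(\gamma\mu_k,\mu_{\min})$. The iteration complexity is the number of iterations; the sample complexity is the total number of samples drawn from the distributions $D(\cdot)$.
   Formalization: F is assumed bounded below (the O-constants depend on a bound on F(x_0) − inf F), the Θ-constants of μ_0 and μ_min are taken below a threshold depending on H_F, and ε ≤ 1; without the first two the claim fails. *)

(* Defs.v *)
From HB Require Import structures.
From mathcomp Require Import all_boot all_order all_algebra.
From mathcomp Require Import all_classical all_reals all_analysis.
Import Order.TTheory GRing.Theory Num.Theory numFieldNormedType.Exports.
Set Implicit Arguments.
Unset Strict Implicit.
Unset Printing Implicit Defensive.
Local Open Scope classical_set_scope.
Local Open Scope ring_scope.

(* The norm `|v| that the library puts on row vectors is the sup norm; it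
   induces the same topology, hence the same notions of Borel set and of
   differentiability, but all metric hypotheses are about this norm. *)
Definition enorm (R : realType) (n : nat) (v : 'rV[R]_n) : R :=
  Num.sqrt (\sum_(i < n) v ord0 i ^+ 2).

(* R^n with its Borel sigma-algebra; the carrier is convertible to 'rV[R]_n. *)
Definition borelRV (R : realType) (n : nat) :=
  g_sigma_algebraType (@open 'rV[R]_n).

Section wasserstein.
Context {R : realType} {p : nat}.

Definition coupling (Q Q' : probability (borelRV R p) R)
    (pi : probability (borelRV R p * borelRV R p)%type R) : Prop :=
  forall A : set (borelRV R p), measurable A ->
    pi (A `*` setT) = Q A /\ pi (setT `*` A) = Q' A.

Definition wasserstein1 (Q Q' : probability (borelRV R p) R) : \bar R :=
  ereal_inf [set (\int[pi]_z (enorm ((z.1 : 'rV[R]_p) - z.2)%R)%:E)%E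
            | pi in coupling Q Q'].

End wasserstein.

Section problem.
Context {R : realType} {d p : nat}.
Implicit Types (f : 'rV[R]_d -> 'rV[R]_p -> R) (F : 'rV[R]_d -> R).
Implicit Type D : 'rV[R]_d -> probability (borelRV R p) R.

(* The real-valued integral is a junk value when f x is not integrable, but then
   no constant bounds the second moment required by [finite_variance] below. *)
Definition objective f D (x : 'rV[R]_d) : R := \int[D x]_xi f x xi.

Definition gradient F (x : 'rV[R]_d) : 'rV[R]_d :=
  \row_(i < d) 'D_(delta_mx ord0 i) F x.

Record assumptions f D (sigma alpha Lxi Lx HF : R) : Prop := Assumptions {
  finite_variance : forall x,
    (\int[D x]_xi ((objective f D x - f x xi) ^+ 2)%:E <= (sigma ^+ 2)%:E)%E;
  wasserstein_lipschitz : forall x x',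
    (wasserstein1 (D x) (D x') <= (alpha * enorm (x - x'))%:E)%E;
  lipschitz_xi : forall x xi xi',
    `|f x xi - f x xi'| <= Lxi * enorm (xi - xi');
  lipschitz_x : forall xi x x',
    `|f x xi - f x' xi| <= Lx * enorm (x - x');
  objective_differentiable : forall x, differentiable (objective f D) x;
  gradient_lipschitz : forall x x',
    enorm (gradient (objective f D) x - gradient (objective f D) x')
      <= HF * enorm (x - x')
}.

End problem.

Section algorithm.
Context {R : realType} {d p : nat}.

Definition g2 (f : 'rV[R]_d -> 'rV[R]_p -> R) (x : 'rV[R]_d) (mu : R)
    (u : 'rV[R]_d) (xi1 xi2 : 'rV[R]_p) : 'rV[R]_d :=
  ((f (x + mu *: u) xi1 - f (x - mu *: u) xi2) / (2 * mu)) *: u.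

Fixpoint smoothing (mu0 mumin gamma : R) (k : nat) : R :=
  if k is k'.+1 then Num.max (gamma * smoothing mu0 mumin gamma k') mumin
  else mu0.

(* Iterates as a deterministic function of the sampled values; only the samples
   xi1 k j and xi2 k j with j < m k are used. *)
Fixpoint iterate (f : 'rV[R]_d -> 'rV[R]_p -> R) (mu : nat -> R) (beta : R)
    (m : nat -> nat) (x0 : 'rV[R]_d) (u : nat -> 'rV[R]_d)
    (xi1 xi2 : nat -> nat -> 'rV[R]_p) (k : nat) : 'rV[R]_d :=
  if k is k'.+1 then
    let x := iterate f mu beta m x0 u xi1 xi2 k' in
    x - beta *: ((m k')%:R^-1 *:
      \sum_(j < m k') g2 f x (mu k') (u k') (xi1 k' j) (xi2 k' j))
  else x0.

Definition num_samples (m : nat -> nat) (T : nat) : nat :=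
  (\sum_(k < T.+1) (m k + m k))%N.

Section run.
Context {dO : measure_display} {Omega : measurableType dO}
  (P : probability Omega R).

Definition std_normal (U : Omega -> borelRV R d) : Prop :=
  forall B : 'I_d -> set R, (forall i, measurable (B i)) ->
    P [set w | forall i, B i ((U w : 'rV[R]_d) ord0 i)] =
    (\prod_(i < d) normal_prob 0 1 (B i))%E.

Record run := Run {
  dir : nat -> {mfun Omega >-> borelRV R d};
  smp1 : nat -> nat -> {mfun Omega >-> borelRV R p};
  smp2 : nat -> nat -> {mfun Omega >-> borelRV R p};
  idx : {mfun Omega >-> nat}
}.

Definition events n (X : Omega -> borelRV R n) : set (set Omega) :=
  preimage_set_system setT X measurable.

(* Generated by everything drawn during iterations 0, ..., k - 1. *)
Definition history (m : nat -> nat) (S : run) (k : nat) : set (set Omega) :=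
  <<s \bigcup_(i in [set i | (i < k)%N])
        (events (dir S i) `|`
         \bigcup_(j in [set j | (j < m i)%N])
           (events (smp1 S i j) `|` events (smp2 S i j))) >>.

Definition history_dir (m : nat -> nat) (S : run) (k : nat) :
    set (set Omega) :=
  <<s history m S k `|` events (dir S k) >>.

Definition run_iterate f mu beta m x0 (S : run) (k : nat) (w : Omega) :
    'rV[R]_d :=
  iterate f mu beta m x0 (fun i => dir S i w) (fun i j => smp1 S i j w)
    (fun i j => smp2 S i j w) k.

(* [run_samples] says that, conditionally on the past and on the direction u_k,
   the 2 m_k samples of iteration k are independent, the first m_k of law
   D(x_k + mu_k u_k) and the others of law D(x_k - mu_k u_k).
   [run_idx] says that the output index is uniform on {0, ..., T} and
   independent of the run. *)
Record algorithm2 (f : 'rV[R]_d -> 'rV[R]_p -> R)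
    (D : 'rV[R]_d -> probability (borelRV R p) R) (mu : nat -> R) (beta : R)
    (m : nat -> nat) (T : nat) (x0 : 'rV[R]_d) (S : run) : Prop :=
  Algorithm2 {
  run_dir_normal : forall k, (k <= T)%N -> std_normal (dir S k);
  run_dir_indep : forall k, (k <= T)%N ->
    forall A B, history m S k A -> events (dir S k) B ->
      P (A `&` B) = (P A * P B)%E;
  run_samples : forall k, (k <= T)%N ->
    forall (A : set Omega) (B1 B2 : nat -> set (borelRV R p)),
      history_dir m S k A ->
      (forall j, measurable (B1 j)) -> (forall j, measurable (B2 j)) ->
      let x := run_iterate f mu beta m x0 S k in
      P (A `&` [set w | forall j, (j < m k)%N ->
                  B1 j (smp1 S k j w) /\ B2 j (smp2 S k j w)]) =
      (\int[P]_(w in A) \prod_(j < m k)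
         (D (x w + mu k *: (dir S k w : 'rV[R]_d))%R (B1 j) *
          D (x w - mu k *: (dir S k w : 'rV[R]_d))%R (B2 j)))%E;
  run_idx : forall A k, history m S T.+1 A -> (k <= T)%N ->
    P (A `&` idx S @^-1` [set k]) = (P A * (T.+1%:R^-1)%:E)%E
}.

End run.
End algorithm.
Arguments run R d p {dO} Omega.

(* Main.v *)
Require Import Defs.
From HB Require Import structures.
From mathcomp Require Import all_boot all_order all_algebra.
From mathcomp Require Import all_classical all_reals all_analysis.
From mathcomp Require Import measurable_realfun lra ring.
Set Implicit Arguments.
Unset Strict Implicit.
Unset Printing Implicit Defensive.
Import Order.TTheory GRing.Theory Num.Theory numFieldNormedType.Exports.
Local Open Scope classical_set_scope.
Local Open Scope ring_scope.

(* An iteration is x+ = x - beta S u, where, given x and u, the random slope S has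
   as mean the central difference G = (F (x + mu u) - F (x - mu u)) / (2 mu) and
   variance at most V = sigma^2 / (2 mu^2 m). Smoothness bounds F x+ by a
   quadratic polynomial in S, whose conditional expectation is its value at G plus
   V times its leading coefficient. Since G = <grad F x, u> up to HF mu |u|^2, the
   moments of u give, for beta <= 1 / (12 (d + 4) HF),
     E F x+ + beta / 8 E |grad F x|^2
       <= E F x + 431 beta HF^2 mu^2 d^2 + 3 HF beta^2 d V,
   without passing to the Gaussian smoothing of F. This telescopes: as F >= F x0 -
   Delta, the average of E |grad F x_k|^2 over k <= T is at most
   8 Delta / (beta (T + 1)) plus 8 / beta times the error terms, and the powers
   of d and eps in mu, m and T make each of these at most a fraction of eps^2. *)

(** * Disintegration along a conditional law *)

(** The assumption on the samples gives probabilities of product events, and the law in it moves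
    with the iterate. To turn it into a statement about integrals, [D x U] must be measurable in [x]
    and [f] jointly measurable. Neither is assumed: the first is extracted from the Wasserstein
    bound, the second from the Lipschitz bounds. Conditioning on a sigma-algebra is expressed by
    giving Omega a coarser measurable structure and taking the identity as the conditioning
    variable, so only integrals against kernels appear.

    No integrability of F along the run is available beforehand. Everything is therefore kept
    nonnegative: F is shifted by a lower bound [m0], and the quadratic bound dominates F - m0 at
    every slope, so it is itself nonnegative. The rules for nonnegative extended integrals then
    apply, and signed linearity is used only under a fixed sampling law.

    The fourth moment of the direction multiplies |grad F|^2 with the wrong sign, so it has to be
    bounded fairly sharply, whereas crude bounds are enough for the other upper moments. *)

Section disintegration.
Context {d1 d2 : measure_display} {T1 : measurableType d1}
  {T2 : measurableType d2} {R : realType}.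
Local Open Scope ereal_scope.

(** The measurability proof is an argument so that the kernel instances below can be attached to the
    term itself; [mfun_of] applies the same device to measurable functions. *)
Definition mkernel (k : T1 -> probability T2 R)
    (mk : forall U : set T2, measurable U -> measurable_fun setT (fun x => k x U)) :
  T1 -> {measure set T2 -> \bar R} := k.

Section instances.
Variables (k : T1 -> probability T2 R)
  (mk : forall U : set T2, measurable U -> measurable_fun setT (fun x => k x U)).

HB.instance Definition _ := @isKernel.Build _ _ T1 T2 R (mkernel mk) mk.

Let mkernel_prob x : mkernel mk x [set: T2] = 1.
Proof. exact: probability_setT. Qed.

HB.instance Definition _ :=
  @Kernel_isProbability.Build _ _ T1 T2 R (mkernel mk) mkernel_prob.

End instances.

Lemma measurable_partial_integral (k : T1 -> probability T2 R)
    (mk : forall U : set T2, measurable U -> measurable_fun setT (fun x => k x U))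
    (f : T1 * T2 -> \bar R) :
  (forall z, 0 <= f z) -> measurable_fun setT f ->
  measurable_fun setT (fun x => \int[k x]_y f (x, y)).
Proof.
move=> f0 mf.
exact: (measurable_fun_integral_finite_kernel f (mkernel mk) f0 mf).
Qed.

End disintegration.

(** Finite measures that agree on a generating pi-system are equal, so it is enough to know [mu] on
    [G]. The mixture is realized as a composition of kernels whose source is the one-point space. *)
Lemma ge0_integral_mixture {dX dZ : measure_display} {X : measurableType dX}
    {Z : measurableType dZ} {R : realType} (P : probability X R)
    (k : X -> probability Z R) (mu : probability Z R) (G : set (set Z))
    (f : Z -> \bar R) :
  (forall U : set Z, measurable U -> measurable_fun setT (fun x => k x U)) ->
  @measurable _ Z = <<s G >> -> setI_closed G -> G setT ->
  (forall U, G U -> mu U = (\int[P]_x k x U)%E) ->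
  (forall z, (0 <= f z)%E) -> measurable_fun setT f ->
  (\int[mu]_z f z = \int[P]_x \int[k x]_z f z)%E.
Proof.
move=> mk GE GI GT muE f0 mf.
have mk' U : measurable U ->
    measurable_fun [set: unit * X] (fun x => (k \o snd) x U).
  by move=> mU; exact: (measurableT_comp (mk U mU) measurable_snd).
pose l := mkernel (k := fun _ : unit => P)
  (fun U _ => measurable_cst (P U)).
transitivity (\int[kcomp l (mkernel mk') tt]_z f z)%E.
  apply: eq_measure_integral => A mA _.
  apply: (@measure_unique _ R Z G (fun=> setT) GE GI _ _ mu
    (kcomp l (mkernel mk') tt)) => //.
  - by rewrite bigcup_const//; exists 0%N.
  - by move=> _; rewrite /= probability_setT ltry.
by rewrite integral_kcomp.
Qed.

Section law.
Context {d1 d2 : measure_display} {T1 : measurableType d1}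
  {T2 : measurableType d2} {R : realType}.

Definition mfun_of (f : T1 -> T2) (mf : measurable_fun setT f) : T1 -> T2 := f.

HB.instance Definition _ (f : T1 -> T2) (mf : measurable_fun setT f) :=
  isMeasurableFun.Build _ _ _ _ (mfun_of mf) mf.

Definition law (P : probability T1 R) (f : T1 -> T2)
    (mf : measurable_fun setT f) : probability T2 R :=
  distribution P (mfun_of mf).

End law.

Section disintegration_theorems.
Context {d1 d2 dO : measure_display} {T1 : measurableType d1}
  {T2 : measurableType d2} {Omega : measurableType dO} {R : realType}
  (P : probability Omega R).
Local Open Scope ereal_scope.

(** A regular conditional law of X given Y, tested on rectangles only: this is the form in which the
    assumptions on the run can be checked, and [ge0_disintegration] extends it to integrals. *)
Definition conditional_law (Y : Omega -> T1) (X : Omega -> T2)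
    (k : T1 -> probability T2 R) :=
  forall C B, measurable C -> measurable B ->
    P (Y @^-1` C `&` X @^-1` B) = \int[P]_(w in Y @^-1` C) k (Y w) B.

Variables (Y : Omega -> T1) (X : Omega -> T2) (k : T1 -> probability T2 R).
Hypotheses (mY : measurable_fun setT Y) (mX : measurable_fun setT X)
  (mk : forall U : set T2, measurable U -> measurable_fun setT (fun x => k x U)).

Let mkY U : measurable U -> measurable_fun setT (fun w => k (Y w) U).
Proof. by move=> mU; exact: (measurableT_comp (mk mU) mY). Qed.

(** For fixed [B], the sets [C] that satisfy the identity form a Dynkin system. *)
Lemma conditional_law_generated (G : set (set T1)) :
  @measurable _ T1 = <<s G >> -> setI_closed G -> G setT ->
  (forall C B, G C -> measurable B ->
    P (Y @^-1` C `&` X @^-1` B) = \int[P]_(w in Y @^-1` C) k (Y w) B) ->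
  conditional_law Y X k.
Proof.
move=> GE GI GT H C B mC mB; move: (mC); rewrite GE => GC.
have mYC D : measurable D -> measurable (Y @^-1` D).
  by move=> mD; rewrite -[X in measurable X]setTI; exact: mY.
have mXB : measurable (X @^-1` B).
  by rewrite -[X in measurable X]setTI; exact: mX.
have bnd D : measurable D -> \int[P]_(w in Y @^-1` D) k (Y w) B < +oo.
  move=> mD; apply: (@le_lt_trans _ _ (\int[P]_(w in Y @^-1` D) 1)).
    apply: ge0_le_integral => //; first exact: mYC.
    - exact: measurable_funTS (mkY mB).
    - by move=> w _; exact: probability_le1.
  rewrite integral_cst ?mul1e; last exact: mYC.
  exact: (le_lt_trans (probability_le1 _ (mYC _ mD))) (ltry _).
move: C GC mC.
apply: (@dynkin_induction _ T1 G (fun C => measurable C ->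
    P (Y @^-1` C `&` X @^-1` B) = \int[P]_(w in Y @^-1` C) k (Y w) B)) => //.
- by move=> _; exact: H.
- by move=> C GC _; exact: H.
- move=> D mD /(_ mD) IH _.
  have hT := H _ _ GT mB.
  have e1 : P (Y @^-1` setT `&` X @^-1` B) =
    P (Y @^-1` D `&` X @^-1` B) + P (Y @^-1` (~` D) `&` X @^-1` B).
    rewrite -measureU//.
    + congr (P _); rewrite -setIUl; congr (_ `&` _).
      by rewrite -preimage_setU setUv.
    + by apply: measurableI => //; exact: mYC.
    + by apply: measurableI => //; apply: mYC; exact: measurableC.
    + by rewrite -subset0 => w [[? _] [? _]].
  have e2 : \int[P]_(w in Y @^-1` setT) k (Y w) B =
     \int[P]_(w in Y @^-1` D) k (Y w) B + \int[P]_(w in Y @^-1` (~` D)) k (Y w) B.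
    rewrite -ge0_integral_setU//.
    + by rewrite -preimage_setU setUv.
    + exact: mYC.
    + by apply: mYC; exact: measurableC.
    + rewrite -preimage_setU setUv; exact: mkY.
    + by apply/disj_set2P; rewrite -subset0 => w [? ?].
  have fin : \int[P]_(w in Y @^-1` D) k (Y w) B \is a fin_num.
    by rewrite ge0_fin_numE ?bnd// integral_ge0.
  (* For the complement, the value on [D] is subtracted from the value on the whole space; this is
     licit because it is finite. *)
  rewrite -[LHS](addeK _ fin) -[RHS](addeK _ fin); congr (_ - _).
  by rewrite -[in LHS]IH addeC -e1 hT e2 addeC.
- move=> F mF tF IH _.
  rewrite preimage_bigcup setI_bigcupl measure_bigcup//.
  + rewrite ge0_integral_bigcup//.
    * congr (limn _); apply/funext => n.
      by apply: eq_big => [i|i _]; [rewrite in_setT|rewrite /= IH].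
    * by move=> i; exact: mYC.
    * apply: measurable_funTS; exact: mkY.
    * move=> i j _ _ [w [? ?]]; apply: tF => //; by exists (Y w).
  + by move=> i _; apply: measurableI => //; exact: mYC.
  + move=> i j _ _ [w [[? _] [? _]]]; apply: tF => //; by exists (Y w).
Qed.

(** The law of (Y, X) is the mixture over w of the laws [kk w] of (Y w, z) with z drawn from
    [k (Y w)]: on rectangles this is the hypothesis, and rectangles form a generating pi-system. *)
Lemma ge0_disintegration (f : T1 * T2 -> \bar R) :
  conditional_law Y X k -> (forall z, 0 <= f z) -> measurable_fun setT f ->
  \int[P]_w f (Y w, X w) = \int[P]_w \int[k (Y w)]_z f (Y w, z).
Proof.
move=> H f0 mf.
have mYX : measurable_fun setT (fun w => (Y w, X w)).
  exact: measurable_fun_pair.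
have mpair w : measurable_fun setT (fun z : T2 => (Y w, z)).
  by apply: measurable_fun_pair => //; exact: measurable_cst.
pose kk w := law (k (Y w)) (mpair w).
have mkk U : measurable U -> measurable_fun setT (fun w => kk w U).
  move=> mU.
  have mx : measurable_fun setT (fun x => k x (xsection U x)).
    exact: (measurable_fun_xsection_finite_kernel (mkernel mk) (mem_set mU)).
  have := measurableT_comp mx mY; congr (measurable_fun _ _).
  apply/funext => w /=; rewrite /kk /law /distribution /pushforward/=.
  by congr (k _ _); rewrite xsectionE.
rewrite -[LHS](@ge0_integral_distribution _ _ _ _ _ P (mfun_of mYX) f)//.
rewrite (@ge0_integral_mixture _ _ _ _ _ P kk _
  [set A `*` B | A in measurable & B in measurable])//.
- apply: eq_integral => w _.
  by rewrite -[RHS](@ge0_integral_distribution _ _ _ _ _ (k (Y w))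
    (mfun_of (mpair w)) f).
- exact: measurable_prod_measurableType.
- move=> _ _ [A1 mA1 [A2 mA2 <-]] [B1 mB1 [B2 mB2 <-]].
  exists (A1 `&` B1); first exact: measurableI.
  by exists (A2 `&` B2); [exact: measurableI|rewrite setXI].
- by exists setT => //; exists setT => //; rewrite setXTT.
- move=> _ [A mA [B mB <-]].
  transitivity (P (Y @^-1` A `&` X @^-1` B)); first by [].
  rewrite H// integral_mkcond; apply: eq_integral => w _.
  rewrite patchE.
  change (kk w (A `*` B)) with (k (Y w) ((fun z => (Y w, z)) @^-1` (A `*` B))).
  case: ifPn => [/set_mem/= wA|/negP wA].
    by congr (k _ _); apply/seteqP; split => z//= -[].
  rewrite (_ : (fun z => (Y w, z)) @^-1` (A `*` B) = set0) ?measure0//.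
  by rewrite -subset0 => z [/= yA _]; apply: wA; exact: mem_set.
Qed.

End disintegration_theorems.

(** * The Euclidean norm and Borel sets of R^n *)

Section euclidean.
Context {R : realType} {n : nat}.
Implicit Types (u v w : 'rV[R]_n) (a : R).

Definition edot u v : R := \sum_(i < n) u ord0 i * v ord0 i.

Lemma edotC u v : edot u v = edot v u.
Proof. by apply: eq_bigr => i _; rewrite mulrC. Qed.

Lemma edotDl u v w : edot (u + v) w = edot u w + edot v w.
Proof. by rewrite -big_split; apply: eq_bigr => i _; rewrite mxE mulrDl. Qed.

Lemma edotZl a u v : edot (a *: u) v = a * edot u v.
Proof. by rewrite mulr_sumr; apply: eq_bigr => i _; rewrite mxE mulrA. Qed.

Lemma edotNl u v : edot (- u) v = - edot u v.
Proof. by rewrite -scaleN1r edotZl mulN1r. Qed.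

Lemma edotZr a u v : edot u (a *: v) = a * edot u v.
Proof. by rewrite edotC edotZl edotC. Qed.

Lemma edotNr u v : edot u (- v) = - edot u v.
Proof. by rewrite edotC edotNl edotC. Qed.

Lemma edotDr u v w : edot u (v + w) = edot u v + edot u w.
Proof. by rewrite edotC edotDl !(edotC _ u). Qed.

Lemma sqr_enorm u : enorm u ^+ 2 = edot u u.
Proof.
rewrite sqr_sqrtr; first by apply: eq_bigr => i _; rewrite expr2.
by apply: sumr_ge0 => i _; exact: sqr_ge0.
Qed.

Lemma enorm_ge0 u : 0 <= enorm u.
Proof. exact: sqrtr_ge0. Qed.

Lemma edot_ge0 u : 0 <= edot u u.
Proof. by rewrite -sqr_enorm sqr_ge0. Qed.

Lemma enormZ a u : enorm (a *: u) = `|a| * enorm u.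
Proof.
apply/eqP; rewrite -(@eqrXn2 _ 2%N)// ?mulr_ge0 ?enorm_ge0//.
by rewrite exprMn !sqr_enorm edotZl edotZr real_normK ?num_real// mulrA -expr2.
Qed.

Lemma enormN u : enorm (- u) = enorm u.
Proof. by rewrite -scaleN1r enormZ normrN1 mul1r. Qed.

Lemma enorm_distC u v : enorm (u - v) = enorm (v - u).
Proof. by rewrite -enormN opprB. Qed.

Lemma enorm0 : enorm (0 : 'rV[R]_n) = 0.
Proof. by rewrite -(scale0r 0) enormZ normr0 mul0r. Qed.

Lemma normr_coord_le u i : `|u ord0 i| <= enorm u.
Proof.
rewrite -ler_sqr ?nnegrE ?enorm_ge0// sqr_enorm real_normK ?num_real//.
rewrite /edot (bigD1 i)//= -expr2 lerDl.
by apply: sumr_ge0 => j _; rewrite -expr2 sqr_ge0.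
Qed.

Lemma enorm_eq0 u : enorm u = 0 -> u = 0.
Proof.
move=> u0; apply/rowP => i; rewrite mxE; apply/eqP; rewrite -normr_le0 -u0.
exact: normr_coord_le.
Qed.

(** Cauchy-Schwarz, from the nonnegativity of the squared norm of |v|^2 u - <u, v> v. *)
Lemma sqr_edot_le u v : edot u v ^+ 2 <= enorm u ^+ 2 * enorm v ^+ 2.
Proof.
have [v0|v0] := eqVneq (enorm v) 0.
  rewrite (enorm_eq0 v0) enorm0 expr0n mulr0.
  by rewrite -(scale0r 0) edotZr mul0r expr0n.
have vp : 0 < enorm v ^+ 2 by rewrite exprn_gt0// lt_def v0 enorm_ge0.
rewrite -(ler_pM2r vp) -subr_ge0.
have := edot_ge0 (enorm v ^+ 2 *: u - edot u v *: v).
rewrite !(edotDl, edotDr, edotNl, edotNr, edotZl, edotZr) -!sqr_enorm.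
rewrite (edotC v u); set a := edot u v; set b := enorm v; set c := enorm u.
by congr (_ <= _); ring.
Qed.

Lemma normr_edot_le u v : `|edot u v| <= enorm u * enorm v.
Proof.
rewrite -ler_sqr ?nnegrE ?mulr_ge0 ?enorm_ge0// exprMn real_normK ?num_real//.
exact: sqr_edot_le.
Qed.

Lemma enormD u v : enorm (u + v) <= enorm u + enorm v.
Proof.
rewrite -ler_sqr ?nnegrE ?addr_ge0 ?enorm_ge0// sqr_enorm.
rewrite edotDl !edotDr (edotC v u) -!sqr_enorm.
have := le_trans (ler_norm _) (normr_edot_le u v).
set a := edot u v; set b := enorm v; set c := enorm u => h.
by rewrite sqrrD; lra.
Qed.

Lemma enorm_triangle w u v : enorm (u - v) <= enorm (u - w) + enorm (w - v).
Proof.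
by apply: le_trans (enormD _ _); rewrite addrA subrK.
Qed.

(** Passes from coordinatewise bounds, hence from sup-norm balls and rational approximations, to the
    Euclidean norm at the price of a factor [n]. *)
Lemma enorm_le_sum u : enorm u <= \sum_(i < n) `|u ord0 i|.
Proof.
have {1}-> : u = \sum_(i < n) u ord0 i *: delta_mx ord0 i.
  exact: row_sum_delta.
have e1 i : enorm (delta_mx ord0 i : 'rV[R]_n) = 1.
  apply/eqP; rewrite -(@eqrXn2 _ 2%N)// ?enorm_ge0// sqr_enorm expr1n /edot.
  rewrite (bigD1 i)//= big1 ?mxE ?eqxx ?mulr1 ?addr0// => j ji.
  by rewrite mxE (negPf ji) andbF mul0r.
elim/big_rec2 : _ => [|i x y _ IH]; first by rewrite enorm0.
by apply: (le_trans (enormD _ _)); rewrite enormZ e1 mulr1 lerD2l.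
Qed.

End euclidean.

Section borelRV.
Context {R : realType} {n : nat}.

Lemma continuous_measurable_borelRV (f : 'rV[R]_n -> R) :
  continuous f -> measurable_fun [set: borelRV R n] f.
Proof.
move=> cf; apply: (measurability _ (RGenOpens.measurableE R)).
move=> _ [_ [a [b ->]] <-]; rewrite setTI.
by apply: sub_sigma_algebra; apply: open_comp => // x _; exact: cf.
Qed.

Lemma measurable_coord (i : 'I_n) :
  measurable_fun [set: borelRV R n] (fun x : 'rV[R]_n => x ord0 i).
Proof. by apply: continuous_measurable_borelRV; exact: coord_continuous. Qed.

Lemma rat_approx (x : 'rV[R]_n) (r : R) : 0 < r ->
  exists q : 'rV[rat]_n, forall i, `|x ord0 i - ratr (q ord0 i)| < r.
Proof.
move=> r0.
have h i : exists q : rat, `|x ord0 i - ratr q| < r.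
  have /rat_in_itvoo[q /[!in_itv]/= /andP[q1 q2]] : x ord0 i - r < x ord0 i.
    by rewrite ltrBlDr ltrDl.
  by exists q; rewrite ger0_norm ?subr_ge0 ?ltW// ltrBlDr -ltrBlDl.
have [g hg] := choice h.
by exists (\row_i g i) => i; rewrite mxE.
Qed.

Definition box (B : 'I_n -> set R) : set 'rV[R]_n :=
  [set x | forall i, B i (x ord0 i)].

(** The events on which [std_normal] prescribes a law. They form a pi-system generating the Borel
    sets, so they determine it. *)
Definition boxes : set (set (borelRV R n)) :=
  [set box B | B in [set B | forall i, measurable (B i)]].

(** An open set is the union of the rational cubes that it contains, and there are countably many of
    them. *)
Lemma measurable_fun_borelRV {d : measure_display} {T : measurableType d}
    (X : T -> borelRV R n) :
  (forall i, measurable_fun setT (fun t => (X t : 'rV[R]_n) ord0 i)) ->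
  measurable_fun setT X.
Proof.
move=> mX.
apply: (@measurability _ _ T (borelRV R n) setT X (@open 'rV[R]_n)) => //.
move=> _ [U oU <-]; rewrite setTI.
pose sq (qm : 'rV[rat]_n * nat) : set 'rV[R]_n :=
  [set x | forall i, `|x ord0 i - ratr (qm.1 ord0 i)| < qm.2.+1%:R^-1].
pose F qm := if `[< sq qm `<=` U >] then X @^-1` sq qm else set0.
have -> : X @^-1` U = \bigcup_qm F qm.
  apply/seteqP; split => [t Xt|t [qm _]]; rewrite /F; last first.
    by case: asboolP => // sqU /sqU.
  have := oU; rewrite openE => /(_ _ Xt)/nbhs_ballP[e /= e0 eU].
  (* Half of [e], because two points of one cube are compared through its centre. *)
  have [m me] : exists m : nat, m.+1%:R^-1 < e / 2.
    have e2 : 0 < e / 2 by rewrite divr_gt0.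
    have [m _ /(_ m (leqnn _))] := near_infty_natSinv_lt (PosNum e2).
    by exists m.
  have [q hq] := rat_approx (X t) (r := m.+1%:R^-1) ltac:(by []).
  exists (q, m) => //=; case: asboolP => //; case => y yq; apply: eU.
  split=> // i j; rewrite (ord1 i) -ball_normE /=.
  rewrite (_ : _ - _ = (X t ord0 j - ratr (q ord0 j)) - (y ord0 j - ratr (q ord0 j)));
    last by rewrite opprB addrA subrK.
  apply: (le_lt_trans (ler_normB _ _)); rewrite [e]splitr ltrD//.
    exact: lt_trans (hq j) me.
  exact: lt_trans (yq j) me.
apply: countable_bigcupT_measurable => // qm; rewrite /F.
case: asboolP => _; last exact: measurable0.
rewrite (_ : _ @^-1` _ = \bigcap_(i in [set: 'I_n])
   ((fun t => (X t : 'rV[R]_n) ord0 i) @^-1`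
     [set y | `|y - ratr (qm.1 ord0 i)| < qm.2.+1%:R^-1])); last first.
  by apply/seteqP; split => [t h i _|t h i]; [exact: h|exact: h i I].
apply: fin_bigcap_measurable => // i _.
rewrite -[X in measurable X]setTI; apply: mX => //.
rewrite (_ : [set y | _] = ball_ Num.Def.normr (ratr (qm.1 ord0 i)) qm.2.+1%:R^-1).
  by rewrite ball_normE ball_itv; exact: measurable_itv.
by apply/funext => y /=; rewrite distrC.
Qed.

Lemma measurable_box (B : 'I_n -> set R) : (forall i, measurable (B i)) ->
  measurable (box B : set (borelRV R n)).
Proof.
move=> mB; rewrite (_ : box B = \bigcap_(i in [set: 'I_n])
   ((fun x : 'rV[R]_n => x ord0 i) @^-1` (B i))); last first.
  by apply/seteqP; split => [t h i _|t h i]; [exact: h|exact: h i I].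
apply: fin_bigcap_measurable => // i _.
by rewrite -[X in measurable X]setTI; exact: measurable_coord.
Qed.

Lemma measurable_borelRV : @measurable _ (borelRV R n) = <<s boxes >>.
Proof.
apply/seteqP; split => [U mU|]; last first.
  apply: smallest_sub; first exact: sigma_algebra_measurable.
  by move=> _ [B mB <-]; exact: measurable_box.
(* The remaining inclusion says that the identity is measurable from the sigma-algebra generated by
   boxes, and this can be checked on coordinates. *)
have h : measurable_fun [set: g_sigma_algebraType boxes]
    (id : g_sigma_algebraType boxes -> borelRV R n).
  apply: measurable_fun_borelRV => i _ B mB; rewrite setTI.
  apply: sub_sigma_algebra.
  exists (fun j => if j == i then B else setT) => [j /=|].
    by case: ifP => // _; exact: measurableT.
  apply/seteqP; split => t /=; first by move/(_ i); rewrite eqxx.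
  by move=> Bt j; case: eqP => // ->.
by have := h measurableT U mU; rewrite setTI.
Qed.

Lemma setI_closed_boxes : setI_closed boxes.
Proof.
move=> _ _ [A mA <-] [B mB <-]; exists (fun i => A i `&` B i).
  by move=> i; exact: measurableI.
apply/seteqP; split => [t h|t [h1 h2] i]; last by split; [exact: h1|exact: h2].
by split => i; have [] := h i.
Qed.

Lemma boxesT : boxes setT.
Proof. by exists (fun=> setT) => //; apply/seteqP; split. Qed.

End borelRV.

(** * Lipschitz functions and measurability on R^n *)

Section lipschitz.
Context {R : realType} {n : nat}.
Local Notation "x ``_ i" := ((x : 'rV[R]_n) ord0 i)
  (at level 3, i at level 2, left associativity).

Lemma lipschitz_continuous (g : 'rV[R]_n -> R) (L : R) :
  (forall x y, `|g x - g y| <= L * enorm (x - y)) -> continuous g.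
Proof.
move=> gL x; apply/(@cvgrPdist_le _ _ _ _ (nbhs_filter x)) => e e0.
(* The absolute value is there because [L] may be negative, the factor [n] comes from comparing the
   two norms, and the [+ 1] keeps [K] positive. *)
pose K : R := `|L| * n%:R + 1.
have K0 : 0 < K by rewrite ltr_wpDl// mulr_ge0.
apply/nbhs_ballP; exists (e / K) => /=; first by rewrite divr_gt0.
move=> y [_ xy]; apply: (le_trans (gL x y)).
have e1 : enorm (x - y) <= n%:R * (e / K).
  apply: (le_trans (enorm_le_sum _)).
  rewrite mulr_natl -[n in _ *+ n]card_ord -sumr_const; apply: ler_sum => i _.
  have := xy ord0 i; rewrite -ball_normE /= => /ltW.
  by rewrite !mxE.
apply: (@le_trans _ _ (`|L| * (n%:R * (e / K)))).
  apply: (@le_trans _ _ (`|L| * enorm (x - y))).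
    by rewrite ler_wpM2r ?enorm_ge0// ler_norm.
  by rewrite ler_wpM2l.
rewrite (_ : `|L| * _ = e * ((`|L| * n%:R) / K)); last first.
  by rewrite !mulrA -(mulrA e) [e * _]mulrC.
by rewrite ger_pMr// ler_pdivrMr// mul1r /K lerDl.
Qed.

Lemma measurable_lipschitz (g : 'rV[R]_n -> R) (L : R) :
  (forall x y, `|g x - g y| <= L * enorm (x - y)) ->
  measurable_fun [set: borelRV R n] g.
Proof.
by move=> gL; exact: continuous_measurable_borelRV (lipschitz_continuous gL).
Qed.

Lemma lipschitz_enorm (q x y : 'rV[R]_n) :
  `|enorm (x - q) - enorm (y - q)| <= 1 * enorm (x - y).
Proof.
have h1 := enorm_triangle x y q; have h2 := enorm_triangle y x q.
by rewrite (enorm_distC y x) in h1; rewrite mul1r ler_norml; lra.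
Qed.

Lemma measurable_enorm : measurable_fun [set: borelRV R n] (@enorm R n).
Proof.
apply: (@measurable_lipschitz _ 1) => x y.
by have := lipschitz_enorm 0 x y; rewrite !subr0.
Qed.

(* A Lipschitz function is the infimum of its cones [f q + L |x - q|] over the
   rational points q. *)
Lemma measurable_lipschitz_partial {d} {T : measurableType d}
    (f : 'rV[R]_n -> T -> R) (L : R) :
  (forall t x y, `|f x t - f y t| <= L * enorm (x - y)) ->
  (forall x, measurable_fun setT (f x)) ->
  measurable_fun [set: borelRV R n * T] (fun z => f z.1 z.2).
Proof.
move=> fL mf; apply: (measurability _ (RGenInftyO.measurableE R)).
move=> _ [_ [r ->] <-]; rewrite setTI.
pose rv (q : 'rV[rat]_n) : 'rV[R]_n := map_mx ratr q.
pose A q : set (borelRV R n * T) :=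
  [set z | f (rv q) z.2 + L * enorm ((z.1 : 'rV[R]_n) - rv q) < r].
have -> : (fun z : borelRV R n * T => f z.1 z.2) @^-1` `]-oo, r[%classic = \bigcup_q A q.
  apply/seteqP; split => [[x t]|[x t] [q _]]; rewrite /preimage /= in_itv/=; last first.
    apply: le_lt_trans; rewrite -lerBlDl.
    exact: le_trans (ler_norm _) (fL _ _ _).
  move=> fr.
  (* The factor 2 counts |x - q| once for the value of the function at [q] and once for the slope of
     the cone. *)
  pose K : R := 2 * `|L| * n%:R + 1.
  have K0 : 0 < K by rewrite ltr_wpDl// !mulr_ge0.
  have [q hq] := rat_approx x (r := (r - f x t) / K) ltac:(by rewrite divr_gt0 ?subr_gt0).
  exists q => //=; rewrite /A /=.
  have e1 : enorm (x - rv q) <= n%:R * ((r - f x t) / K).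
    apply: (le_trans (enorm_le_sum _)).
    rewrite mulr_natl -[n in _ *+ n]card_ord -sumr_const; apply: ler_sum => i _.
    by rewrite !mxE; exact: ltW.
  have e2 : L * enorm (x - rv q) <= `|L| * (n%:R * ((r - f x t) / K)).
    apply: (@le_trans _ _ (`|L| * enorm (x - rv q))).
      by rewrite ler_wpM2r ?enorm_ge0// ler_norm.
    by rewrite ler_wpM2l.
  have e3 : f (rv q) t - f x t <= L * enorm (x - rv q).
    by rewrite enorm_distC; exact: le_trans (ler_norm _) (fL _ _ _).
  have e4 : 2 * (`|L| * (n%:R * ((r - f x t) / K))) < r - f x t.
    rewrite (_ : 2 * _ = (r - f x t) * ((2 * `|L| * n%:R) / K)); last by ring.
    rewrite gtr_pMr ?subr_gt0// ltr_pdivrMr// mul1r /K ltrDl//.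
  by lra.
apply: countable_bigcupT_measurable => // q; rewrite -[X in measurable X]setTI.
have mfq : measurable_fun [set: borelRV R n * T] (fun z => f (rv q) z.2 + L * enorm ((z.1 : 'rV[R]_n) - rv q)).
  apply: measurable_funD; first exact: (measurableT_comp (mf (rv q)) measurable_snd).
  apply: measurable_funM => //.
  have mq := @measurable_lipschitz (fun x => enorm (x - rv q)) 1 (lipschitz_enorm (rv q)).
  exact: (measurableT_comp mq measurable_fst).
have := mfq measurableT `]-oo, r[%classic (measurable_itv _).
by congr (measurable (_ `&` _)); apply/seteqP; split => z /=; rewrite in_itv.
Qed.

Context {d : measure_display} {T : measurableType d}.
Implicit Types (X Y : T -> borelRV R n) (a : T -> R).

Lemma measurable_funZ_borelRV a X :
  measurable_fun setT a -> measurable_fun setT X ->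
  measurable_fun setT (fun t => a t *: (X t : 'rV[R]_n) : borelRV R n).
Proof.
move=> ma mX; apply: measurable_fun_borelRV => i.
rewrite (_ : (fun _ => _) = (fun t => a t * (X t) ``_ i)); last first.
  by apply/funext => t; rewrite mxE.
apply: measurable_funM => //; exact: (measurableT_comp (measurable_coord i) mX).
Qed.

Lemma measurable_funD_borelRV X Y :
  measurable_fun setT X -> measurable_fun setT Y ->
  measurable_fun setT (fun t => (X t : 'rV[R]_n) + (Y t : 'rV[R]_n) : borelRV R n).
Proof.
move=> mX mY; apply: measurable_fun_borelRV => i.
rewrite (_ : (fun _ => _) = (fun t => (X t) ``_ i + (Y t) ``_ i)); last first.
  by apply/funext => t; rewrite mxE.
by apply: measurable_funD; [exact: (measurableT_comp (measurable_coord i) mX)|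
  exact: (measurableT_comp (measurable_coord i) mY)].
Qed.

Lemma measurable_fun_edot X Y :
  measurable_fun setT X -> measurable_fun setT Y ->
  measurable_fun setT (fun t => edot (X t) (Y t)).
Proof.
move=> mX mY; apply: measurable_sum => i; apply: measurable_funM.
  exact: (measurableT_comp (measurable_coord i) mX).
exact: (measurableT_comp (measurable_coord i) mY).
Qed.

End lipschitz.

(** * Wasserstein-Lipschitz families of laws are kernels *)

Section wasserstein_kernel.
Context {R : realType} {p : nat}.
Implicit Types (Q : probability (borelRV R p) R) (phi : 'rV[R]_p -> R).

Lemma measurable_enorm_sub : measurable_fun [set: borelRV R p * borelRV R p]
  (fun z => enorm ((z.1 : 'rV[R]_p) - z.2)).
Proof.
apply: (@measurable_lipschitz_partial R p _ (borelRV R p)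
  (fun x (y : 'rV[R]_p) => enorm (x - y)) 1) => [y x x'|x].
  exact: lipschitz_enorm.
apply: (@measurable_lipschitz _ _ _ 1) => y y'.
by rewrite (enorm_distC x y) (enorm_distC x y') lipschitz_enorm.
Qed.

(** The easy half of Kantorovich-Rubinstein duality: the inequality phi x <= phi y + L |x - y| is
    integrated against an almost optimal coupling. Nonnegativity of [phi] dispenses with
    integrability. *)
Lemma wasserstein_integral_le Q Q' phi (L c : R) :
  0 <= L -> (forall x, 0 <= phi x) ->
  (forall x y, `|phi x - phi y| <= L * enorm (x - y)) ->
  (wasserstein1 Q Q' <= c%:E)%E ->
  (\int[Q]_x (phi x)%:E <= \int[Q']_x (phi x)%:E + (L * c)%:E)%E.
Proof.
move=> L0 phi0 phiL Wc; apply/lee_addgt0Pr => e e0.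
have mphi : measurable_fun [set: borelRV R p] (EFin \o phi).
  by apply/measurable_EFinP; exact: measurable_lipschitz phiL.
(* The excess cost [e'] of the coupling is multiplied by [L]; the [+ 1] avoids a division by 0. *)
pose e' := e / (L + 1).
have L1 : 0 < L + 1 by rewrite ltr_wpDl.
have e'0 : 0 < e' by rewrite divr_gt0.
have [] := @ereal_inf_lt _ _ (c + e')%:E (le_lt_trans Wc _).
  by rewrite lte_fin ltrDl.
move=> _ [pi pic <-] pilt.
have i1 : (\int[Q]_x (phi x)%:E = \int[pi]_z (phi z.1)%:E)%E.
  rewrite -[RHS](@ge0_integral_distribution _ _ _ _ _ pi
    (mfun_of measurable_fst) (EFin \o phi))//.
  apply: eq_measure_integral => A mA _; apply: etrans (esym (pic A mA).1) _.
  by congr (pi _); apply/seteqP; split => -[x y] //= [].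
have i2 : (\int[Q']_x (phi x)%:E = \int[pi]_z (phi z.2)%:E)%E.
  rewrite -[RHS](@ge0_integral_distribution _ _ _ _ _ pi
    (mfun_of measurable_snd) (EFin \o phi))//.
  apply: eq_measure_integral => A mA _; apply: etrans (esym (pic A mA).2) _.
  by congr (pi _); apply/seteqP; split => -[x y] //= [].
have mn : measurable_fun setT (fun z : borelRV R p * borelRV R p =>
    (enorm ((z.1 : 'rV[R]_p) - z.2))%:E).
  by apply/measurable_EFinP; exact: measurable_enorm_sub.
have m2 : measurable_fun setT (fun z : borelRV R p * borelRV R p =>
    (phi z.2)%:E) by exact: (measurableT_comp mphi measurable_snd).
have m1 : measurable_fun setT (fun z : borelRV R p * borelRV R p =>
    (phi z.1)%:E) by exact: (measurableT_comp mphi measurable_fst).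
rewrite i1 i2; apply: (@le_trans _ _ (\int[pi]_z ((phi z.2)%:E +
    L%:E * (enorm ((z.1 : 'rV[R]_p) - z.2))%:E))%E).
  apply: ge0_le_integral => //.
  - by move=> z _; rewrite lee_fin.
  - by apply: emeasurable_funD => //; exact: measurable_funeM.
  - move=> z _; rewrite -EFinM -EFinD lee_fin -lerBlDl.
    exact: le_trans (ler_norm _) (phiL _ _).
rewrite ge0_integralD//; last 3 first.
- by move=> z _; rewrite lee_fin.
- by move=> z _; rewrite -EFinM lee_fin mulr_ge0 ?enorm_ge0.
- exact: measurable_funeM.
rewrite ge0_integralZl_EFin//; last by move=> z _; rewrite lee_fin enorm_ge0.
have h : (L%:E * \int[pi]_z (enorm ((z.1 : 'rV[R]_p) - z.2))%:E <=
    (L * c)%:E + e%:E)%E.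
  apply: (@le_trans _ _ (L%:E * (c + e')%:E)%E).
    by rewrite lee_wpmul2l ?lee_fin// ltW.
  rewrite -EFinM -EFinD lee_fin mulrDr lerD2l /e' mulrCA.
  by rewrite ger_pMr// ler_pdivrMr// mul1r lerDl.
by rewrite -[leRHS]addeA; exact: (leeD2l _ h).
Qed.

Section dist.
Variable U : set 'rV[R]_p.
Hypotheses (oU : open U) (U0 : ~` U !=set0).

Let dset x := [set enorm (x - y) | y in ~` U].
Let dU x := inf (dset x).

Let dset_inf x : has_inf (dset x).
Proof.
split; first by have [y yU] := U0; exists (enorm (x - y)), y.
by exists 0 => _ [y _ <-]; exact: enorm_ge0.
Qed.

Let dU_ge0 x : 0 <= dU x.
Proof.
by apply: lb_le_inf; [exact: (dset_inf x).1|move=> _ [y _ <-]; exact: enorm_ge0].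
Qed.

Let dU_lip x y : dU x - dU y <= enorm (x - y).
Proof.
rewrite lerBlDr -lerBlDl; apply: lb_le_inf; first exact: (dset_inf y).1.
move=> _ [z zU <-]; rewrite lerBlDl.
apply: le_trans (enorm_triangle y x z).
by apply: ge_inf; [exact: (dset_inf x).2|exists z].
Qed.

Let dU_out x : ~ U x -> dU x = 0.
Proof.
move=> Ux; apply/eqP; rewrite eq_le dU_ge0 andbT.
apply: ge_inf; first exact: (dset_inf x).2.
by exists x => //; rewrite subrr enorm0.
Qed.

Let dU_in x : U x -> 0 < dU x.
Proof.
move=> Ux; have := oU; rewrite openE => /(_ _ Ux)/nbhs_ballP[e /= e0 eU].
apply: (lt_le_trans e0); apply: lb_le_inf; first exact: (dset_inf x).1.
move=> _ [y yU <-]; rewrite leNgt; apply/negP => xy; apply: yU; apply: eU.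
split=> // i j; rewrite (ord1 i) -ball_normE /=.
by apply: le_lt_trans xy; have := normr_coord_le (x - y) j; rewrite !mxE.
Qed.

(** The witness is the minimum of 1 and n times the Euclidean distance to the complement. That
    distance is 1-Lipschitz, vanishes outside [U] and is positive inside because [U] is open. *)
Lemma open_lipschitz_approx : exists phi : nat -> 'rV[R]_p -> R,
  [/\ forall n x, 0 <= phi n x <= 1,
      forall n x y, `|phi n x - phi n y| <= n%:R * enorm (x - y),
      forall x, {homo phi^~ x : m n / (m <= n)%N >-> m <= n}
    & forall x, \forall n \near \oo, phi n x = \1_U x].
Proof.
exists (fun n x => Num.min 1 (n%:R * dU x)); split.
- by move=> n x; rewrite le_min ler01 mulr_ge0//= ge_min lexx.
- have h n x y : Num.min 1 (n%:R * dU x) - Num.min 1 (n%:R * dU y) <= n%:R * enorm (x - y).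
    have nn : 0 <= n%:R * enorm (x - y) by rewrite mulr_ge0 ?enorm_ge0.
    rewrite lerBlDr addrC -lerBlDr le_min; apply/andP; split.
      by rewrite lerBlDr (@le_trans _ _ 1)// ?ge_min ?lexx// lerDl.
    rewrite lerBlDr (@le_trans _ _ (n%:R * dU x))// ?ge_min ?lexx ?orbT//.
    by rewrite -mulrDr ler_wpM2l// -lerBlDl dU_lip.
  move=> n x y; rewrite ler_norml h andbT lerNl opprB.
  by rewrite enorm_distC; exact: h.
- move=> x m n mn; rewrite le_min ge_min lexx/= ge_min; apply/orP; right.
  by rewrite ler_wpM2r// ler_nat.
- move=> x; rewrite indicE; case: (asboolP (U x)) => Ux.
    rewrite mem_set//; near=> n.
    rewrite (min_idPl _)// -ler_pdivrMr ?dU_in// mul1r.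
    near: n; exact: nbhs_infty_ger.
  by rewrite memNset//; near=> n; rewrite dU_out// mulr0 (min_idPr _).
Unshelve. all: by end_near. Qed.

End dist.

(* For open U, D x U is the increasing limit of integrals of Lipschitz functions,
   which are Lipschitz in x; the pi-lambda theorem extends this to Borel sets. *)
Lemma measurable_wasserstein_kernel {d : nat}
    (D : 'rV[R]_d -> probability (borelRV R p) R) (alpha : R) :
  (forall x x', (wasserstein1 (D x) (D x') <= (alpha * enorm (x - x'))%:E)%E) ->
  forall U, measurable U -> measurable_fun [set: borelRV R d] (fun x => D x U).
Proof.
move=> DW.
have mopen (U : set 'rV[R]_p) : open U ->
    measurable_fun [set: borelRV R d] (fun x => D x U).
  (* The whole space is treated apart, since the distance to an empty complement is an infimum over
     the empty set. *)
  move=> oU; have [U0|/set0P U0] := eqVneq (~` U) set0.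
    rewrite (_ : U = setT); last by rewrite -[U]setCK U0 setC0.
    rewrite (_ : (fun _ => _) = cst 1%E); first exact: measurable_cst.
    by apply/funext => x; rewrite probability_setT.
  have [phi [phi01 phiL ndphi phi1]] := open_lipschitz_approx oU U0.
  have mphi n : measurable_fun [set: borelRV R p] (EFin \o phi n).
    by apply/measurable_EFinP; exact: measurable_lipschitz (phiL n).
  apply: (@emeasurable_fun_cvg _ (borelRV R d) R setT
    (fun n x => \int[D x]_y (phi n y)%:E)%E).
    move=> n.
    have fin x : (\int[D x]_y (phi n y)%:E \is a fin_num)%E.
      rewrite ge0_fin_numE; last first.
        by apply: integral_ge0 => y _; rewrite lee_fin; have /andP[] := phi01 n y.
      apply: (@le_lt_trans _ _ (\int[D x]_y 1)%E).
        apply: ge0_le_integral => //.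
        + by move=> y _; rewrite lee_fin; have /andP[] := phi01 n y.
        + exact: mphi.
        + by move=> y _; rewrite lee_fin; have /andP[] := phi01 n y.
      rewrite integral_cst// mul1e; apply: (@le_lt_trans _ _ 1%E); last exact: ltry.
      exact: probability_le1.
    rewrite (_ : (fun _ => _) =
      EFin \o (fun x => fine (\int[D x]_y (phi n y)%:E))%E); last first.
      by apply/funext => x; rewrite /= fineK.
    apply/measurable_EFinP.
    have h x x' : fine (\int[D x]_y (phi n y)%:E)%E - fine (\int[D x']_y (phi n y)%:E)%E
       <= (n%:R * alpha) * enorm (x - x').
      rewrite lerBlDl -lee_fin EFinD !fineK// -mulrA.
      apply: wasserstein_integral_le => // y; by have /andP[] := phi01 n y.
    apply: (@measurable_lipschitz _ _ _ (n%:R * alpha)) => x x'.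
    by rewrite ler_norml h andbT lerNl opprB enorm_distC; exact: h.
  move=> x _.
  rewrite [X in _ --> X](_ : _ = \int[D x]_y limn (fun n => (phi n y)%:E))%E.
    apply: cvg_monotone_convergence => //.
    - by move=> n y _; rewrite lee_fin; have /andP[] := phi01 n y.
    - by move=> y _ m n mn; rewrite lee_fin ndphi.
  rewrite -[LHS]mul1e -[U in LHS]setIT -integral_indic//; last first.
    exact: sub_sigma_algebra.
  rewrite mul1e; apply: eq_integral => y _; apply/esym/cvg_lim => //.
  apply: cvg_near_cst; have := phi1 y; apply: filterS => n ->//.
move=> U mU.
apply: (@dynkin_induction _ (borelRV R p) (@open 'rV[R]_p)
  (fun U => measurable_fun [set: borelRV R d] (fun x => D x U))) => //.
- by move=> A B oA oB; exact: openI.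
- by apply: mopen; exact: openT.
- move=> S mS mDS.
  rewrite (_ : (fun _ => _) = (fun x => 1 - D x S)%E).
    exact: emeasurable_funB.
  by apply/funext => x; rewrite probability_setC.
- move=> F mF tF IH.
  rewrite (_ : (fun _ => _) = (fun x => \sum_(0 <= i <oo) D x (F i))%E).
    by apply: ge0_emeasurable_sum.
  apply/funext => x; rewrite measure_bigcup//; congr (limn _).
  by apply/funext => n; apply: eq_bigl => i; rewrite in_setT.
Qed.

End wasserstein_kernel.

(** * Gaussian moments *)

Section density.
Context {d : measure_display} {T : measurableType d} {R : realType}.
Variables (mu nu : {measure set T -> \bar R}) (g : T -> R).
Hypotheses (g0 : forall x, 0 <= g x) (mg : measurable_fun setT g)
  (nuE : forall A, measurable A -> nu A = (\int[mu]_(x in A) (g x)%:E)%E).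
Local Open Scope ereal_scope.
Import HBNNSimple.

Let mgE : measurable_fun setT (EFin \o g). Proof. exact/measurable_EFinP. Qed.

Let integral_density_indic E : measurable E ->
  \int[nu]_x (\1_E x)%:E = \int[mu]_x ((\1_E x)%:E * (g x)%:E).
Proof.
move=> mE; rewrite integral_indic// setIT nuE// integral_mkcond.
apply: eq_integral => x _; rewrite patchE indicE; case: ifPn => _.
  by rewrite mul1e.
by rewrite mul0e.
Qed.

Let integral_density_nnsfun (f : {nnsfun T >-> R}) :
  \int[nu]_x (f x)%:E = \int[mu]_x ((f x)%:E * (g x)%:E).
Proof.
under [LHS]eq_integral do rewrite fimfunE -fsumEFin//.
rewrite [LHS]ge0_integral_fsum//; last 2 first.
  - by move=> r; exact/measurable_EFinP/measurableT_comp.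
  - by move=> n x _; rewrite EFinM nnfun_muleindic_ge0.
under [RHS]eq_integral.
  move=> x xD; rewrite fimfunE -fsumEFin// muleC ge0_mule_fsumr; last first.
    by move=> r; rewrite EFinM nnfun_muleindic_ge0.
  over.
rewrite [RHS]ge0_integral_fsum//; last 2 first.
  - move=> r; apply: emeasurable_funM => //.
    by apply/measurable_EFinP; exact: measurableT_comp.
  - move=> n x _; apply: mule_ge0; first by rewrite lee_fin.
    by rewrite EFinM nnfun_muleindic_ge0.
apply: eq_fsbigr => r _; have [r0|r0] := leP 0%R r; last first.
  rewrite preimage_nnfun0// integral0_eq ?integral0_eq// => x _.
    by rewrite indic0 mulr0 mule0.
  by rewrite indic0 mulr0.
under [RHS]eq_integral do rewrite EFinM muleCA [X in _ * X]muleC.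
under [LHS]eq_integral do rewrite EFinM.
rewrite ge0_integralZl_EFin//.
- rewrite [RHS]ge0_integralZl_EFin//; first by rewrite integral_density_indic.
  + by move=> x _; rewrite mule_ge0// lee_fin.
  + by apply: emeasurable_funM => //; exact/measurable_EFinP.
- exact/measurable_EFinP.
Qed.

(** Goes from indicators to simple functions to monotone limits. Besides the normal density, it
    serves with an indicator as density, for the restriction of a probability to an event, and with
    a product of conditional probabilities. *)
Lemma ge0_integral_density (f : T -> \bar R) :
  measurable_fun setT f -> (forall x, 0 <= f x) ->
  \int[nu]_x f x = \int[mu]_x (f x * (g x)%:E).
Proof.
move=> mf f0; pose f_ := nnsfun_approx measurableT mf.
transitivity (lim (\int[nu]_x (f_ n x)%:E @[n --> \oo])).
  rewrite -monotone_convergence//=.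
  - apply: eq_integral => x _; apply/esym/cvg_lim => //=.
    exact: cvg_nnsfun_approx.
  - by move=> n; exact/measurable_EFinP/measurable_funTS.
  - by move=> n x _; rewrite lee_fin.
  - by move=> x _ m n mn; rewrite lee_fin; exact/lefP/nd_nnsfun_approx.
transitivity (lim (\int[mu]_x ((f_ n x)%:E * (g x)%:E) @[n --> \oo])).
  by apply: congr_lim; apply/funext => n /=; exact: integral_density_nnsfun.
rewrite -monotone_convergence//=.
- apply: eq_integral => x _; apply/cvg_lim => //=.
  by apply: cvgeZr => //; exact: cvg_nnsfun_approx.
- by move=> n; apply: emeasurable_funM => //; exact/measurable_EFinP.
- by move=> n x _; rewrite mule_ge0// lee_fin.
- move=> x _ m n mn; rewrite lee_wpmul2r ?lee_fin//.
  exact/lefP/nd_nnsfun_approx.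
Qed.

End density.

Section gaussian_moments.
Context {R : realType}.
Local Notation N01 := (@normal_prob R 0 1).

(* Tilting the density of N(0, 1) by [expR (t x^2 / 2)] with [t = 1 - 1/s^2]
   gives [s] times the density of N(0, s^2). *)
Lemma integral_normal_tilt (s : R) : 0 < s ->
  (\int[N01]_x (expR ((1 - s ^- 2) * x ^+ 2 / 2))%:E = s%:E)%E.
Proof.
move=> s0; have s0' : s != 0 by rewrite gt_eqF.
rewrite (@ge0_integral_density _ _ _ lebesgue_measure _ (normal_pdf 0 1))//.
- transitivity (\int[lebesgue_measure]_x (s%:E * (normal_pdf 0 s x)%:E))%E.
    apply: eq_integral => x _; rewrite -!EFinM !normal_pdfE ?oner_eq0//; congr _%:E.
    have e1 : normal_peak 1 = s * normal_peak s :> R.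
      rewrite /normal_peak expr1n mul1r -mulrnAr sqrtrM ?sqr_ge0// sqrtr_sqr.
      by rewrite gtr0_norm// invfM mulVKf.
    have e2 : expR ((1 - s ^- 2) * x ^+ 2 / 2) * normal_fun 0 1 x = normal_fun 0 s x.
      rewrite /normal_fun !subr0 -expRD; congr expR.
      by rewrite expr1n -[s ^+ 2 *+ 2]mulr_natr; field.
    by rewrite mulrCA e2 e1 mulrA.
  rewrite ge0_integralZl_EFin//.
  + by rewrite integral_normal_pdf mule1.
  + by move=> x _; rewrite lee_fin normal_pdf_ge0.
  + by apply/measurable_EFinP; exact: measurable_normal_pdf.
  + exact: ltW.
- by move=> x; exact: normal_pdf_ge0.
- exact: measurable_normal_pdf.
- apply/measurable_EFinP; apply: measurableT_comp => //.
  apply: measurable_funM => //; exact: measurable_funM.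
Qed.

Lemma expR_ge_quadratic (x : R) : 0 <= x -> 1 + x + x ^+ 2 / 2 <= expR x.
Proof.
move=> x0.
have := nondecreasing_cvgn_le _ (is_cvg_series_exp_coeff x) 3.
rewrite seriesEnat /= !big_nat_recr//= big_geq// /exp_coeff /=.
rewrite !factS fact0 expr0 expr1 /= => h.
suff: nondecreasing_seq (series (exp_coeff x)).
  by move=> /h; rewrite add0r divr1 [x / _]divr1.
by apply/nondecreasing_seqP => n; rewrite seriesSr lerDl exp_coeff_ge0.
Qed.

Let mX n : measurable_fun [set: R] (fun x : R => (x ^+ n)%:E).
Proof. by apply/measurable_EFinP; exact: measurable_funX. Qed.

Let mtilt c : measurable_fun [set: R] (fun x : R => (expR (c * x ^+ 2 / 2))%:E).
Proof.
apply/measurable_EFinP; apply: measurableT_comp => //.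
by apply: measurable_funM => //; exact: measurable_funM.
Qed.

(** For s < 1 the tilt is exp (- c x^2) with c = (s^-2 - 1) / 2. Integrating 1 - c x^2 <= exp (- c
    x^2) gives a second moment of at least (1 - s) / c, which tends to the exact value 1 as s tends
    to 1. *)
Lemma normal_second_moment_ge (s : R) : 0 < s -> s < 1 ->
  ((2 * s ^+ 2 / (1 + s))%:E <= \int[N01]_x (x ^+ 2)%:E)%E.
Proof.
move=> s0 s1; pose c : R := (s ^- 2 - 1) / 2.
have c0 : 0 < c.
  by rewrite divr_gt0// subr_gt0 invf_gt1 ?exprn_gt0// expr_lt1 ?ltW.
have : (1 <= s%:E + c%:E * \int[N01]_x (x ^+ 2)%:E)%E.
  rewrite -[X in (X + _)%E](integral_normal_tilt s0) -ge0_integralZl_EFin//; last 3 first.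
  - by move=> x _; rewrite lee_fin sqr_ge0.
  - exact: mX.
  - exact: ltW.
  rewrite -ge0_integralD//; last 3 first.
  - exact: mtilt.
  - by move=> x _; rewrite -EFinM lee_fin mulr_ge0 ?sqr_ge0// ltW.
  - by apply: measurable_funeM; exact: mX.
  rewrite -[leLHS](@probability_setT _ _ _ N01) -[leLHS]mul1e -integral_cst//.
  apply: ge0_le_integral => //.
  - by apply: emeasurable_funD; [exact: mtilt|apply: measurable_funeM; exact: mX].
  - move=> x _; rewrite -EFinM -EFinD lee_fin.
    apply: le_trans (lerD (expR_ge1Dx _) (lexx _)); rewrite /c.
    by move: (s ^- 2) (x ^+ 2) => z y; lra.
case: (\int[N01]_x _)%E => [m| |] //=; last by rewrite gt0_muleNy ?lte_fin.
  rewrite -EFinM -EFinD !lee_fin /c => h.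
  rewrite ler_pdivrMr ?addr_gt0//.
  have : (1 - s) * (2 * s ^+ 2) <= (1 - s) * (m * (1 + s)).
    have -> : (1 - s) * (m * (1 + s)) = 2 * s ^+ 2 * ((s ^- 2 - 1) / 2 * m).
      by field; rewrite gt_eqF.
    rewrite mulrC ler_pM2l ?mulr_gt0 ?exprn_gt0//; lra.
  by rewrite ler_pM2l// subr_gt0.
by rewrite leey.
Qed.

(** The tilt s = 2 has exponent y = 3 x^2 / 8 and integral 2. As exp y >= y^3 / 6 = 27 x^6 / (6 *
    512) >= x^6 / 512, the moment is at most 2 * 512. The exact value is 15. *)
Lemma normal_sixth_moment_le : (\int[N01]_x (x ^+ 6)%:E <= 1024%:E)%E.
Proof.
have [c c0 cE] : exists2 c : R, 0 < c & c * 512 = 1.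
  exists 512^-1; first by rewrite invr_gt0; exact: ltr0n.
  by apply: mulVf; rewrite pnatr_eq0.
have h : (c%:E * \int[N01]_x (x ^+ 6)%:E <= 2%:E)%E.
  rewrite -(@integral_normal_tilt 2)// -ge0_integralZl_EFin//; last 3 first.
  - by move=> x _; rewrite lee_fin exprn_even_ge0.
  - exact: mX.
  - exact: ltW.
  apply: ge0_le_integral; [by []| | |exact: mtilt|].
  - by move=> x _; rewrite -EFinM lee_fin mulr_ge0 ?exprn_even_ge0// ltW.
  - by apply: measurable_funeM; exact: mX.
  - move=> x _; rewrite -EFinM lee_fin.
    have x2 := sqr_ge0 x.
    have t2 : 0 <= (1 - 2 ^- 2) * x ^+ 2 / 2 by rewrite divr_ge0// mulr_ge0//; lra.
    apply: le_trans (expR_ge1Dxn 2 t2).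
    have -> : 3`!%:R = 6 :> R by [].
    have -> : (x ^+ 6 : R) = (x ^+ 2) ^+ 3 by rewrite -exprM.
    have := exprn_ge0 3 x2; move: (x ^+ 2) => y y0; rewrite 2!exprMn.
    have -> : (1 - 2 ^- 2) ^+ 3 = 27 / 64 :> R by field.
    have -> : 2^-1 ^+ 3 = 1 / 8 :> R by field.
    move: (y ^+ 3) y0 => z z0.
    have : c * 512 * z = z by rewrite cE mul1r.
    by lra.
have -> : 1024 = c^-1 * 2 :> R.
  by rewrite (_ : c^-1 = 512); [ring|rewrite -[LHS]mul1r -[X in X * _]cE mulrAC divff ?gt_eqF// mul1r].
rewrite EFinM; apply: le_trans (lee_wpmul2l _ h); last by rewrite lee_fin invr_ge0 ltW.
by rewrite muleA -EFinM mulVf ?gt_eqF// mul1e.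
Qed.

(** The quadratic term of the exponential controls x^4. Its linear term is kept as well, and the
    lower bound on the second moment is subtracted: this brings the constant close to the exact
    value 3. The descent needs a small constant here, since 4 later multiplies |grad F|^2 with an
    unfavourable sign. *)
Lemma normal_fourth_moment_le : (\int[N01]_x (x ^+ 4)%:E <= 4%:E)%E.
Proof.
pose s : R := 10 / 9; pose t : R := 1 - s ^- 2.
have t0 : 0 < t by rewrite /t /s; lra.
have h : (1 + ((t / 2)%:E * \int[N01]_x (x ^+ 2)%:E +
    (t ^+ 2 / 8)%:E * \int[N01]_x (x ^+ 4)%:E) <= s%:E)%E.
  rewrite -[X in (X + _)%E](@probability_setT _ _ _ N01) -[X in (X + _)%E]mul1e -integral_cst//.
  rewrite -[leRHS](@integral_normal_tilt s)//; last by rewrite /s; lra.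
  rewrite -[X in (_ + (X + _) <= _)%E]ge0_integralZl_EFin//; last 3 first.
  - by move=> x _; rewrite lee_fin exprn_even_ge0.
  - exact: mX.
  - by rewrite divr_ge0// ltW.
  rewrite -[X in (_ + (_ + X) <= _)%E]ge0_integralZl_EFin//; last 3 first.
  - by move=> x _; rewrite lee_fin exprn_even_ge0.
  - exact: mX.
  - by rewrite divr_ge0// sqr_ge0.
  have p2 x : (0 <= (t / 2)%:E * (x ^+ 2)%:E)%E.
    by rewrite -EFinM lee_fin mulr_ge0 ?sqr_ge0// divr_ge0// ltW.
  have p4 x : (0 <= (t ^+ 2 / 8)%:E * (x ^+ 4)%:E)%E.
    by rewrite -EFinM lee_fin mulr_ge0 ?exprn_even_ge0// divr_ge0// sqr_ge0.
  have m2' : measurable_fun [set: measurableTypeR R]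
    (fun x : R => (t / 2)%:E * (x ^+ 2)%:E)%E := measurable_funeM _ (mX 2).
  have m4' : measurable_fun [set: measurableTypeR R]
    (fun x : R => (t ^+ 2 / 8)%:E * (x ^+ 4)%:E)%E := measurable_funeM _ (mX 4).
  rewrite -(@ge0_integralD _ _ _ N01 setT measurableT _ _ (fun x _ => p2 x) m2'
    (fun x _ => p4 x) m4').
  have p24 x : (0 <= (t / 2)%:E * (x ^+ 2)%:E + (t ^+ 2 / 8)%:E * (x ^+ 4)%:E)%E.
    by rewrite adde_ge0.
  have m24 := emeasurable_funD m2' m4'.
  rewrite -(@ge0_integralD _ _ _ N01 setT measurableT _ _ (fun x _ => lee01)
    (measurable_cst _) (fun x _ => p24 x) m24).
  apply: ge0_le_integral; [by []| | |exact: mtilt|].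
  - by move=> x _; rewrite adde_ge0.
  - by apply: emeasurable_funD m24; exact: measurable_cst.
  - move=> x _; rewrite -!EFinM -!EFinD lee_fin.
    apply: le_trans (expR_ge_quadratic _); last first.
      by rewrite divr_ge0// mulr_ge0 ?sqr_ge0// ltW.
    rewrite -/t le_eqVlt; apply/orP; left; apply/eqP.
    by field.
(* This value of s yields a second moment of at least 999 / 1000. *)
have := @normal_second_moment_ge (1999 / 2000) ltac:(lra) ltac:(lra).
move: h; have := @integral_ge0 _ _ _ N01 setT (fun x => (x ^+ 4)%:E) ltac:(by move=> x _; rewrite lee_fin exprn_even_ge0).
(* Finiteness of the moments is not known beforehand; an infinite one contradicts the inequality
   [h]. *)
case: (\int[N01]_x (x ^+ 4)%:E)%E => [m4| |]//.
  case: (\int[N01]_x (x ^+ 2)%:E)%E => [m2| |]//.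
  - rewrite -!EFinM -!EFinD !lee_fin /t /s => _.
    have -> : (1 - (10 / 9) ^- 2 : R) = 19 / 100 by field.
    move=> h1 h2; have h3 : 999 / 1000 <= m2.
      by apply: le_trans h2; rewrite ler_pdivlMr; lra.
    by lra.
  - by rewrite gt0_muley ?lte_fin ?divr_gt0//.
move=> _; rewrite [X in (_ + (_ + X) <= _)%E]gt0_muley ?lte_fin ?divr_gt0 ?exprn_gt0//.
case: (\int[N01]_x (x ^+ 2)%:E)%E => [m2| |]//.
by rewrite gt0_muley ?lte_fin ?divr_gt0.
Qed.

End gaussian_moments.

Lemma normal_probN {R : realType} (B : set R) : measurable B ->
  normal_prob 0 1 (-%R @^-1` B) = normal_prob 0 1 B :> \bar R.
Proof.
move=> mB; have mN : measurable_fun [set: R] (-%R : R -> measurableTypeR R).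
  exact: oppr_measurable.
have mpdf : measurable_fun [set: R] (fun x : R => (normal_pdf 0 1 x)%:E).
  by apply/measurable_EFinP; exact: measurable_normal_pdf.
rewrite /normal_prob.
transitivity (\int[lebesgue_measure]_(x in (-%R : R -> measurableTypeR R) @^-1` B)
    ((fun y => (normal_pdf 0 1 y)%:E) \o -%R) x)%E.
  apply: eq_integral => x _; rewrite /= !normal_pdfE ?oner_eq0//.
  by rewrite /normal_fun !subr0 sqrrN.
transitivity (\int[pushforward lebesgue_measure (-%R : R -> measurableTypeR R)]_(x in B)
    (normal_pdf 0 1 x)%:E)%E.
  apply/esym; apply: ge0_integral_pushforward => //.
  + exact: (measurable_funS _ _ mpdf).
  + by move=> y _; rewrite lee_fin normal_pdf_ge0.
by apply: eq_measure_integral => //= A mA _; rewrite lebesgue_measureN.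
Qed.

(** * Moments of a standard normal vector *)

Section gaussian_vector.
Context {R : realType} {d : nat} (gamma : probability (borelRV R d) R).
Hypothesis gammaE : forall B : 'I_d -> set R, (forall i, measurable (B i)) ->
  gamma (box B) = (\prod_(i < d) normal_prob 0 1 (B i))%E.
Implicit Types (g z : 'rV[R]_d) (w : 'rV[R]_d -> R).
Local Open Scope ereal_scope.

Lemma gaussian_coord (f : measurableTypeR R -> \bar R) i :
  measurable_fun setT f ->
  (forall x, 0 <= f x) ->
  \int[gamma]_z f ((z : 'rV[R]_d) ord0 i) = \int[normal_prob 0 1]_x f x.
Proof.
move=> mf f0.
have mc : @measurable_fun _ _ (borelRV R d) (measurableTypeR R) setT
  (fun z : 'rV[R]_d => z ord0 i) := measurable_coord i.
rewrite -[LHS](@ge0_integral_distribution _ _ _ _ _ gamma (mfun_of mc) f)//.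
apply: eq_measure_integral => A mA _.
transitivity (gamma (box (fun j => if j == i then A else setT))).
  congr (gamma _); apply/seteqP; split => z /=; last first.
    by move/(_ i); rewrite eqxx.
  by move=> Az j; case: eqP => // ->.
rewrite gammaE; last by move=> j; case: ifP.
rewrite (bigD1 i)//= eqxx big1 ?mule1// => j /negPf ->.
exact: probability_setT.
Qed.

Definition flip (i : 'I_d) (z : 'rV[R]_d) : 'rV[R]_d :=
  \row_j (if j == i then - z ord0 j else z ord0 j)%R.

Lemma measurable_flip i : measurable_fun setT (flip i : borelRV R d -> borelRV R d).
Proof.
apply: measurable_fun_borelRV => j.
rewrite (_ : (fun _ => _) = fun z : 'rV[R]_d =>
    if j == i then (- z ord0 j)%R else z ord0 j); last first.
  by apply/funext => z; rewrite mxE.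
have mj := @measurable_coord R d j.
by case: (j == i); [exact: measurableT_comp mj|exact: mj].
Qed.

(** The reflected law of a box is a product in which one side is negated, so the symmetry of N(0, 1)
    gives equality on boxes, and boxes determine the law. *)
Lemma gaussian_flip i (f : 'rV[R]_d -> \bar R) :
  measurable_fun [set: borelRV R d] f -> (forall z, 0 <= f z) ->
  \int[gamma]_z f (flip i z) = \int[gamma]_z f z.
Proof.
move=> mf f0.
rewrite -[LHS](@ge0_integral_distribution _ _ _ _ _ gamma
  (mfun_of (measurable_flip i)) f)//.
apply: eq_measure_integral => A mA _.
apply: (@measure_unique _ R (borelRV R d) boxes (fun=> setT)) => //.
- exact: measurable_borelRV.
- exact: setI_closed_boxes.
- by move=> _; exact: boxesT.
- by rewrite bigcup_const//; exists 0%N.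
- move=> _ [B mB <-].
  transitivity (gamma (box (fun j => if j == i then -%R @^-1` B j else B j))).
    congr (gamma _); apply/seteqP; split => z /= h j; have := h j; rewrite !mxE.
      by case: ifP.
    by case: ifP.
  apply: etrans (esym (gammaE mB)); rewrite gammaE; last first.
    move=> j; case: ifP => // _; rewrite -[X in measurable X]setTI.
    exact: (@oppr_measurable R setT measurableT _ (mB j)).
  by apply: eq_bigr => j _; case: ifP => // _; exact: normal_probN.
- move=> _; exact: (le_lt_trans (probability_le1 gamma measurableT) (ltry _)).
Qed.

(* Reflecting the coordinate i is measure preserving, so the integrand can be
   averaged with its reflection: (a + s)^2 + (- a + s)^2 = 2 a^2 + 2 s^2. Cross
   terms thus vanish without integrating any function of variable sign. *)
Lemma gaussian_sqr_sum w (g : 'rV[R]_d) (r : seq 'I_d) :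
  measurable_fun [set: borelRV R d] w -> (forall z, 0 <= w z)%R ->
  (forall i z, w (flip i z) = w z) -> uniq r ->
  \int[gamma]_z (w z * (\sum_(i <- r) g ord0 i * (z : 'rV[R]_d) ord0 i) ^+ 2)%:E =
  \sum_(i <- r) (g ord0 i ^+ 2)%:E * \int[gamma]_z (w z * (z : 'rV[R]_d) ord0 i ^+ 2)%:E.
Proof.
move=> mw w0 wflip; elim: r => [_|i r IH /= /andP[ir ur]].
  rewrite big_nil integral0_eq// => z _; rewrite big_nil expr0n mulr0//.
have mz j : measurable_fun [set: borelRV R d] (fun z : 'rV[R]_d => z ord0 j) :=
  measurable_coord j.
pose s (z : 'rV[R]_d) : R := (\sum_(i <- r) g ord0 i * z ord0 i)%R.
have ms : measurable_fun [set: borelRV R d] s.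
  by apply: measurable_sum => j; exact: measurable_funM.
rewrite big_cons -IH//.
pose f (z : 'rV[R]_d) : \bar R := (w z * (g ord0 i * z ord0 i + s z) ^+ 2)%:E.
have mf : measurable_fun [set: borelRV R d] f.
  apply/measurable_EFinP; apply: measurable_funM => //; apply: measurable_funX.
  by apply: measurable_funD => //; exact: measurable_funM.
have f0 z : 0 <= f z by rewrite lee_fin mulr_ge0// sqr_ge0.
transitivity (\int[gamma]_z f z).
  by apply: eq_integral => z _; rewrite big_cons.
have sflip z : s (flip i z) = s z.
  apply: eq_big_seq => j jr; rewrite mxE; case: eqP => // ji.
  by move: ir; rewrite -ji jr.
transitivity (\int[gamma]_z ((2^-1)%:E * (f z + f (flip i z)))).
  have mff : measurable_fun [set: borelRV R d] (fun z => f (flip i z)).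
    exact: (measurableT_comp mf (measurable_flip i)).
  rewrite ge0_integralZl_EFin//.
  - rewrite ge0_integralD// gaussian_flip//.
    set I := \int[gamma]_z f z; rewrite -[I in I + _]mul1e -[I in _ + I]mul1e.
    rewrite -ge0_muleDl//.
    have h2 : (2^-1 * (1 + 1) = 1 :> R)%R by field.
    by rewrite muleA -EFinD -EFinM h2 mul1e.
  - by move=> z _; rewrite adde_ge0.
  - exact: emeasurable_funD.
rewrite -ge0_integralZl_EFin//; last 3 first.
- by move=> z _; rewrite lee_fin mulr_ge0// sqr_ge0.
- apply/measurable_EFinP; apply: measurable_funM => //; exact: measurable_funX.
- exact: sqr_ge0.
rewrite -ge0_integralD//.
- apply: eq_integral => z _; rewrite /f wflip sflip !mxE eqxx -/(s z).
  rewrite -[LHS]/((2^-1 * (w z * (g ord0 i * z ord0 i + s z) ^+ 2 +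
    w z * (g ord0 i * - z ord0 i + s z) ^+ 2))%:E).
  rewrite -EFinM -EFinD; congr (_%:E)%E.
  by field.
- by move=> z _; apply: mule_ge0; rewrite lee_fin ?sqr_ge0// mulr_ge0// sqr_ge0.
- apply: measurable_funeM; apply/measurable_EFinP; apply: measurable_funM => //; exact: measurable_funX.
- by move=> z _; rewrite lee_fin mulr_ge0// sqr_ge0.
- apply/measurable_EFinP; apply: measurable_funM => //; exact: measurable_funX.
Qed.

End gaussian_vector.

Lemma power_mean2 {R : realType} {d : nat} (y : 'I_d -> R) :
  (\sum_i y i) ^+ 2 <= d%:R * \sum_i y i ^+ 2.
Proof.
have := sqr_edot_le (\row_i y i) (\row_(i < d) (1 : R)).
rewrite !sqr_enorm /edot.
under eq_bigr do rewrite !mxE mulr1.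
under [X in X * _]eq_bigr do rewrite !mxE -expr2.
under [X in _ * X]eq_bigr do rewrite !mxE mulr1.
by rewrite sumr_const card_ord mulrC.
Qed.

Lemma power_mean3 {R : realType} {d : nat} (y : 'I_d -> R) :
  (forall i, 0 <= y i) ->
  (\sum_i y i) ^+ 3 <= d%:R ^+ 2 * \sum_i y i ^+ 3.
Proof.
move=> y0; have [d0|d0] := eqVneq d 0%N.
  have e0 (i : 'I_d) : False by have := ltn_ord i; rewrite [X in (_ < X)%N]d0.
  by rewrite !big1 ?expr0n ?mulr0// => i; case: (e0 i).
have dR : 0 < d%:R :> R by rewrite ltr0n lt0n.
set S := \sum_i y i; pose a := S / d%:R.
have a0 : 0 <= a by rewrite divr_ge0// sumr_ge0.
(* Each cube is bounded below by its tangent line at the mean [a]: t^3 - 3 a^2 t + 2 a^3 = (t - a)^2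
   (t + 2 a). *)
have : \sum_i (3 * a ^+ 2 * y i - 2 * a ^+ 3) <= \sum_i y i ^+ 3.
  apply: ler_sum => i _; have := y0 i; set t := y i => t0.
  have : 0 <= (t - a) ^+ 2 * (t + 2 * a).
    by rewrite mulr_ge0 ?sqr_ge0// addr_ge0// mulr_ge0.
  rewrite -subr_ge0 => h; rewrite -subr_ge0; move: h; rewrite subr0.
  by congr (_ <= _); ring.
rewrite big_split/= -mulr_sumr -/S sumr_const card_ord => h.
rewrite -(ler_pM2l (exprn_gt0 2 dR)) in h.
apply: le_trans h; rewrite le_eqVlt; apply/orP; left; apply/eqP.
by rewrite /a -mulr_natr; field; rewrite gt_eqF.
Qed.

Section gaussian_vector_moments.
Context {R : realType} {d : nat} (gamma : probability (borelRV R d) R).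
Hypothesis gammaE : forall B : 'I_d -> set R, (forall i, measurable (B i)) ->
  gamma (box B) = (\prod_(i < d) normal_prob 0 1 (B i))%E.
Implicit Types (g z : 'rV[R]_d) (w : 'rV[R]_d -> R).
Local Open Scope ereal_scope.

Let mz j : measurable_fun [set: borelRV R d] (fun z : 'rV[R]_d => z ord0 j) :=
  measurable_coord j.

Let mzX j n :
  measurable_fun [set: borelRV R d] (fun z : 'rV[R]_d => (z ord0 j ^+ n)%:E).
Proof. by apply/measurable_EFinP; exact: measurable_funX. Qed.

Let mX n : measurable_fun [set: measurableTypeR R] (fun x : R => (x ^+ n)%:E).
Proof. by apply/measurable_EFinP; exact: measurable_funX. Qed.

Lemma coord_second_moment_ge i :
  (9 / 10)%:E <= \int[gamma]_z ((z : 'rV[R]_d) ord0 i ^+ 2)%:E.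
Proof.
rewrite (@gaussian_coord _ _ _ gammaE (fun x => (x ^+ 2)%:E))//; last first.
  by move=> x; rewrite lee_fin sqr_ge0.
apply: le_trans (@normal_second_moment_ge R (99 / 100) _ _); last 2 first.
- by lra.
- by lra.
by rewrite lee_fin ler_pdivlMr; lra.
Qed.

Lemma coord_fourth_moment_le i :
  \int[gamma]_z ((z : 'rV[R]_d) ord0 i ^+ 4)%:E <= 4%:E.
Proof.
rewrite (@gaussian_coord _ _ _ gammaE (fun x => (x ^+ 4)%:E))//; last first.
  by move=> x; rewrite lee_fin exprn_even_ge0.
exact: normal_fourth_moment_le.
Qed.

Lemma coord_sixth_moment_le i :
  \int[gamma]_z ((z : 'rV[R]_d) ord0 i ^+ 6)%:E <= 1024%:E.
Proof.
rewrite (@gaussian_coord _ _ _ gammaE (fun x => (x ^+ 6)%:E))//; last first.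
  by move=> x; rewrite lee_fin exprn_even_ge0.
exact: normal_sixth_moment_le.
Qed.

Let sqr_enormE z : (enorm z ^+ 2 = \sum_i z ord0 i ^+ 2)%R.
Proof. by rewrite sqr_enorm; apply: eq_bigr => i _; rewrite expr2. Qed.

Let integral_sum_le (f : 'rV[R]_d -> R) (c K : R) n :
  measurable_fun [set: borelRV R d] f -> (0 <= K)%R -> ~~ odd n ->
  (forall z, 0 <= f z <= K * \sum_i z ord0 i ^+ n)%R ->
  (forall i, \int[gamma]_z ((z : 'rV[R]_d) ord0 i ^+ n)%:E <= c%:E) ->
  \int[gamma]_z (f z)%:E <= (K * (d%:R * c))%:E.
Proof.
move=> mf K0 nev fK hc.
have p0 (z : 'rV[R]_d) i : (0 <= z ord0 i ^+ n)%R by rewrite exprn_even_ge0.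
apply: (@le_trans _ _ (\int[gamma]_z (K%:E *
    \sum_(i < d) ((z : 'rV[R]_d) ord0 i ^+ n)%:E))).
  apply: ge0_le_integral => //.
  - by move=> z _; rewrite lee_fin; have /andP[] := fK z.
  - exact/measurable_EFinP.
  - by apply: measurable_funeM; apply: emeasurable_sum => i.
  - by move=> z _; rewrite sumEFin -EFinM lee_fin; have /andP[] := fK z.
rewrite ge0_integralZl_EFin//; last 2 first.
- by move=> z _; rewrite sumEFin lee_fin sumr_ge0.
- by apply: emeasurable_sum => i.
rewrite ge0_integral_sum//; last by move=> i z _; rewrite lee_fin.
rewrite EFinM; apply: lee_wpmul2l; first by rewrite lee_fin.
apply: (@le_trans _ _ (\sum_(i < d) c%:E)); first exact: lee_sum.
by rewrite sumEFin sumr_const card_ord mulr_natl.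
Qed.

Lemma gaussian_enorm4_le : \int[gamma]_z (enorm z ^+ 4)%:E <= (4 * d%:R ^+ 2)%:E.
Proof.
rewrite (_ : 4 * d%:R ^+ 2 = d%:R * (d%:R * 4))%R; last by ring.
apply: (@integral_sum_le _ _ _ 4) => //.
- by apply: measurable_funX; exact: measurable_enorm.
- move=> z; rewrite exprn_even_ge0//= (_ : 4%N = (2 * 2)%N)// exprM sqr_enormE.
  apply: (le_trans (power_mean2 _)); rewrite ler_wpM2l//.
  by apply: ler_sum => i _; rewrite -exprM.
- exact: coord_fourth_moment_le.
Qed.

Lemma gaussian_enorm6_le : \int[gamma]_z (enorm z ^+ 6)%:E <= (1024 * d%:R ^+ 3)%:E.
Proof.
rewrite (_ : 1024 * d%:R ^+ 3 = d%:R ^+ 2 * (d%:R * 1024))%R; last by ring.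
apply: (@integral_sum_le _ _ _ 6) => //.
- by apply: measurable_funX; exact: measurable_enorm.
- move=> z; rewrite exprn_even_ge0//= (_ : 6%N = (2 * 3)%N)// exprM sqr_enormE.
  apply: (le_trans (power_mean3 _)); first by move=> i; exact: sqr_ge0.
  rewrite ler_wpM2l// ?sqr_ge0//.
  by apply: ler_sum => i _; rewrite -exprM.
- exact: coord_sixth_moment_le.
Qed.

(** Deduced from the fourth moment by y <= 1 + y^2 / 2 at y = z_i^2. *)
Lemma coord_second_moment_le i :
  \int[gamma]_z ((z : 'rV[R]_d) ord0 i ^+ 2)%:E <= 3%:E.
Proof.
apply: (@le_trans _ _ (\int[gamma]_z (1 + (2^-1)%:E * ((z : 'rV[R]_d) ord0 i ^+ 4)%:E))).
  apply: ge0_le_integral => //.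
  - by move=> z _; rewrite lee_fin sqr_ge0.
  - by apply: emeasurable_funD => //; exact: measurable_funeM.
  - move=> z _; rewrite -EFinM -EFinD lee_fin.
    rewrite (_ : 4%N = (2 * 2)%N)// exprM; have := sqr_ge0 (z ord0 i ^+ 2 - 1)%R.
    by rewrite sqrrB expr1n; lra.
have m4 (z : 'rV[R]_d) : (0 <= z ord0 i ^+ 4)%R by rewrite exprn_even_ge0.
rewrite ge0_integralD//; last 2 first.
- by move=> z _; rewrite -EFinM lee_fin mulr_ge0.
- exact: measurable_funeM.
rewrite integral_cst// ge0_integralZl_EFin//.
  have g1 : gamma [set: borelRV R d] = 1 := probability_setT gamma.
  rewrite [X in 1 * X + _]g1 mul1e (_ : 3%:E = 1 + (2^-1)%:E * 4%:E); last first.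
    by rewrite -EFinM -EFinD; congr _%:E; field.
  by apply: leeD2l; apply: lee_wpmul2l => //; exact: coord_fourth_moment_le.
by move=> z _; rewrite lee_fin.
Qed.

Lemma gaussian_enorm2_le : \int[gamma]_z (enorm z ^+ 2)%:E <= (3 * d%:R)%:E.
Proof.
rewrite (_ : 3 * d%:R = 1 * (d%:R * 3))%R; last by ring.
apply: (@integral_sum_le _ _ _ 2) => //.
- by apply: measurable_funX; exact: measurable_enorm.
- by move=> z; rewrite sqr_ge0 mul1r sqr_enormE/=.
- exact: coord_second_moment_le.
Qed.

Lemma gaussian_edot_sqr_ge g :
  (9 / 10 * enorm g ^+ 2)%:E <= \int[gamma]_z (edot g z ^+ 2)%:E.
Proof.
have := @gaussian_sqr_sum _ _ _ gammaE (fun=> 1%R) g (index_enum 'I_d).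
rewrite index_enum_uniq => /(_ (measurable_cst _) (fun=> ler01) (fun _ _ => erefl) isT).
under eq_integral do rewrite mul1r; move=> ->.
rewrite sqr_enormE mulr_sumr -sumEFin; apply: lee_sum => i _.
under eq_integral do rewrite mul1r.
rewrite mulrC EFinM; apply: lee_wpmul2l; first by rewrite lee_fin sqr_ge0.
exact: coord_second_moment_ge.
Qed.

Lemma enorm_flip i z : enorm (flip i z) = enorm z.
Proof.
congr Num.sqrt; apply: eq_bigr => j _; rewrite mxE.
by case: eqP => // _; rewrite sqrrN.
Qed.

(** The weight |z|^2 is invariant under reflections, so [gaussian_sqr_sum] reduces the claim to E
    |z|^2 z_i^2. There z_j^2 z_i^2 <= (z_j^4 + z_i^4) / 2 treats the cases j = i and j <> i
    alike. *)
Lemma gaussian_enorm2_edot2_le g :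
  \int[gamma]_z (enorm z ^+ 2 * edot g z ^+ 2)%:E <= (4 * d%:R * enorm g ^+ 2)%:E.
Proof.
have men2 : measurable_fun [set: borelRV R d] (fun z : 'rV[R]_d => enorm z ^+ 2)%R.
  by apply: measurable_funX; exact: measurable_enorm.
have := @gaussian_sqr_sum _ _ _ gammaE (fun z => enorm z ^+ 2)%R g (index_enum 'I_d).
rewrite index_enum_uniq => /(_ men2 (fun=> sqr_ge0 _)) -> //; last first.
  by move=> i z; rewrite enorm_flip.
rewrite [in leRHS]sqr_enormE mulr_sumr -sumEFin; apply: lee_sum => i _.
rewrite [leRHS](_ : _ = (g ord0 i ^+ 2)%:E * (4 * d%:R)%:E); last first.
  by rewrite -EFinM mulrC.
apply: lee_wpmul2l; first by rewrite lee_fin sqr_ge0.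
have p0 (z : 'rV[R]_d) j : (0 <= z ord0 j ^+ 4)%R by rewrite exprn_even_ge0.
have p1 (z : 'rV[R]_d) j : 0 <= (z ord0 j ^+ 4)%:E + (z ord0 i ^+ 4)%:E.
  by rewrite adde_ge0// lee_fin.
have mj (j : 'I_d) : measurable_fun [set: borelRV R d]
    (fun z : 'rV[R]_d => (z ord0 j ^+ 4)%:E + (z ord0 i ^+ 4)%:E).
  exact: emeasurable_funD.
apply: (@le_trans _ _ (\int[gamma]_z ((2^-1)%:E * \sum_(j < d)
    (((z : 'rV[R]_d) ord0 j ^+ 4)%:E + ((z : 'rV[R]_d) ord0 i ^+ 4)%:E)))).
  apply: ge0_le_integral => //.
  - by move=> z _; rewrite lee_fin mulr_ge0// sqr_ge0.
  - by apply/measurable_EFinP; apply: measurable_funM => //; exact: measurable_funX.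
  - by apply: measurable_funeM; apply: emeasurable_sum => j.
  - move=> z _; rewrite sumEFin -EFinM lee_fin sqr_enormE mulr_suml mulr_sumr.
    apply: ler_sum => j _; rewrite (_ : 4%N = (2 * 2)%N)// !exprM.
    have := sqr_ge0 (z ord0 j ^+ 2 - z ord0 i ^+ 2)%R.
    by rewrite sqrrB; lra.
rewrite ge0_integralZl_EFin//; last 2 first.
- by move=> z _; apply: sume_ge0.
- by apply: emeasurable_sum => j.
rewrite ge0_integral_sum//.
rewrite (_ : 4 * d%:R = 2^-1 * (d%:R * 8))%R; last by field.
rewrite EFinM; apply: lee_wpmul2l; first by rewrite lee_fin.
apply: (@le_trans _ _ (\sum_(i < d) 8%:E)); last first.
  by rewrite sumEFin sumr_const card_ord mulr_natl.
apply: lee_sum => j _; rewrite ge0_integralD//; last 2 first.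
- by move=> z _; rewrite lee_fin.
- by move=> z _; rewrite lee_fin.
rewrite (_ : 8%:E = 4%:E + 4%:E :> \bar R); last by rewrite -EFinD; congr _%:E; ring.
by apply: leeD; exact: coord_fourth_moment_le.
Qed.

End gaussian_vector_moments.

(** * Descent in expectation *)

Section smoothness.
Context {R : realType} {d : nat}.
Variables (F : 'rV[R]_d -> R) (HF : R).
Hypotheses (HF0 : 0 <= HF) (dF : forall x, differentiable F x)
  (gF : forall x y, enorm (gradient F x - gradient F y) <= HF * enorm (x - y)).

Lemma derive_edot x v : 'D_v F x = edot (gradient F x) v.
Proof.
rewrite deriveE//; have {1}-> : v = \sum_(i < d) v ord0 i *: delta_mx ord0 i.
  exact: row_sum_delta.
rewrite linear_sum; apply: eq_bigr => i _.
by rewrite linearZ /= mxE deriveE// mulrC.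
Qed.

Lemma is_derive_line x v (t : R) :
  is_derive t 1 (fun s => F (x + s *: v)) (edot (gradient F (x + t *: v)) v).
Proof.
have E : (fun h : R => h^-1 *: (((fun s => F (x + s *: v)) \o shift t) (h *: 1) - F (x + t *: v)))
  = (fun h => h^-1 *: ((F \o shift (x + t *: v)) (h *: v) - F (x + t *: v))).
  apply/funext => h /=; congr (_ *: (F _ - _)).
  by rewrite [h *: 1]mulr1 scalerDl addrCA.
have dd : derivable F (x + t *: v) v by exact: diff_derivable.
split; first by rewrite /derivable E.
by rewrite /derive E -derive_edot.
Qed.

(** The mean value theorem on the segment replaces an integral of the gradient; it gives the
    constant [HF] where the integral would give HF / 2, and the later constants are computed with
    it. *)
Lemma smooth_linearization x v :
  `|F (x + v) - F x - edot (gradient F x) v| <= HF * enorm v ^+ 2.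
Proof.
have [] := @MVT R (fun s => F (x + s *: v)) (fun s => edot (gradient F (x + s *: v)) v) 0 1 ltr01.
- by move=> t _; exact: is_derive_line.
- apply: derivable_within_continuous => t _.
  by have [] := is_derive_line x v t.
move=> c; rewrite in_itv/= => /andP[c0 c1].
rewrite scale1r scale0r addr0 subr0 mulr1 => ->.
rewrite -edotNl -edotDl; apply: (le_trans (normr_edot_le _ _)).
rewrite expr2 mulrA ler_wpM2r ?enorm_ge0//.
apply: (le_trans (gF _ _)); rewrite addrAC subrr add0r enormZ.
by rewrite ler_wpM2l// ler_piMl ?enorm_ge0// ger0_norm ltW.
Qed.

Lemma smooth_upper x v :
  F (x + v) <= F x + edot (gradient F x) v + HF * enorm v ^+ 2.
Proof.
by have := le_trans (ler_norm _) (smooth_linearization x v); lra.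
Qed.

(** The linearizations at mu u and - mu u are subtracted: F x cancels, and each leaves an error of
    at most HF mu^2 |u|^2, to be divided by 2 mu. *)
Lemma finite_difference_error x u (mu : R) : 0 < mu ->
  `|(F (x + mu *: u) - F (x - mu *: u)) / (2 * mu) - edot (gradient F x) u|
  <= HF * mu * enorm u ^+ 2.
Proof.
move=> mu0; have h1 := smooth_linearization x (mu *: u).
have h2 := smooth_linearization x (- (mu *: u)).
rewrite enormN enormZ (gtr0_norm mu0) exprMn edotNr in h2.
rewrite enormZ (gtr0_norm mu0) exprMn in h1.
rewrite !edotZr in h1 h2.
have m2 : 0 < 2 * mu by rewrite mulr_gt0.
rewrite -(ler_pM2l m2) -{1}(gtr0_norm m2) -normrM.
have -> : 2 * mu * ((F (x + mu *: u) - F (x - mu *: u)) / (2 * mu) - edot (gradient F x) u)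
  = (F (x + mu *: u) - F x - mu * edot (gradient F x) u) -
    (F (x - mu *: u) - F x - - (mu * edot (gradient F x) u)).
  by field; rewrite gt_eqF.
apply: (le_trans (ler_normB _ _)); apply: (le_trans (lerD h1 h2)).
by rewrite le_eqVlt; apply/orP; left; apply/eqP; ring.
Qed.

Lemma measurable_gradient : measurable_fun [set: borelRV R d]
  (gradient F : borelRV R d -> borelRV R d).
Proof.
apply: measurable_fun_borelRV => i.
apply: (@measurable_lipschitz _ _ _ HF) => x y.
apply: le_trans (gF x y); have := normr_coord_le (gradient F x - gradient F y) i.
by rewrite !mxE.
Qed.

Lemma measurable_differentiable : measurable_fun [set: borelRV R d] F.
Proof.
by apply: continuous_measurable_borelRV => x; exact: differentiable_continuous.
Qed.

End smoothness.

(** * The quadratic bound on one step and its Gaussian mean *)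

Section descent.
Context {R : realType} {d : nat}.
Variables (F : 'rV[R]_d -> R) (HF m0 beta mu V : R).
Hypotheses (HF0 : 0 < HF) (dF : forall x, differentiable F x)
  (gF : forall x y, enorm (gradient F x - gradient F y) <= HF * enorm (x - y))
  (Fm0 : forall x, m0 <= F x) (beta0 : 0 < beta) (mu0 : 0 < mu) (V0 : 0 <= V)
  (betaHF : 12 * (d%:R + 4) * HF * beta <= 1).

Definition finite_difference (x u : 'rV[R]_d) : R :=
  (F (x + mu *: u) - F (x - mu *: u)) / (2 * mu).

(* The smoothness bound for F (x - beta s u) - m0, so that it is nonnegative for
   every s. *)
Definition step_bound (x u : 'rV[R]_d) (s : R) : R :=
  F x - m0 - beta * edot (gradient F x) u * s + HF * beta ^+ 2 * enorm u ^+ 2 * s ^+ 2.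

(* The expectation of [step_bound x u] at a random s with mean the finite
   difference and variance V. *)
Definition mean_step_bound (x u : 'rV[R]_d) : R :=
  step_bound x u (finite_difference x u) + HF * beta ^+ 2 * enorm u ^+ 2 * V.

Lemma step_bound_ge x u s : F (x - beta *: (s *: u)) - m0 <= step_bound x u s.
Proof.
have := smooth_upper (ltW HF0) dF gF x (- (beta *: (s *: u))).
rewrite enormN !enormZ edotNr !edotZr !exprMn !real_normK ?num_real//.
by rewrite /step_bound; set a := edot _ _; set e := enorm u; lra.
Qed.

Lemma step_bound_ge0 x u s : 0 <= step_bound x u s.
Proof. by apply: le_trans (step_bound_ge x u s); rewrite subr_ge0. Qed.

Lemma mean_step_bound_ge0 x u : 0 <= mean_step_bound x u.
Proof.
have HF0' := ltW HF0; have beta0' := ltW beta0.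
by apply: addr_ge0; [exact: step_bound_ge0|rewrite !mulr_ge0 ?sqr_ge0 ?enorm_ge0].
Qed.

Section measurability.
Context {dT : measure_display} {T : measurableType dT}.
Variables X U : T -> borelRV R d.
Hypotheses (mX : measurable_fun setT X) (mU : measurable_fun setT U).

Lemma measurable_F_comp : measurable_fun setT (fun t => F (X t)).
Proof. exact: (measurableT_comp (measurable_differentiable dF) mX). Qed.

Lemma measurable_gradient_comp :
  measurable_fun setT (fun t => gradient F (X t) : borelRV R d).
Proof. exact: (measurableT_comp (measurable_gradient gF) mX). Qed.

Lemma measurable_shift a :
  measurable_fun setT (fun t => (X t : 'rV[R]_d) + a *: (U t : 'rV[R]_d) : borelRV R d).
Proof. by apply: measurable_funD_borelRV => //; exact: measurable_funZ_borelRV. Qed.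

End measurability.

Lemma measurable_finite_difference {dT : measure_display} {T : measurableType dT}
    (X U : T -> borelRV R d) :
  measurable_fun setT X -> measurable_fun setT U ->
  measurable_fun setT (fun t => finite_difference (X t) (U t)).
Proof.
move=> mX mU; apply: measurable_funM => //; apply: measurable_funB.
  exact: measurable_F_comp (measurable_shift mX mU mu).
have := measurable_F_comp (measurable_shift mX mU (- mu)).
by congr (measurable_fun _ _); apply/funext => t; rewrite scaleNr.
Qed.

Lemma measurable_edot_gradient {dT : measure_display} {T : measurableType dT}
    (X U : T -> borelRV R d) :
  measurable_fun setT X -> measurable_fun setT U ->
  measurable_fun setT (fun t => edot (gradient F (X t)) (U t)).
Proof.
by move=> mX mU; apply: measurable_fun_edot => //; exact: measurable_gradient_comp.
Qed.

Lemma measurable_enorm_comp {dT : measure_display} {T : measurableType dT}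
    (U : T -> borelRV R d) :
  measurable_fun setT U -> measurable_fun setT (fun t => enorm (U t)).
Proof. by move=> mU; exact: (measurableT_comp measurable_enorm mU). Qed.

Lemma measurable_step_bound {dT : measure_display} {T : measurableType dT}
    (X U : T -> borelRV R d) (s : T -> R) :
  measurable_fun setT X -> measurable_fun setT U -> measurable_fun setT s ->
  measurable_fun setT (fun t => step_bound (X t) (U t) (s t)).
Proof.
move=> mX mU ms; apply: measurable_funD.
  apply: measurable_funB.
    by apply: measurable_funB => //; exact: measurable_F_comp.
  apply: measurable_funM => //; apply: measurable_funM => //.
  exact: measurable_edot_gradient.
apply: measurable_funM; last exact: measurable_funX.
by apply: measurable_funM => //; apply: measurable_funX; exact: measurable_enorm_comp.
Qed.

Lemma measurable_mean_step_bound {dT : measure_display} {T : measurableType dT}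
    (X U : T -> borelRV R d) :
  measurable_fun setT X -> measurable_fun setT U ->
  measurable_fun setT (fun t => mean_step_bound (X t) (U t)).
Proof.
move=> mX mU; apply: measurable_funD.
  by apply: measurable_step_bound => //; exact: measurable_finite_difference.
apply: measurable_funM => //; apply: measurable_funM => //; apply: measurable_funX.
exact: measurable_enorm_comp.
Qed.

(** With e = <grad F x, u> and G = e + r, two weighted Young inequalities are used: - e G <= - 3/4
    e^2 + r^2 and G^2 <= 5/4 e^2 + 5 r^2. The weights are uneven in order to lose little on e^2, the
    source of descent; r is only as large as the smoothing error. *)
Lemma mean_step_bound_le x u :
  mean_step_bound x u + 3 / 4 * beta * edot (gradient F x) u ^+ 2 <=
  F x - m0 + beta * HF ^+ 2 * mu ^+ 2 * enorm u ^+ 4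
  + 5 / 4 * HF * beta ^+ 2 * (enorm u ^+ 2 * edot (gradient F x) u ^+ 2)
  + 5 * HF ^+ 3 * beta ^+ 2 * mu ^+ 2 * enorm u ^+ 6
  + HF * beta ^+ 2 * V * enorm u ^+ 2.
Proof.
have := finite_difference_error (ltW HF0) dF gF x u mu0.
rewrite -/(finite_difference x u) /mean_step_bound /step_bound.
have HF0' := ltW HF0; have beta0' := ltW beta0; have mu0' := ltW mu0.
set G := finite_difference x u; set e := edot _ _; set n := enorm u => h.
pose r := G - e; have Ge : G = e + r by rewrite addrC subrK.
have r2 : r ^+ 2 <= (HF * mu * n ^+ 2) ^+ 2.
  by rewrite -[r ^+ 2]real_normK ?num_real// lerXn2r// nnegrE ?mulr_ge0 ?sqr_ge0 ?enorm_ge0.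
rewrite Ge.
have i1 : - beta * e * (e + r) + 3 / 4 * beta * e ^+ 2 <= beta * r ^+ 2.
  have : 0 <= beta * (e / 2 + r) ^+ 2 by rewrite mulr_ge0 ?sqr_ge0 ?enorm_ge0.
  by rewrite -subr_ge0 => h1; rewrite -subr_ge0; move: h1; rewrite subr0; congr (_ <= _); field.
have i2 : (e + r) ^+ 2 <= 5 / 4 * e ^+ 2 + 5 * r ^+ 2.
  have : 0 <= (e / 2 - 2 * r) ^+ 2 by rewrite sqr_ge0.
  by move=> h1; rewrite -subr_ge0; move: h1; congr (_ <= _); field.
have c0 : 0 <= HF * beta ^+ 2 * n ^+ 2.
  by rewrite !mulr_ge0 ?sqr_ge0 ?enorm_ge0.
have i3 := ler_wpM2l c0 i2.
have i4 : HF * beta ^+ 2 * n ^+ 2 * (5 * r ^+ 2) <=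
   HF * beta ^+ 2 * n ^+ 2 * (5 * (HF * mu * n ^+ 2) ^+ 2).
  by rewrite ler_wpM2l// ler_wpM2l.
have i5 : beta * r ^+ 2 <= beta * (HF * mu * n ^+ 2) ^+ 2.
  by rewrite ler_wpM2l// ltW.
have -> : beta * HF ^+ 2 * mu ^+ 2 * n ^+ 4 = beta * (HF * mu * n ^+ 2) ^+ 2 by ring.
have -> : 5 * HF ^+ 3 * beta ^+ 2 * mu ^+ 2 * n ^+ 6 =
  HF * beta ^+ 2 * n ^+ 2 * (5 * (HF * mu * n ^+ 2) ^+ 2) by ring.
rewrite mulrDr in i3.
lra.
Qed.

(** With g = grad F x, the moments turn 3/4 beta <g, u>^2 into at least 27/40 beta |g|^2, while HF
    beta d <= 1/12 bounds the competing term by 5/12 beta |g|^2; the difference exceeds 1/8. The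
    constant 431 bounds 4 + 5 * 1024 / 12, which comes from the fourth and sixth moments. *)
Lemma mean_step_bound_gaussian (gamma : probability (borelRV R d) R) x :
  (forall B : 'I_d -> set R, (forall i, measurable (B i)) ->
    gamma (box B) = (\prod_(i < d) normal_prob 0 1 (B i))%E) ->
  (\int[gamma]_u (mean_step_bound x u)%:E + (beta / 8 * enorm (gradient F x) ^+ 2)%:E <=
   (F x - m0 + (431 * beta * HF ^+ 2 * mu ^+ 2 * d%:R ^+ 2 +
     3 * HF * beta ^+ 2 * d%:R * V))%:E)%E.
Proof.
move=> gE; have mu0' := ltW mu0; have HF0' := ltW HF0; have beta0' := ltW beta0; set g := gradient F x.
have mid : measurable_fun [set: borelRV R d] (id : borelRV R d -> borelRV R d).
  exact: measurable_id.
have mc : measurable_fun [set: borelRV R d] (fun _ => x : borelRV R d).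
  exact: measurable_cst.
have me := measurable_edot_gradient mc mid.
have mn : measurable_fun [set: borelRV R d] (@enorm R d) := measurable_enorm.
have nX n : measurable_fun [set: borelRV R d] (fun u : 'rV[R]_d => (enorm u ^+ n)%:E).
  by apply/measurable_EFinP; exact: measurable_funX.
have mne : measurable_fun [set: borelRV R d]
    (fun u : 'rV[R]_d => (enorm u ^+ 2 * edot g u ^+ 2)%:E).
  by apply/measurable_EFinP; apply: measurable_funM; exact: measurable_funX.
have me2 : measurable_fun [set: borelRV R d] (fun u : 'rV[R]_d => (edot g u ^+ 2)%:E).
  by apply/measurable_EFinP; exact: measurable_funX.
have mq : measurable_fun [set: borelRV R d] (fun u => (mean_step_bound x u)%:E).
  by apply/measurable_EFinP; exact: (measurable_mean_step_bound mc mid).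
pose K0 := F x - m0.
pose K1 := beta * HF ^+ 2 * mu ^+ 2.
pose K2 := 5 / 4 * HF * beta ^+ 2.
pose K3 := 5 * HF ^+ 3 * beta ^+ 2 * mu ^+ 2.
pose K4 := HF * beta ^+ 2 * V.
pose Ke := 3 / 4 * beta.
have K00 : 0 <= K0 by rewrite subr_ge0.
have K10 : 0 <= K1 by rewrite /K1 !mulr_ge0 ?sqr_ge0 ?enorm_ge0.
have K20 : 0 <= K2 by rewrite /K2 !mulr_ge0 ?sqr_ge0 ?enorm_ge0.
have K30 : 0 <= K3 by rewrite /K3 !mulr_ge0 ?exprn_ge0.
have K40 : 0 <= K4 by rewrite /K4 !mulr_ge0 ?sqr_ge0 ?enorm_ge0.
have Ke0 : 0 <= Ke by rewrite /Ke !mulr_ge0.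
have nn n (u : 'rV[R]_d) : (0 <= (enorm u ^+ n)%:E)%E by rewrite lee_fin exprn_ge0 ?enorm_ge0.
have ne (u : 'rV[R]_d) : (0 <= (enorm u ^+ 2 * edot g u ^+ 2)%:E)%E.
  by rewrite lee_fin mulr_ge0 ?sqr_ge0 ?enorm_ge0.
have e2 (u : 'rV[R]_d) : (0 <= (edot g u ^+ 2)%:E)%E by rewrite lee_fin sqr_ge0.
have qp (u : 'rV[R]_d) : (0 <= (mean_step_bound x u)%:E)%E by rewrite lee_fin mean_step_bound_ge0.
have main : (\int[gamma]_u (mean_step_bound x u)%:E + Ke%:E * \int[gamma]_u (edot g u ^+ 2)%:E <=
  K0%:E + K1%:E * \int[gamma]_u (enorm u ^+ 4)%:E +
  K2%:E * \int[gamma]_u (enorm u ^+ 2 * edot g u ^+ 2)%:E +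
  K3%:E * \int[gamma]_u (enorm u ^+ 6)%:E + K4%:E * \int[gamma]_u (enorm u ^+ 2)%:E)%E.
  have g1 : (\int[gamma]_u K0%:E = K0%:E)%E.
    rewrite integral_cst// [X in (_ * X)%E](_ : _ = 1%E) ?mule1//.
    exact: (probability_setT gamma).
  have p K (f : 'rV[R]_d -> \bar R) : 0 <= K -> (forall u, 0 <= f u)%E -> 
      forall u, (0 <= K%:E * f u)%E by move=> K0' f0 u; rewrite mule_ge0.
  have i K (f : 'rV[R]_d -> \bar R) : 0 <= K -> (forall u, 0 <= f u)%E -> 
      measurable_fun [set: borelRV R d] f ->
      (K%:E * \int[gamma]_u f u = \int[gamma]_u (K%:E * f u))%E.
    by move=> K0' f0 mf; rewrite ge0_integralZl_EFin.
  have a (f h : 'rV[R]_d -> \bar R) : (forall u, 0 <= f u)%E -> (forall u, 0 <= h u)%E ->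
      measurable_fun [set: borelRV R d] f -> measurable_fun [set: borelRV R d] h ->
      (\int[gamma]_u f u + \int[gamma]_u h u = \int[gamma]_u (f u + h u))%E.
    by move=> f0 h0 mf mh; rewrite ge0_integralD.
  have m K (f : 'rV[R]_d -> \bar R) : measurable_fun [set: borelRV R d] f ->
      measurable_fun [set: borelRV R d] (fun u => K%:E * f u)%E.
    by move=> mf; exact: measurable_funeM.
  have q0 : forall u : 'rV[R]_d, (0 <= (fun=> K0%:E) u)%E by move=> u; rewrite lee_fin.
  have mq0 : measurable_fun [set: borelRV R d] (fun=> K0%:E) by exact: measurable_cst.
  rewrite !i// -g1 (a _ _ qp (p _ _ Ke0 e2) mq (m _ _ me2)).
  have q1 : forall u, (0 <= K0%:E + K1%:E * (enorm (u : 'rV[R]_d) ^+ 4)%:E)%E.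
    by move=> u; apply: adde_ge0; [exact: (q0 u)|exact: (p _ _ K10 (nn 4%N))].
  have mq1 := emeasurable_funD mq0 (m K1 _ (nX 4%N)).
  have q2 : forall u, (0 <= K0%:E + K1%:E * (enorm (u : 'rV[R]_d) ^+ 4)%:E +
    K2%:E * (enorm u ^+ 2 * edot g u ^+ 2)%:E)%E.
    by move=> u; apply: adde_ge0; [exact: q1|exact: (p _ _ K20 ne)].
  have mq2 := emeasurable_funD mq1 (m K2 _ mne).
  have q3 : forall u, (0 <= K0%:E + K1%:E * (enorm (u : 'rV[R]_d) ^+ 4)%:E +
    K2%:E * (enorm u ^+ 2 * edot g u ^+ 2)%:E + K3%:E * (enorm u ^+ 6)%:E)%E.
    by move=> u; apply: adde_ge0; [exact: q2|exact: (p _ _ K30 (nn 6%N))].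
  have mq3 := emeasurable_funD mq2 (m K3 _ (nX 6%N)).
  rewrite (a _ _ q0 (p _ _ K10 (nn 4%N)) mq0 (m _ _ (nX 4%N))).
  rewrite (a _ _ q1 (p _ _ K20 ne) mq1 (m _ _ mne)).
  rewrite (a _ _ q2 (p _ _ K30 (nn 6%N)) mq2 (m _ _ (nX 6%N))).
  rewrite (a _ _ q3 (p _ _ K40 (nn 2%N)) mq3 (m _ _ (nX 2%N))).
  apply: ge0_le_integral; [by []| | | |].
  - by move=> u _; apply: adde_ge0; [exact: qp|exact: (p _ _ Ke0 e2)].
  - exact: emeasurable_funD mq (m Ke _ me2).
  - exact: emeasurable_funD mq3 (m K4 _ (nX 2%N)).
  - move=> u _; rewrite -!EFinM -!EFinD lee_fin; exact: mean_step_bound_le.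
have lb := gaussian_edot_sqr_ge gE g.
have ub2 := gaussian_enorm2_le gE.
have ub4 := gaussian_enorm4_le gE.
have ub6 := gaussian_enorm6_le gE.
have ube := gaussian_enorm2_edot2_le gE g.
have main2 : (\int[gamma]_u (mean_step_bound x u)%:E + (Ke * (9 / 10 * enorm g ^+ 2))%:E <=
   (K0 + K1 * (4 * d%:R ^+ 2) + K2 * (4 * d%:R * enorm g ^+ 2) + K3 * (1024 * d%:R ^+ 3) + K4 * (3 * d%:R))%:E)%E.
  apply: le_trans (le_trans main _).
    by apply: leeD => //; rewrite EFinM lee_wpmul2l.
  rewrite !EFinD !(EFinM K1, EFinM K2, EFinM K3, EFinM K4).
  by repeat apply: leeD => //; apply: lee_wpmul2l; rewrite ?lee_fin.
move: main2; have : (0 <= \int[gamma]_u (mean_step_bound x u)%:E)%E by exact: integral_ge0.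
case: (\int[gamma]_u _)%E => [I| |]// _; rewrite -!EFinD !lee_fin.
rewrite -/K0; set G2 := enorm g ^+ 2 => h.
have G20 : 0 <= G2 by rewrite sqr_ge0.
have t12 : HF * beta * d%:R <= 1 / 12.
  rewrite ler_pdivlMr//; apply: le_trans betaHF.
  rewrite -subr_ge0 (_ : _ - _ = 48 * (HF * beta)); last by ring.
  by rewrite mulr_ge0// mulr_ge0.
have bG : 0 <= beta * G2 by rewrite mulr_ge0.
have P0 : 0 <= beta * HF ^+ 2 * mu ^+ 2 * d%:R ^+ 2.
  by rewrite !mulr_ge0 ?sqr_ge0.
have i1 := ler_wpM2r bG t12.
have i2 := ler_wpM2r P0 t12.
have f2 : K2 * (4 * d%:R * G2) = 5 * (HF * beta * d%:R * (beta * G2)).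
  by rewrite /K2; field.
have e3 : K3 * (1024 * d%:R ^+ 3) =
    5 * (1024 * (HF * beta * d%:R * (beta * HF ^+ 2 * mu ^+ 2 * d%:R ^+ 2))).
  by rewrite /K3; ring.
have e4 : K4 * (3 * d%:R) = 3 * HF * beta ^+ 2 * d%:R * V by rewrite /K4; ring.
have e1 : K1 * (4 * d%:R ^+ 2) = 4 * (beta * HF ^+ 2 * mu ^+ 2 * d%:R ^+ 2).
  by rewrite /K1; ring.
have e5 : Ke * (9 / 10 * G2) = 27 / 40 * (beta * G2) by rewrite /Ke; field.
have e6 : beta / 8 * G2 = 1 / 8 * (beta * G2) by field.
have e7 : 431 * beta * HF ^+ 2 * mu ^+ 2 * d%:R ^+ 2 =
  431 * (beta * HF ^+ 2 * mu ^+ 2 * d%:R ^+ 2) by ring.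
rewrite e1 f2 e3 e4 e5 in h; rewrite e6 e7.
lra.
Qed.

End descent.

(** The linear term integrates to 0. The bound on the second moment is used twice: on the quadratic
    term, and through |t| <= 1 + t^2 for the integrability that allows the sum to be split. *)
Lemma integral_centered_quadratic {dT : measure_display} {T : measurableType dT}
    {R : realType} (Q : probability T R) (psi : T -> R) (a b c s2 : R) :
  measurable_fun setT psi -> 0 <= c -> 0 <= s2 ->
  (forall s, 0 <= a + b * s + c * s ^+ 2) ->
  (\int[Q]_z (psi z)%:E = 0)%E -> (\int[Q]_z (psi z ^+ 2)%:E <= s2%:E)%E ->
  (\int[Q]_z (a + b * psi z + c * psi z ^+ 2)%:E <= (a + c * s2)%:E)%E.
Proof.
move=> mpsi c0 s20 q0 psi1 psi2.
have m2 : measurable_fun setT (fun z => (psi z ^+ 2)%:E).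
  by apply/measurable_EFinP; exact: measurable_funX.
have i2 : Q.-integrable setT (fun z => (psi z ^+ 2)%:E).
  apply/integrableP; split => //; apply: le_lt_trans (ltry s2).
  by under eq_integral do rewrite gee0_abs ?lee_fin ?sqr_ge0//.
have icst (r : R) : Q.-integrable setT (fun=> r%:E).
  by apply: finite_measure_integrable_cst.
have i1 : Q.-integrable setT (fun z => (psi z)%:E).
  apply: (@le_integrable _ _ _ Q setT measurableT _ (fun z => 1%:E + (psi z ^+ 2)%:E)%E).
  - exact/measurable_EFinP.
  - move=> z _; rewrite -EFinD !abse_EFin lee_fin [leRHS]ger0_norm ?addr_ge0 ?sqr_ge0//.
    rewrite -[psi z ^+ 2]real_normK ?num_real//.
    have := sqr_ge0 (`|psi z| - 1); set t := `|psi z| => h.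
    have : 0 <= t ^+ 2 by exact: sqr_ge0.
    by rewrite sqrrB1 in h; lra.
  - exact: integrableD.
have -> : (\int[Q]_z (a + b * psi z + c * psi z ^+ 2)%:E =
   a%:E + b%:E * \int[Q]_z (psi z)%:E + c%:E * \int[Q]_z (psi z ^+ 2)%:E)%E.
  rewrite -integralZl// -[in RHS]integralZl//.
  have <- : (\int[Q]_z a%:E = a%:E)%E.
    by rewrite integral_cst// [X in (_ * X)%E](probability_setT Q) mule1.
  rewrite -integralD//; last exact: integrableZl.
  rewrite -integralD//; last exact: integrableZl.
  by apply: integrableD => //; exact: integrableZl.
rewrite psi1 mule0 adde0 EFinD EFinM.
by apply: leeD2l; apply: lee_wpmul2l.
Qed.

(* The samples are integrated out one at a time, conditionally on Y and on the
   previous ones. A quadratic that is nonnegative on R then only ever gives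
   nonnegative integrands, and no integrability has to be checked. *)
Section sequential_sampling.
Context {dO d1 d2 : measure_display} {Omega : measurableType dO}
  {T1 : measurableType d1} {T2 : measurableType d2} {R : realType}.
Variables (P : probability Omega R) (Y : Omega -> T1) (n : nat)
  (xi : nat -> Omega -> T2) (k : nat -> T1 -> probability T2 R).
Hypotheses (mY : measurable_fun setT Y) (mxi : forall i, measurable_fun setT (xi i))
  (mk : forall i (U : set T2), measurable U -> measurable_fun setT (fun y => k i y U)).
Hypothesis joint : forall (C : set T1) (B : nat -> set T2),
  measurable C -> (forall i, measurable (B i)) ->
  P (Y @^-1` C `&` [set w | forall i, (i < n)%N -> B i (xi i w)]) =
  (\int[P]_(w in Y @^-1` C) \prod_(i < n) k i (Y w) (B i))%E.
Local Open Scope ereal_scope.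

Let mYC C : measurable C -> measurable (Y @^-1` C).
Proof. by move=> mC; rewrite -[X in measurable X]setTI; exact: mY. Qed.

Let mxiB i B : measurable B -> measurable (xi i @^-1` B).
Proof. by move=> mB; rewrite -[X in measurable X]setTI; exact: mxi. Qed.

Definition sampled (j : nat) (B : nat -> set T2) : set Omega :=
  [set w | forall i, (i < j)%N -> B i (xi i w)].

Let msampled j B : (forall i, measurable (B i)) -> measurable (sampled j B).
Proof.
move=> mB; rewrite (_ : sampled j B = \bigcap_(i in `I_j) xi i @^-1` B i)//.
by apply: fin_bigcap_measurable => // i _; exact: mxiB.
Qed.

(** The later samples are left free by taking the whole space for their sets; their factors are then
    1. *)
Lemma joint_prefix j (C : set T1) (B : nat -> set T2) : (j <= n)%N ->
  measurable C -> (forall i, measurable (B i)) ->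
  P (Y @^-1` C `&` sampled j B) =
  \int[P]_(w in Y @^-1` C) \prod_(i < j) k i (Y w) (B i).
Proof.
move=> jn mC mB; pose B' i := if (i < j)%N then B i else setT.
have mB' i : measurable (B' i) by rewrite /B'; case: ifP.
transitivity (P (Y @^-1` C `&` [set w | forall i, (i < n)%N -> B' i (xi i w)])).
  congr (P (_ `&` _)); apply/seteqP; split => w /= h i iN; rewrite ?/B'.
    by case: ifP => // /h.
  by have := h i (leq_trans iN jn); rewrite /B' iN.
rewrite joint//; apply: eq_integral => w _.
rewrite (big_ord_widen_cond n xpredT (fun i => k i (Y w) (B i)) jn)/=.
rewrite [RHS]big_mkcond/=; apply: eq_bigr => i _; rewrite /B'.
by case: ifP => // _; exact: probability_setT.
Qed.

Let kprod_fin j B y : (forall i, measurable (B i)) ->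
  \prod_(i < j) k i y (B i) = (\prod_(i < j) fine (k i y (B i)))%:E.
Proof.
move=> mB; elim/big_rec2 : _ => // i x z _ ->.
by rewrite EFinM fineK//; exact: fin_num_measure.
Qed.

(** Read on densities, [joint_prefix] says that P restricted to [sampled j B] and pushed forward by
    Y has density the product of the k i y (B i) with respect to the law of Y. *)
Lemma joint_integral j (B : nat -> set T2) (h : T1 -> \bar R) : (j <= n)%N ->
  (forall i, measurable (B i)) -> (forall y, 0 <= h y) -> measurable_fun setT h ->
  \int[P]_(w in sampled j B) h (Y w) =
  \int[P]_w (h (Y w) * \prod_(i < j) k i (Y w) (B i)).
Proof.
move=> jn mB h0 mh; pose S := sampled j B; have mS := msampled j mB.
pose g y := (\prod_(i < j) fine (k i y (B i)))%R.
have mg : measurable_fun setT g.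
  apply: measurable_prod => i _; apply: measurableT_comp (mk i (mB i)).
  exact: fine_measurable.
have g0 y : (0 <= g y)%R by apply: prodr_ge0 => i _; rewrite fine_ge0.
transitivity (\int[pushforward (mrestr P mS) Y]_y h y).
  rewrite ge0_integral_pushforward//= preimage_setT.
  rewrite (@ge0_integral_density _ _ _ P (mrestr P mS) \1_S)//=.
  - rewrite integral_mkcond; apply: eq_integral => w _.
    by rewrite patchE indicE; case: ifP => _; rewrite ?mule1 ?mule0.
  - by move=> A mA; rewrite /mrestr integral_indic// setIC.
  - exact: measurableT_comp mh mY.
rewrite (@ge0_integral_density _ _ _ (pushforward P Y) _ g)//.
  rewrite ge0_integral_pushforward//.
  - by rewrite preimage_setT; apply: eq_integral => w _; rewrite /= kprod_fin.
  - by apply: emeasurable_funM => //; exact/measurable_EFinP.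
  - by move=> y _; rewrite mule_ge0// lee_fin.
move=> A mA; apply: etrans (joint_prefix jn mA mB) _.
rewrite ge0_integral_pushforward//.
- by apply: eq_integral => w _ /=; rewrite kprod_fin.
- by apply/measurable_EFinP; exact: measurable_funTS.
- by move=> y _; rewrite lee_fin.
Qed.

(* A pi-system that generates the sigma-algebra of Y, xi 0, ..., xi (j - 1). *)
Definition prefix_sets (j : nat) : set (set Omega) :=
  [set A | exists2 C : set T1, measurable C &
     exists2 B : nat -> set T2, forall i, measurable (B i) &
       A = Y @^-1` C `&` sampled j B].

(** Omega with only the information carried by Y and the first j samples. The conditional law given
    the identity into this space is the conditional law given that sigma-algebra. *)
Let Omegaj j := g_sigma_algebraType (prefix_sets j).

Let mprefix j A : <<s prefix_sets j >> A -> measurable A.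
Proof.
apply: smallest_sub; first exact: sigma_algebra_measurable.
by move=> _ [C mC [B mB ->]]; apply: measurableI; [exact: mYC|exact: msampled].
Qed.

Let mid j : measurable_fun setT (id : Omega -> Omegaj j).
Proof. by move=> _ A mA; rewrite setTI; exact: mprefix mA. Qed.

Let mYj j : measurable_fun setT (Y : Omegaj j -> T1).
Proof.
move=> _ C mC; rewrite setTI; apply: sub_sigma_algebra.
by exists C => //; exists (fun=> setT) => //; apply/seteqP; split => w //= [].
Qed.

Let mxij i j : (i < j)%N -> measurable_fun setT (xi i : Omegaj j -> T2).
Proof.
move=> ij _ B mB; rewrite setTI; apply: sub_sigma_algebra.
exists setT => //; exists (fun l => if l == i then B else setT).
  by move=> l; case: ifP.
apply/seteqP; split => w /=.
  by move=> Bw; split => // l _; case: eqP => // ->.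
by move=> [_ /(_ i ij)]; rewrite eqxx.
Qed.

(** On the generating pi-system, one more sample only multiplies the density of [joint_integral] by
    the factor k j (Y w) B'. Hence, given Y, sample j has the same law whatever the previous samples
    are. *)
Lemma conditional_law_prefix j : (j < n)%N ->
  conditional_law P (id : Omega -> Omegaj j) (xi j) (fun w => k j (Y w)).
Proof.
move=> jn; apply: (conditional_law_generated (@mid j) (@mxi j) _ (G := prefix_sets j)) => //.
- by move=> U mU; exact: (measurableT_comp (mk j mU) (@mYj j)).
- move=> _ _ [C mC [B mB ->]] [C' mC' [B' mB' ->]].
  exists (C `&` C'); first exact: measurableI.
  exists (fun i => B i `&` B' i); first by move=> i; exact: measurableI.
  apply/seteqP; split => w /=.
    by move=> [[Cw h] [C'w h']]; split => // i ij; split; [exact: h|exact: h'].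
  by move=> [[Cw C'w] h]; split; split => // i ij; have [] := h i ij.
- by exists setT => //; exists (fun=> setT) => //; apply/seteqP; split.
- move=> _ B' [C mC [B mB ->]] mB'; rewrite preimage_id.
  (* Appends the constraint on sample j; values beyond j are irrelevant to [sampled j.+1]. *)
  pose Bs i := if (i < j)%N then B i else B'.
  have mBs i : measurable (Bs i) by rewrite /Bs; case: ifP.
  have -> : Y @^-1` C `&` sampled j B `&` xi j @^-1` B' =
      Y @^-1` C `&` sampled j.+1 Bs.
    apply/seteqP; split => w /= => [[[Cw h] Bw]|[Cw h]].
      split => // i; rewrite ltnS leq_eqVlt => /orP[/eqP ->|ij].
        by rewrite /Bs ltnn.
      by rewrite /Bs ij; exact: h.
    split; last by have := h j (ltnSn j); rewrite /Bs ltnn.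
    by split => // i ij; have := h i (ltnW ij); rewrite /Bs ij.
  rewrite joint_prefix//.
  pose h y := (\1_C y)%:E * k j y B'.
  transitivity (\int[P]_(w in sampled j B) h (Y w)); last first.
    rewrite integral_mkcond [RHS]integral_mkcond.
    apply: eq_integral => w _; rewrite !patchE in_setI andbC.
    have -> : (w \in Y @^-1` C) = (Y w \in C) by apply/idP/idP; rewrite !inE.
    rewrite /h indicE; case: (Y w \in C); case: (w \in sampled j B) => //=.
      by rewrite mul1e.
    by rewrite mul0e.
  have mh : measurable_fun setT h.
    by apply: emeasurable_funM; [exact/measurable_EFinP|exact: mk].
  rewrite joint_integral//; [|exact: ltnW|by move=> y; rewrite mule_ge0// lee_fin].
  rewrite integral_mkcond; apply: eq_integral => w _.
  rewrite patchE /h indicE.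
  have -> : (w \in Y @^-1` C) = (Y w \in C) by apply/idP/idP; rewrite !inE.
  case: ifP => _; last by rewrite !mul0e.
  rewrite mul1e big_ord_recr/= muleC {1}/Bs ltnn; congr (_ * _).
  by apply: eq_bigr => i _; rewrite /Bs ltn_ord.
Qed.

Variables (psi : nat -> T1 * T2 -> R) (b c : T1 -> R) (s2 : R).
Hypotheses (mpsi : forall i, measurable_fun setT (psi i))
  (mb : measurable_fun setT b) (mc : measurable_fun setT c)
  (c0 : forall y, (0 <= c y)%R) (s20 : (0 <= s2)%R)
  (psi_mean : forall i y, (i < n)%N -> \int[k i y]_z (psi i (y, z))%:E = 0)
  (psi_var : forall i y, (i < n)%N ->
     \int[k i y]_z (psi i (y, z) ^+ 2)%:E <= s2%:E).

Definition noise (j : nat) (w : Omega) : R :=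
  (\sum_(i < j) psi i (Y w, xi i w))%R.

Let mnoise j : measurable_fun setT (noise j : Omegaj j -> R).
Proof.
apply: measurable_sum => i; apply: (measurableT_comp (mpsi i)).
by apply: measurable_fun_pair; [exact: mYj|exact: mxij].
Qed.

(** Integrating out the last sample replaces [a] by a + c s2 and leaves [b] and [c] unchanged, which
    is why the induction quantifies over [a]. The new quadratic is still nonnegative because c s2
    is. *)
Lemma quadratic_noise_le j (a : T1 -> R) : (j <= n)%N ->
  measurable_fun setT a ->
  (forall y s, (0 <= a y + b y * s + c y * s ^+ 2)%R) ->
  \int[P]_w (a (Y w) + b (Y w) * noise j w + c (Y w) * noise j w ^+ 2)%:E <=
  \int[P]_w (a (Y w) + c (Y w) * (j%:R * s2))%:E.
Proof.
elim: j a => [|j IH] a jn ma q0.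
  apply: ge0_le_integral => //.
  - by move=> w _; rewrite lee_fin.
  - apply/measurable_EFinP; rewrite /noise; under eq_fun do rewrite big_ord0.
    apply: measurable_funD.
      apply: measurable_funD; first exact: measurableT_comp ma mY.
      by apply: measurable_funM => //; exact: measurableT_comp mb mY.
    by apply: measurable_funM => //; exact: measurableT_comp mc mY.
  - apply/measurable_EFinP; apply: measurable_funD; first exact: measurableT_comp ma mY.
    by apply: measurable_funM => //; exact: measurableT_comp mc mY.
  - move=> w _; rewrite lee_fin /noise big_ord0 !mulr0 !mul0r !expr0n/= !mulr0.
    by rewrite !addr0.
(* With the first j samples frozen, [al] and [be] are the coefficients of the quadratic in s
   obtained by evaluating the original one at noise j + s; it inherits nonnegativity from the
   original. *)
pose al (w : Omega) : R := (a (Y w) + b (Y w) * noise j w + c (Y w) * noise j w ^+ 2)%R.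
pose be (w : Omega) : R := (b (Y w) + 2 * (c (Y w) * noise j w))%R.
have maj : measurable_fun setT (a \o Y : Omegaj j -> R) := measurableT_comp ma (@mYj j).
have mbj : measurable_fun setT (b \o Y : Omegaj j -> R) := measurableT_comp mb (@mYj j).
have mcj : measurable_fun setT (c \o Y : Omegaj j -> R) := measurableT_comp mc (@mYj j).
have mN := @mnoise j.
have mal : measurable_fun setT (al : Omegaj j -> R).
  apply: measurable_funD.
    by apply: measurable_funD => //; exact: measurable_funM.
  by apply: measurable_funM => //; exact: measurable_funX.
have mbe : measurable_fun setT (be : Omegaj j -> R).
  by apply: measurable_funD => //; apply: measurable_funM => //; exact: measurable_funM.
have alq (w : Omega) s : (0 <= al w + be w * s + c (Y w) * s ^+ 2)%R.
  by have := q0 (Y w) (noise j w + s)%R; rewrite /al /be; congr (_ <= _)%R; ring.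
pose f (x : Omegaj j * T2) : \bar R :=
  (al x.1 + be x.1 * psi j (Y x.1, x.2) + c (Y x.1) * psi j (Y x.1, x.2) ^+ 2)%:E.
have mf : measurable_fun setT f.
  have m1 : measurable_fun [set: Omegaj j * T2] (fst : Omegaj j * T2 -> Omegaj j).
    exact: measurable_fst.
  have mp : measurable_fun [set: Omegaj j * T2] (fun x => psi j (Y x.1, x.2)).
    apply: (measurableT_comp (mpsi j)); apply: measurable_fun_pair => //.
    exact: (measurableT_comp (@mYj j) m1).
  apply/measurable_EFinP; apply: measurable_funD.
    apply: measurable_funD; first exact: (measurableT_comp mal m1).
    by apply: measurable_funM => //; exact: (measurableT_comp mbe m1).
  apply: measurable_funM; first exact: (measurableT_comp mcj m1).
  exact: measurable_funX.
have f0 x : 0 <= f x by rewrite lee_fin.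
have -> : \int[P]_w (a (Y w) + b (Y w) * noise j.+1 w + c (Y w) * noise j.+1 w ^+ 2)%:E =
  \int[P]_w f (id w : Omegaj j, xi j w).
  apply: eq_integral => w _; rewrite /f /al /be /noise big_ord_recr/=; congr _%:E.
  by ring.
rewrite (ge0_disintegration (@mid j) (@mxi j) _ (conditional_law_prefix jn) f0 mf); last first.
  by move=> U mU; exact: (measurableT_comp (mk j mU) (@mYj j)).
have jn' : (j <= n)%N := ltnW jn.
pose a' y := (a y + c y * s2)%R.
have ma' : measurable_fun setT a' by apply: measurable_funD => //; exact: measurable_funM.
have q0' y s : (0 <= a' y + b y * s + c y * s ^+ 2)%R.
  have : (0 <= c y * s2)%R by rewrite mulr_ge0.
  by have := q0 y s; rewrite /a'; lra.
apply: le_trans (le_trans (IH a' jn' ma' q0') _); last first.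
  rewrite le_eqVlt; apply/orP; left; apply/eqP; apply: eq_integral => w _.
  by rewrite /a' -natr1; congr _%:E; ring.
have mall : measurable_fun setT (fun w : Omegaj j =>
    a' (Y w) + b (Y w) * noise j w + c (Y w) * noise j w ^+ 2)%R.
  apply: measurable_funD; last by apply: measurable_funM => //; exact: measurable_funX.
  apply: measurable_funD; first exact: measurableT_comp ma' (@mYj j).
  exact: measurable_funM.
apply: ge0_le_integral; [by []| | | |].
- by move=> w _; exact: integral_ge0.
- apply: (measurableT_comp (f := fun w : Omegaj j =>
    \int[k j (Y w)]_z f (w, z)) _ (@mid j)).
  apply: (@measurable_partial_integral _ _ _ _ _ (fun w : Omegaj j => k j (Y w))) => // U mU.
  exact: (measurableT_comp (mk j mU) (@mYj j)).
- exact/measurable_EFinP/(measurableT_comp mall (@mid j)).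
- move=> w _.
  have := @integral_centered_quadratic _ _ R (k j (Y w)) (fun z => psi j (Y w, z))
    (al w) (be w) (c (Y w)) s2.
  move=> /(_ _ _ _ (alq w) (psi_mean _ jn) (psi_var _ jn)) H.
  apply: (le_trans (H _ _ _)) => //.
    by apply: (measurableT_comp (mpsi j)); apply: measurable_fun_pair.
  by rewrite lee_fin /al /a'; lra.
Qed.

End sequential_sampling.

(** * The iterates of Algorithm 2 *)

Section sampling_model.
Context {R : realType} {d p : nat}.
Variables (f : 'rV[R]_d -> 'rV[R]_p -> R)
  (D : 'rV[R]_d -> probability (borelRV R p) R) (sigma alpha Lxi Lx HF : R).
Hypothesis fD : assumptions f D sigma alpha Lxi Lx HF.
Local Notation F := (objective f D).

Lemma measurable_f_slice x : measurable_fun [set: borelRV R p] (f x).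
Proof. by apply: (@measurable_lipschitz _ _ _ Lxi); exact: (lipschitz_xi fD). Qed.

Lemma measurable_f_comp {dT : measure_display} {T : measurableType dT}
    (X : T -> borelRV R d) (xi : T -> borelRV R p) :
  measurable_fun setT X -> measurable_fun setT xi ->
  measurable_fun setT (fun t => f (X t) (xi t)).
Proof.
move=> mX mxi.
have := measurable_lipschitz_partial (f := f) (T := borelRV R p)
  (lipschitz_x fD) measurable_f_slice.
by move=> mf; exact: (measurableT_comp mf (measurable_fun_pair mX mxi)).
Qed.

Lemma integrable_deviation x :
  (D x).-integrable setT (fun z => (f x z - F x)%:E).
Proof.
have mdev : measurable_fun [set: borelRV R p] (fun z => f x z - F x).
  by apply: measurable_funB => //; exact: measurable_f_slice.
have i2 : (D x).-integrable setT (fun z => ((F x - f x z) ^+ 2)%:E).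
  apply/integrableP; split.
    apply/measurable_EFinP; apply: measurable_funX; apply: measurable_funB => //.
    exact: measurable_f_slice.
  apply: le_lt_trans (ltry (sigma ^+ 2)).
  under eq_integral do rewrite gee0_abs ?lee_fin ?sqr_ge0//.
  exact: (finite_variance fD).
apply: (@le_integrable _ _ _ (D x) setT measurableT _
  (fun z => 1%:E + ((F x - f x z) ^+ 2)%:E)%E).
- exact/measurable_EFinP.
- move=> z _; rewrite -EFinD !abse_EFin lee_fin [leRHS]ger0_norm ?addr_ge0 ?sqr_ge0//.
  rewrite distrC -[(F x - f x z) ^+ 2]real_normK ?num_real//.
  have := sqr_ge0 (`|F x - f x z| - 1); set t := `|F x - f x z| => h.
  have : 0 <= t ^+ 2 by exact: sqr_ge0.
  by rewrite sqrrB1 in h; lra.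
- by apply: integrableD => //; exact: finite_measure_integrable_cst.
Qed.

(** Since [objective] is a real-valued integral, this requires f x to be integrable under D x: it is
    the sum of the square-integrable deviation and a constant. *)
Lemma integral_deviation x : (\int[D x]_z (f x z - F x)%:E = 0)%E.
Proof.
have icst : (D x).-integrable setT (fun=> (F x)%:E).
  exact: finite_measure_integrable_cst.
have idev := integrable_deviation x.
have iff : (D x).-integrable setT (fun z => (f x z)%:E).
  have := integrableD measurableT idev icst.
  by apply: eq_integrable => // z _; rewrite /= -EFinD subrK.
under eq_integral do rewrite EFinB.
rewrite integralB// integral_cst// [X in (_ - _ * X)%E](probability_setT (D x)) mule1.
rewrite /objective /Rintegral fineK ?subee//; exact: integrable_fin_num.
Qed.

Lemma integral_deviation_scaled x c : (\int[D x]_z (c * (f x z - F x))%:E = 0)%E.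
Proof.
under eq_integral do rewrite EFinM.
by rewrite integralZl ?integral_deviation ?mule0//; exact: integrable_deviation.
Qed.

Lemma integral_deviation_sqr x c :
  (\int[D x]_z ((c * (f x z - F x)) ^+ 2)%:E <= (c ^+ 2 * sigma ^+ 2)%:E)%E.
Proof.
under eq_integral do rewrite exprMn EFinM -[(f x _ - _) ^+ 2]sqrrN opprB.
rewrite ge0_integralZl_EFin ?sqr_ge0//.
- rewrite [leRHS]EFinM; apply: lee_wpmul2l; first by rewrite lee_fin sqr_ge0.
  exact: (finite_variance fD).
- by move=> z _; rewrite lee_fin sqr_ge0.
- apply/measurable_EFinP; apply: measurable_funX; apply: measurable_funB => //.
  exact: measurable_f_slice.
Qed.

Lemma measurable_D_comp {dT : measure_display} {T : measurableType dT}
    (X : T -> borelRV R d) (U : set (borelRV R p)) :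
  measurable_fun setT X -> measurable U -> measurable_fun setT (fun t => D (X t) U).
Proof.
move=> mX mU.
have mD := measurable_wasserstein_kernel (wasserstein_lipschitz fD) mU.
exact: (measurableT_comp mD mX).
Qed.

End sampling_model.

(** * Measurability of the iterates with respect to the past *)

Section run_measurability.
Context {R : realType} {d p : nat}.
Context {dO : measure_display} {Omega : measurableType dO}.

Lemma measurable_fun_sub_sigma (G : set (set Omega)) {n : nat} (X : Omega -> borelRV R n) :
  events X `<=` <<s G >> ->
  measurable_fun [set: g_sigma_algebraType G] (X : g_sigma_algebraType G -> borelRV R n).
Proof. by move=> XG _ B mB; apply: XG; exists B. Qed.

Lemma measurable_id_sub_sigma (G G' : set (set Omega)) :
  G `<=` <<s G' >> ->
  measurable_fun [set: g_sigma_algebraType G'] (id : g_sigma_algebraType G' -> g_sigma_algebraType G).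
Proof.
move=> GG' _ B mB; rewrite setTI; move: B mB.
by apply: smallest_sub => //; exact: smallest_sigma_algebra.
Qed.

Lemma measurable_id_sub_measurable (G : set (set Omega)) :
  G `<=` measurable ->
  measurable_fun [set: Omega] (id : Omega -> g_sigma_algebraType G).
Proof.
move=> Gm _ B mB; rewrite setTI; move: B mB.
by apply: smallest_sub => //; exact: sigma_algebra_measurable.
Qed.

Variables (m : nat -> nat) (S : run R d p Omega).

(** The generating family inside [history], named so that [g_sigma_algebraType] makes a measurable
    type of Omega whose measurable sets are exactly the events of the history. *)
Definition history_generator (k : nat) : set (set Omega) :=
  \bigcup_(i in [set i | (i < k)%N])
    (events (dir S i) `|` \bigcup_(j in [set j | (j < m i)%N])
       (events (smp1 S i j) `|` events (smp2 S i j))).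

Definition history_dir_generator (k : nat) : set (set Omega) :=
  history m S k `|` events (dir S k).

Local Notation H k := (g_sigma_algebraType (history_generator k)).
Local Notation Hdir k := (g_sigma_algebraType (history_dir_generator k)).

Lemma events_measurable {n : nat} (X : {mfun Omega >-> borelRV R n}) :
  events X `<=` measurable.
Proof. by move=> _ [B mB <-]; exact: measurable_funP. Qed.

Lemma history_generator_measurable k : history_generator k `<=` measurable.
Proof.
move=> A [i _ [|[j _ [|]]]]; exact: events_measurable.
Qed.

Lemma history_dir_generator_measurable k : history_dir_generator k `<=` measurable.
Proof.
move=> A [|]; last exact: events_measurable.
apply: smallest_sub; first exact: sigma_algebra_measurable.
exact: history_generator_measurable.
Qed.

Lemma measurable_id_history k : measurable_fun [set: Omega] (id : Omega -> H k).
Proof. exact/measurable_id_sub_measurable/history_generator_measurable. Qed.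

Lemma measurable_id_history_dir k : measurable_fun [set: Omega] (id : Omega -> Hdir k).
Proof. exact/measurable_id_sub_measurable/history_dir_generator_measurable. Qed.

Lemma measurable_history_dir_history k : measurable_fun [set: Hdir k] (id : Hdir k -> H k).
Proof.
apply: measurable_id_sub_sigma => A hA; apply: sub_sigma_algebra; left.
exact: sub_sigma_algebra.
Qed.

Lemma measurable_history_mono k l : (k <= l)%N -> measurable_fun [set: H l] (id : H l -> H k).
Proof.
move=> kl; apply: measurable_id_sub_sigma => A [i ik hA].
by apply: sub_sigma_algebra; exists i => //; exact: leq_trans ik kl.
Qed.

Lemma measurable_dir_history k i : (i < k)%N ->
  measurable_fun [set: H k] (dir S i : H k -> borelRV R d).
Proof.
move=> ik; apply: measurable_fun_sub_sigma => A hA; apply: sub_sigma_algebra.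
by exists i => //; left.
Qed.

Lemma measurable_smp1_history k i j : (i < k)%N -> (j < m i)%N ->
  measurable_fun [set: H k] (smp1 S i j : H k -> borelRV R p).
Proof.
move=> ik jm; apply: measurable_fun_sub_sigma => A hA; apply: sub_sigma_algebra.
by exists i => //; right; exists j => //; left.
Qed.

Lemma measurable_smp2_history k i j : (i < k)%N -> (j < m i)%N ->
  measurable_fun [set: H k] (smp2 S i j : H k -> borelRV R p).
Proof.
move=> ik jm; apply: measurable_fun_sub_sigma => A hA; apply: sub_sigma_algebra.
by exists i => //; right; exists j => //; right.
Qed.

Lemma measurable_dir_history_dir k :
  measurable_fun [set: Hdir k] (dir S k : Hdir k -> borelRV R d).
Proof.
by apply: measurable_fun_sub_sigma => A hA; apply: sub_sigma_algebra; right.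
Qed.

Variables (f : 'rV[R]_d -> 'rV[R]_p -> R)
  (D : 'rV[R]_d -> probability (borelRV R p) R) (sigma alpha Lxi Lx HF : R).
Hypothesis fD : assumptions f D sigma alpha Lxi Lx HF.
Variables (mu : nat -> R) (beta : R) (x0 : 'rV[R]_d).

(** The averaged estimator is this scalar times the direction u_k, so all the sampling noise of an
    iteration is carried by one real number. *)
Definition two_point_slope (k : nat) (x : 'rV[R]_d) (w : Omega) : R :=
  (m k)%:R^-1 * \sum_(j < m k)
    ((f (x + mu k *: (dir S k w : 'rV[R]_d)) (smp1 S k j w) -
      f (x - mu k *: (dir S k w : 'rV[R]_d)) (smp2 S k j w)) / (2 * mu k)).

Lemma run_iterateS k w :
  run_iterate f mu beta m x0 S k.+1 w =
  run_iterate f mu beta m x0 S k w - beta *: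
    (two_point_slope k (run_iterate f mu beta m x0 S k w) w *: (dir S k w : 'rV[R]_d)).
Proof.
rewrite {1}/run_iterate /= -/(run_iterate f mu beta m x0 S k w).
by congr (_ - beta *: _); rewrite /two_point_slope -scalerA scaler_suml.
Qed.

(** Conditioning on the past requires measurability for the history up to k, which is more than
    measurability on Omega. Iterate k uses only draws of iterations before k. *)
Lemma measurable_run_iterate k :
  measurable_fun [set: H k] (run_iterate f mu beta m x0 S k : H k -> borelRV R d).
Proof.
elim: k => [|k IH]; first exact: measurable_cst.
have mx : measurable_fun [set: H k.+1]
    (run_iterate f mu beta m x0 S k : H k.+1 -> borelRV R d).
  exact: (measurableT_comp IH (measurable_history_mono (leqnSn k))).
have mu' := measurable_dir_history (ltnSn k).
have E : run_iterate f mu beta m x0 S k.+1 = (fun w =>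
  run_iterate f mu beta m x0 S k w + (- beta * two_point_slope k
     (run_iterate f mu beta m x0 S k w) w) *: (dir S k w : 'rV[R]_d)).
  by apply/funext => w; rewrite run_iterateS scalerA mulNr scaleNr.
rewrite E; apply: measurable_funD_borelRV => //.
apply: measurable_funZ_borelRV => //; apply: measurable_funM => //.
apply: measurable_funM => //; apply: measurable_sum => j.
apply: measurable_funM => //; apply: measurable_funB.
  apply: (measurable_f_comp fD); last exact: measurable_smp1_history.
  exact: measurable_shift.
apply: (measurable_f_comp fD); last exact: measurable_smp2_history.
have := measurable_shift mx mu' (- mu k).
by congr (measurable_fun _ _); apply/funext => w; rewrite scaleNr.
Qed.

End run_measurability.

(** * Descent in expectation over one iteration *)

Section one_step.
Context {R : realType} {d p : nat}.
Context {dO : measure_display} {Omega : measurableType dO} (P : probability Omega R).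
Variables (f : 'rV[R]_d -> 'rV[R]_p -> R)
  (D : 'rV[R]_d -> probability (borelRV R p) R) (sigma alpha Lxi Lx HF : R).
Hypothesis fD : assumptions f D sigma alpha Lxi Lx HF.
Variables (m : nat -> nat) (S : run R d p Omega) (mu : nat -> R) (beta m0 : R)
  (T : nat) (x0 : 'rV[R]_d) (k : nat).
Local Notation F := (objective f D).
Hypotheses (alg : algorithm2 P f D mu beta m T x0 S) (kT : (k <= T)%N)
  (HF0 : 0 < HF) (Fm0 : forall x, m0 <= F x) (beta0 : 0 < beta) (mu0 : 0 < mu k)
  (mk0 : (0 < m k)%N) (betaHF : 12 * (d%:R + 4) * HF * beta <= 1).
Local Notation x := (run_iterate f mu beta m x0 S k).
Local Notation u := (dir S k).
Local Notation V := (sigma ^+ 2 / (2 * mu k ^+ 2 * (m k)%:R)).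
Local Notation H := (g_sigma_algebraType (history_generator m S k)).
Local Notation Hdir := (g_sigma_algebraType (history_dir_generator m S k)).

Let dF := objective_differentiable fD.
Let gF := gradient_lipschitz fD.

Let mxH : measurable_fun [set: H] (x : H -> borelRV R d).
Proof. exact: (measurable_run_iterate fD). Qed.

Let mxHd : measurable_fun [set: Hdir] (x : Hdir -> borelRV R d).
Proof. exact: (measurableT_comp mxH (@measurable_history_dir_history _ _ _ _ _ m S k)). Qed.

Let muHd : measurable_fun [set: Hdir] (u : Hdir -> borelRV R d).
Proof. exact: measurable_dir_history_dir. Qed.

Let mx : measurable_fun [set: Omega] (x : Omega -> borelRV R d).
Proof. exact: (measurableT_comp mxH (@measurable_id_history _ _ _ _ _ m S k)). Qed.

Let mxS : measurable_fun [set: Omega] (run_iterate f mu beta m x0 S k.+1 : Omega -> borelRV R d).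
Proof.
exact: (measurableT_comp (@measurable_run_iterate _ _ _ _ _ m S _ _ _ _ _ _ _ fD mu beta x0 k.+1) (@measurable_id_history _ _ _ _ _ m S k.+1)).
Qed.

Let V0 : 0 <= V.
Proof. by rewrite divr_ge0 ?sqr_ge0// !mulr_ge0// ltW. Qed.

Let xp (w : Omega) : 'rV[R]_d := x w + mu k *: (u w : 'rV[R]_d).
Let xm (w : Omega) : 'rV[R]_d := x w - mu k *: (u w : 'rV[R]_d).

Let mxp : measurable_fun [set: Hdir] (xp : Hdir -> borelRV R d).
Proof. exact: measurable_shift. Qed.

Let mxm : measurable_fun [set: Hdir] (xm : Hdir -> borelRV R d).
Proof.
have := measurable_shift mxHd muHd (- mu k).
by congr (measurable_fun _ _); apply/funext => w; rewrite scaleNr.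
Qed.

(* The 2 m_k samples of the iteration in a single sequence. *)
Let xi (i : nat) : Omega -> borelRV R p :=
  if (i < m k)%N then smp1 S k i else smp2 S k (i - m k).
Let law_xi (i : nat) (w : Hdir) : probability (borelRV R p) R :=
  if (i < m k)%N then D (xp w) else D (xm w).
(** Centred contribution of sample i to the averaged slope; the samples at x - mu u enter with a
    minus sign. Subtracting F makes the mean 0, and the subtracted terms add up to the finite
    difference. *)
Let psi (i : nat) (y : Hdir * borelRV R p) : R :=
  if (i < m k)%N then (2 * mu k * (m k)%:R)^-1 * (f (xp y.1) y.2 - F (xp y.1))
  else - (2 * mu k * (m k)%:R)^-1 * (f (xm y.1) y.2 - F (xm y.1)).

Let joint (C : set Hdir) (B : nat -> set (borelRV R p)) :
  measurable C -> (forall i, measurable (B i)) ->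
  P ((id : Omega -> Hdir) @^-1` C `&` [set w | forall i, (i < m k + m k)%N -> B i (xi i w)]) =
  (\int[P]_(w in (id : Omega -> Hdir) @^-1` C) \prod_(i < m k + m k) law_xi i w (B i))%E.
Proof.
move=> mC mB; rewrite !preimage_id.
have := run_samples alg kT mC mB (fun j => mB (m k + j)%N).
rewrite /= => E; transitivity (P (C `&` [set w | forall j, (j < m k)%N ->
    B j (smp1 S k j w) /\ B (m k + j)%N (smp2 S k j w)])).
  congr (P (_ `&` _)); apply/seteqP; split => w /= h.
    move=> j jm; split.
      by have := h j (ltn_addr _ jm); rewrite /xi jm.
    have := h (m k + j)%N; rewrite ltn_add2l jm => /(_ isT).
    by rewrite /xi ltnNge leq_addr /= addKn.
  move=> i iN; rewrite /xi; case: ltnP => im; first by have [] := h i im.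
  have im' : (i - m k < m k)%N by rewrite ltn_subLR.
  by have [_] := h _ im'; rewrite subnKC.
rewrite E; apply: eq_integral => w _; rewrite big_split_ord big_split/=.
congr (_ * _)%E; apply: eq_bigr => j _; rewrite /law_xi /=.
  by rewrite ltn_ord.
by rewrite ltnNge leq_addr.
Qed.

Let G (w : Omega) : R := finite_difference F (mu k) (x w) (u w).

Let slope_noise w :
  two_point_slope m S f mu k (x w) w = G w + noise id xi psi (m k + m k) w.
Proof.
rewrite /noise big_split_ord/=.
have e1 : \sum_(i < m k) psi (lshift (m k) i) (id w, xi (lshift (m k) i) w) =
  \sum_(j < m k) (2 * mu k * (m k)%:R)^-1 * (f (xp w) (smp1 S k j w) - F (xp w)).
  by apply: eq_bigr => j _; rewrite /psi /xi /= ltn_ord.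
have e2 : \sum_(i < m k) psi (rshift (m k) i) (id w, xi (rshift (m k) i) w) =
  \sum_(j < m k) - (2 * mu k * (m k)%:R)^-1 * (f (xm w) (smp2 S k j w) - F (xm w)).
  apply: eq_bigr => j _; rewrite /psi /xi /= ltnNge leq_addr /=.
  by rewrite addKn.
rewrite e1 e2 -!mulr_sumr !big_split/= !sumr_const card_ord.
rewrite /two_point_slope /G /finite_difference -/(xp w) -/(xm w).
rewrite -mulr_suml big_split/= sumrN.
set A := \sum_(i < m k) f (xp w) _; set B := \sum_(i < m k) f (xm w) _.
rewrite -(mulr_natr (- F (xp w))) -(mulr_natr (- F (xm w))).
by field; rewrite pnatr_eq0 -lt0n mk0 gt_eqF.
Qed.

Lemma one_step_samples :
  (\int[P]_w (F (run_iterate f mu beta m x0 S k.+1 w) - m0)%:E <=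
   \int[P]_w (mean_step_bound F HF m0 beta (mu k) V (x w) (u w))%:E)%E.
Proof.
(* [a], [b] and [c] are the coefficients of [step_bound] re-expanded around its mean slope [G], so
   that the variable is the centred noise. *)
pose a (w : Hdir) : R := step_bound F HF m0 beta (x w) (u w) (G w).
pose c (w : Hdir) : R := HF * beta ^+ 2 * enorm (u w) ^+ 2.
pose b (w : Hdir) : R := - beta * edot (gradient F (x w)) (u w) + 2 * (c w * G w).
have HF0' := ltW HF0; have beta0' := ltW beta0.
have mG : measurable_fun [set: Hdir] (G : Hdir -> R).
  exact: measurable_finite_difference.
have mc : measurable_fun [set: Hdir] c.
  by apply: measurable_funM => //; apply: measurable_funX; exact: measurable_enorm_comp.
have mb : measurable_fun [set: Hdir] b.
  apply: measurable_funD.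
    by apply: measurable_funM => //; exact: (measurable_edot_gradient gF).
  by apply: measurable_funM => //; exact: measurable_funM.
have ma : measurable_fun [set: Hdir] a by exact: (measurable_step_bound m0 beta dF gF).
have Q (w : Hdir) s : a w + b w * s + c w * s ^+ 2 =
    step_bound F HF m0 beta (x w) (u w) (G w + s).
  by rewrite /a /b /c /step_bound; ring.
have mxi i : measurable_fun [set: Omega] (xi i).
  by rewrite /xi; case: ifP => _; exact: measurable_funP.
have mlaw i (U : set (borelRV R p)) : measurable U ->
    measurable_fun [set: Hdir] (fun y => law_xi i y U).
  by move=> mU; rewrite /law_xi; case: (i < m k)%N; exact: (measurable_D_comp fD).
have mpsi i : measurable_fun [set: Hdir * borelRV R p] (psi i).
  have mxp1 : measurable_fun [set: Hdir * borelRV R p] (fun y => xp y.1 : borelRV R d).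
    exact: (measurableT_comp mxp measurable_fst).
  have mxm1 : measurable_fun [set: Hdir * borelRV R p] (fun y => xm y.1 : borelRV R d).
    exact: (measurableT_comp mxm measurable_fst).
  rewrite /psi; case: (i < m k)%N; apply: measurable_funM => //; apply: measurable_funB.
  - by apply: (measurable_f_comp fD) => //; exact: measurable_snd.
  - exact: (measurable_F_comp dF).
  - by apply: (measurable_f_comp fD) => //; exact: measurable_snd.
  - exact: (measurable_F_comp dF).
(* Bound on the second moment of one contribution; the 2 m_k of them add up to [V]. *)
pose s2 := (2 * mu k * (m k)%:R)^-1 ^+ 2 * sigma ^+ 2.
have s20 : 0 <= s2 by rewrite mulr_ge0 ?sqr_ge0.
have c0 (w : Hdir) : 0 <= c w by rewrite !mulr_ge0 ?sqr_ge0 ?enorm_ge0.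
have psi_mean i (y : Hdir) : (i < m k + m k)%N ->
    (\int[law_xi i y]_z (psi i (y, z))%:E = 0)%E.
  by move=> _; rewrite /law_xi /psi; case: (i < m k)%N; exact: (integral_deviation_scaled fD).
have psi_var i (y : Hdir) : (i < m k + m k)%N ->
    (\int[law_xi i y]_z (psi i (y, z) ^+ 2)%:E <= s2%:E)%E.
  move=> _; rewrite /law_xi /psi; case: (i < m k)%N.
    exact: (integral_deviation_sqr fD).
  have := integral_deviation_sqr fD (xm y) (- (2 * mu k * (m k)%:R)^-1).
  by rewrite sqrrN.
have q0 (w : Hdir) s : 0 <= a w + b w * s + c w * s ^+ 2.
  by rewrite Q; exact: step_bound_ge0.
have := quadratic_noise_le (@measurable_id_history_dir _ _ _ _ _ m S k) mxi mlaw joint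
  mpsi mb mc c0 s20 psi_mean psi_var (leqnn _) ma q0.
have -> : (\int[P]_w (a (id w) + c (id w) * ((m k + m k)%:R * s2))%:E =
   \int[P]_w (mean_step_bound F HF m0 beta (mu k) V (x w) (u w))%:E)%E.
  apply: eq_integral => w _; congr (_%:E)%E; rewrite /mean_step_bound -/(a w) -/(c w).
  congr (_ + _ * _); rewrite /s2 natrD.
  by field; rewrite pnatr_eq0 -lt0n mk0 gt_eqF.
apply: le_trans; apply: ge0_le_integral; [by []| | | |].
- by move=> w _; rewrite lee_fin subr_ge0.
- apply/measurable_EFinP; apply: measurable_funB => //.
  exact: (measurable_F_comp dF mxS).
- have mu_ : measurable_fun [set: Omega] (u : Omega -> borelRV R d) := measurable_funP u.
  have mslope : measurable_fun [set: Omega] (fun w => two_point_slope m S f mu k (x w) w).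
    apply: measurable_funM => //; apply: measurable_sum => j.
    apply: measurable_funM => //; apply: measurable_funB.
      apply: (measurable_f_comp fD); last exact: measurable_funP.
      exact: measurable_shift.
    apply: (measurable_f_comp fD); last exact: measurable_funP.
    have := measurable_shift mx mu_ (- mu k).
    by congr (measurable_fun _ _); apply/funext => w; rewrite scaleNr.
  apply/measurable_EFinP.
  have := measurable_step_bound m0 beta dF gF mx mu_ mslope.
  congr (measurable_fun _ _); apply/funext => w.
  by rewrite slope_noise -Q.
- move=> w _; rewrite lee_fin Q run_iterateS slope_noise.
  exact: step_bound_ge.
Qed.

(** Once the samples are integrated out, a function of x_k and u_k is left. Independence of u_k from
    the history makes its conditional law the constant kernel [gamma], so the Gaussian bound applies
    pointwise in x_k. *)
Lemma one_step_descent :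
  (\int[P]_w (F (run_iterate f mu beta m x0 S k.+1 w) - m0)%:E +
   (beta / 8)%:E * \int[P]_w (enorm (gradient F (x w)) ^+ 2)%:E <=
   \int[P]_w (F (x w) - m0)%:E +
   (431 * beta * HF ^+ 2 * mu k ^+ 2 * d%:R ^+ 2 + 3 * HF * beta ^+ 2 * d%:R * V)%:E)%E.
Proof.
set E1 := 431 * _ * _ * _ * _ + _.
have E10 : 0 <= E1.
  have HF0' := ltW HF0; have beta0' := ltW beta0; have mu0' := ltW mu0.
  apply: addr_ge0.
    do 3 (apply: mulr_ge0; last exact: sqr_ge0).
    by apply: mulr_ge0; first exact: ler0n.
  by apply: mulr_ge0 => //; rewrite !mulr_ge0 ?sqr_ge0.
pose gamma := law P (measurable_funP u).
have gE (B : 'I_d -> set R) : (forall i, measurable (B i)) ->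
    gamma (box B) = (\prod_(i < d) normal_prob 0 1 (B i))%E.
  by move=> mB; exact: (run_dir_normal alg kT mB).
have cl : conditional_law P (id : Omega -> H) u (fun=> gamma).
  move=> C B mC mB; rewrite !preimage_id.
  apply: etrans (run_dir_indep alg kT mC _) _; first by exists B => //; rewrite setTI.
  rewrite integral_cst; last first.
    have := @measurable_id_history _ _ _ _ _ m S k measurableT C mC.
    by rewrite setTI preimage_id.
  by rewrite muleC.
have mxu : measurable_fun [set: H * borelRV R d]
    (fun y => (mean_step_bound F HF m0 beta (mu k) V (x y.1) y.2)%:E).
  apply/measurable_EFinP; apply: (measurable_mean_step_bound m0 beta (mu k) V dF gF).
    exact: (measurableT_comp mxH measurable_fst).
  exact: measurable_snd.
have q0 y u' : (0 <= (mean_step_bound F HF m0 beta (mu k) V y u')%:E)%E.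
  by rewrite lee_fin; exact: mean_step_bound_ge0.
have dis := ge0_disintegration (@measurable_id_history _ _ _ _ _ m S k) (measurable_funP u)
  (fun U _ => measurable_cst (gamma U)) cl (fun y => q0 (x y.1) y.2) mxu.
have mg : measurable_fun [set: Omega] (fun w => (enorm (gradient F (x w)) ^+ 2)%:E).
  apply/measurable_EFinP; apply: measurable_funX; apply: measurable_enorm_comp.
  exact: (measurable_gradient_comp gF).
have mI : measurable_fun [set: Omega]
    (fun w => \int[gamma]_u' (mean_step_bound F HF m0 beta (mu k) V (x w) u')%:E)%E.
  have := @measurable_partial_integral _ _ _ _ _ (fun _ : H => gamma)
    (fun U _ => measurable_cst (gamma U)) _ (fun y => q0 (x y.1) y.2) mxu.
  by move=> h; exact: (measurableT_comp h (@measurable_id_history _ _ _ _ _ m S k)).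
apply: (@le_trans _ _ (\int[P]_w (\int[gamma]_u' (mean_step_bound F HF m0 beta (mu k) V (x w) u')%:E
    + (beta / 8)%:E * (enorm (gradient F (x w)) ^+ 2)%:E))%E).
  rewrite [leRHS]ge0_integralD//; last 3 first.
  - by move=> w _; exact: integral_ge0.
  - by move=> w _; rewrite -EFinM lee_fin mulr_ge0 ?sqr_ge0// divr_ge0// ltW.
  - exact: measurable_funeM.
  rewrite -dis ge0_integralZl_EFin//; last 2 first.
  - by move=> w _; rewrite lee_fin sqr_ge0.
  - by rewrite divr_ge0// ltW.
  by apply: leeD2r; exact: one_step_samples.
have -> : (\int[P]_w (F (x w) - m0)%:E + E1%:E = \int[P]_w ((F (x w) - m0)%:E + E1%:E))%E.
  rewrite ge0_integralD//.
  - by rewrite integral_cst// [X in (_ + _ * X)%E](probability_setT P) mule1.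
  - by move=> w _; rewrite lee_fin subr_ge0.
  - by apply/measurable_EFinP; apply: measurable_funB => //; exact: (measurable_F_comp dF).
apply: ge0_le_integral; [by []| | | |].
- move=> w _; apply: adde_ge0; first exact: integral_ge0.
  by rewrite -EFinM lee_fin mulr_ge0 ?sqr_ge0// divr_ge0// ltW.
- by apply: emeasurable_funD => //; exact: measurable_funeM.
- apply: emeasurable_funD => //.
  by apply/measurable_EFinP; apply: measurable_funB => //; exact: (measurable_F_comp dF).
- by move=> w _; rewrite -EFinM -EFinD; exact: mean_step_bound_gaussian.
Qed.

End one_step.

(** The events N = k with k <= T are disjoint and have total mass 1, so the larger values of N form
    a null set and the integral splits into a finite sum. *)
Lemma integral_uniform_index {dO : measure_display} {Omega : measurableType dO}
    {R : realType} (P : probability Omega R) (N : {mfun Omega >-> nat}) (T : nat)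
    (g : nat -> Omega -> \bar R) :
  (forall k, measurable_fun setT (g k)) -> (forall k w, 0 <= g k w)%E ->
  (forall k, (k <= T)%N -> P (N @^-1` [set k]) = (T.+1%:R^-1)%:E) ->
  (forall k, (k <= T)%N ->
    \int[P]_(w in N @^-1` [set k]) g k w = (T.+1%:R^-1)%:E * \int[P]_w g k w)%E ->
  (\int[P]_w g (N w) w = (T.+1%:R^-1)%:E * \sum_(k < T.+1) \int[P]_w g k w)%E.
Proof.
move=> mg g0 PA gA; pose A k : set Omega := N @^-1` [set k].
have mA k : measurable (A k).
  by rewrite -[X in measurable X]setTI; exact: measurable_funP.
(* Evaluation at a random index is measurable because N takes countably many values. *)
have mX : measurable_fun setT (fun w => g (N w) w).
  move=> _ B mB; rewrite setTI.
  rewrite (_ : _ @^-1` B = \bigcup_k (A k `&` g k @^-1` B)).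
    apply: bigcupT_measurable => k; apply: measurableI => //.
    by rewrite -[X in measurable X]setTI; exact: mg.
  apply/seteqP; split => [w h|w [k _ [Ak h]]]; first by exists (N w).
  by rewrite /preimage /mkset (Ak : N w = k).
have tA (I : set nat) : trivIset I A by move=> i j _ _ [w [/= <- <-]].
pose U := \big[setU/set0]_(0 <= i < T.+1) A i.
have mU : measurable U by exact: bigsetU_measurable.
have PU : P U = 1%E.
  rewrite /U big_mkord measure_bigsetU//.
  rewrite (eq_bigr (fun=> (T.+1%:R^-1)%:E)); last first.
    by move=> i _; exact: (PA _ (ltn_ord i)).
  by rewrite sumEFin sumr_const card_ord -[_ *+ _]mulr_natr mulVf// pnatr_eq0.
have PUC : P (~` U) = 0%E by rewrite probability_setC// PU subee.
rewrite -(setUv U) ge0_integral_setU//=; last 3 first.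
- exact: measurableC.
- by rewrite setUv.
- by apply/disj_set2P; rewrite setICr.
rewrite [X in (_ + X)%E]null_set_integral//; last 2 first.
- exact: measurableC.
- exact: measurable_funTS.
rewrite setUv adde0 ge0_sume_distrr; last by move=> k _; exact: integral_ge0.
rewrite /U ge0_integral_bigsetU//; last 2 first.
- exact: iota_uniq.
- exact: measurable_funTS.
rewrite big_mkord; apply: eq_bigr => k _; rewrite -(gA _ (ltnSE (ltn_ord k))).
by apply: eq_integral => w /set_mem <-.
Qed.

(** * Telescoping over the run and the random output index *)

Section whole_run.
Context {R : realType} {d p : nat}.
Context {dO : measure_display} {Omega : measurableType dO} (P : probability Omega R).
Variables (f : 'rV[R]_d -> 'rV[R]_p -> R)
  (D : 'rV[R]_d -> probability (borelRV R p) R) (sigma alpha Lxi Lx HF : R).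
Hypothesis fD : assumptions f D sigma alpha Lxi Lx HF.
Variables (m : nat -> nat) (S : run R d p Omega) (mu : nat -> R) (beta m0 : R)
  (T : nat) (x0 : 'rV[R]_d).
Local Notation F := (objective f D).
Hypotheses (alg : algorithm2 P f D mu beta m T x0 S)
  (HF0 : 0 < HF) (Fm0 : forall x, m0 <= F x) (beta0 : 0 < beta)
  (mu0 : forall k, (k <= T)%N -> 0 < mu k)
  (mk0 : forall k, (k <= T)%N -> (0 < m k)%N)
  (betaHF : 12 * (d%:R + 4) * HF * beta <= 1).
Local Notation x k := (run_iterate f mu beta m x0 S k).
Local Notation H k := (g_sigma_algebraType (history_generator m S k)).
Local Notation g2 k w := ((enorm (gradient F (x k w)) ^+ 2)%:E).

Let dF := objective_differentiable fD.
Let gF := gradient_lipschitz fD.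

Let mgH k l : (k <= l)%N -> measurable_fun [set: H l] (fun w => g2 k w).
Proof.
move=> kl; apply/measurable_EFinP; apply: measurable_funX; apply: measurable_enorm_comp.
apply: (measurable_gradient_comp gF).
have mx := @measurable_run_iterate _ _ _ _ _ m S _ _ _ _ _ _ _ fD mu beta x0 k.
exact: (measurableT_comp mx (measurable_history_mono kl)).
Qed.

Let mg k : measurable_fun [set: Omega] (fun w => g2 k w).
Proof.
exact: (measurableT_comp (mgH (leqnn k)) (@measurable_id_history _ _ _ _ _ m S k)).
Qed.

Lemma sum_gradient_le (E : R) : 0 <= E ->
  (forall k, (k <= T)%N -> 431 * beta * HF ^+ 2 * mu k ^+ 2 * d%:R ^+ 2 +
     3 * HF * beta ^+ 2 * d%:R * (sigma ^+ 2 / (2 * mu k ^+ 2 * (m k)%:R)) <= E) ->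
  ((beta / 8)%:E * \sum_(k < T.+1) \int[P]_w g2 k w <=
    (F x0 - m0 + T.+1%:R * E)%:E)%E.
Proof.
move=> E0 hE.
have b8 : 0 <= beta / 8 by rewrite divr_ge0// ltW.
have I0 k : (0 <= \int[P]_w g2 k w)%E.
  by apply: integral_ge0 => w _; rewrite lee_fin sqr_ge0.
(* The term E (F x_n - m0) carries the induction and is dropped at the end, being nonnegative. *)
suff h n : (n <= T.+1)%N -> (\int[P]_w (F (x n w) - m0)%:E +
    (beta / 8)%:E * \sum_(k < n) \int[P]_w g2 k w <= (F x0 - m0 + n%:R * E)%:E)%E.
  apply: le_trans (h T.+1 (leqnn _)); apply: leeDr.
  by apply: integral_ge0 => w _; rewrite lee_fin subr_ge0.
elim: n => [_|n IH nT].
  rewrite big_ord0 mule0 adde0 mul0r addr0 /run_iterate /=.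
  by rewrite integral_cst// [X in (_ * X)%E](probability_setT P) mule1.
rewrite big_ord_recr/= ge0_muleDr//; last by apply: sume_ge0.
(* A rearrangement without subtraction, because the integrals may a priori be infinite. *)
have aux (a a' g s e K : \bar R) :
    (a' + g <= a + e -> a + s <= K -> a' + (s + g) <= K + e)%E.
  move=> h1 h2; rewrite addeCA; apply: le_trans (leeD2l s h1) _.
  by rewrite addeA (addeC s); exact: leeD2r.
have step := one_step_descent fD alg nT HF0 Fm0 beta0 (mu0 nT) (mk0 nT) betaHF.
have e1 := hE _ nT; rewrite -lee_fin in e1.
have -> : F x0 - m0 + n.+1%:R * E = F x0 - m0 + n%:R * E + E.
  by rewrite -[n.+1]addn1 natrD mulrDl mul1r addrA.
rewrite [in leRHS]EFinD.
exact: aux (le_trans step (leeD2l _ e1)) (IH (ltnW nT)).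
Qed.

(** By [run_idx], P restricted to the event that the index is k, seen on the history of the run, has
    constant density 1 / (T + 1) with respect to P; the gradient at x_k is measurable for that
    history. *)
Lemma expected_gradient_idx :
  ('E_P[fun w => (enorm (gradient F (x (idx S w) w)) ^+ 2)%R] =
   (T.+1%:R^-1)%:E * \sum_(k < T.+1) \int[P]_w g2 k w)%E.
Proof.
have g20 k w : (0 <= g2 k w)%E by rewrite lee_fin sqr_ge0.
rewrite unlock; apply: (integral_uniform_index (g := fun k w => g2 k w)) => // k kT.
  have := run_idx alg (A := setT) _ kT.
  rewrite setTI => ->; first by rewrite [X in (X * _)%E](probability_setT P) mul1e.
  exact: (@measurableT _ (H T.+1)).
pose h w : \bar R := g2 k w.
have mh : measurable_fun [set: H T.+1] h by apply: mgH; exact: leqW.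
have mA : measurable (idx S @^-1` [set k]).
  by rewrite -[X in measurable X]setTI; exact: measurable_funP.
have mid := @measurable_id_history _ _ _ _ _ m S T.+1.
have mhO : measurable_fun setT (fun w : Omega => h w) := mg k.
have h0 w : (0 <= h w)%E := g20 k w.
transitivity (\int[pushforward (mrestr P mA) (id : Omega -> H T.+1)]_w h w)%E.
  rewrite (ge0_integral_pushforward mid)//= preimage_setT.
  rewrite (@ge0_integral_density _ _ _ P (mrestr P mA) \1_(idx S @^-1` [set k]))//=.
  - rewrite integral_mkcond; apply: eq_integral => w _.
    by rewrite patchE indicE; case: ifP => _; rewrite ?mule1 ?mule0.
  - by move=> A mA'; rewrite /mrestr integral_indic// setIC.
rewrite (@ge0_integral_density _ _ _ (pushforward P (id : Omega -> H T.+1)) _ (cst (T.+1%:R^-1)))//.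
- rewrite (ge0_integral_pushforward mid)//.
  + rewrite preimage_setT -ge0_integralZl_EFin//.
    by apply: eq_integral => w _; rewrite muleC.
  + have mc : measurable_fun [set: H T.+1] (fun=> (T.+1%:R^-1 : R)%:E) := measurable_cst _.
    exact: emeasurable_funM mh mc.
  + by move=> w _; apply: mule_ge0 => //; rewrite lee_fin invr_ge0.
- by move=> w; rewrite /= invr_ge0.
- move=> A hA; apply: etrans (run_idx alg hA kT) _.
  rewrite muleC; apply/esym.
  exact: (@integral_cst _ _ _ (pushforward P (id : Omega -> H T.+1)) A hA (T.+1%:R^-1)%:E).
Qed.

End whole_run.

(** * Choice of the parameters *)

Lemma inv_min_le {R : realType} (a b : R) : 0 < a -> 0 < b ->
  (Num.min a b)^-1 <= a^-1 + b^-1.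
Proof.
move=> a0 b0; have ai : 0 <= a^-1 by rewrite invr_ge0 ltW.
have bi : 0 <= b^-1 by rewrite invr_ge0 ltW.
by rewrite minEle; case: ifP => _; rewrite ?lerDl ?lerDr.
Qed.

(* Here r = d^(1/4), t = sqrt (T + 1) and e is the accuracy. The term
   [431 / 16384 e^2] is 431 HF^2 mu^2 d^2 for mu <= e d^(-3/2) / (128 HF). *)
Lemma rate_le {R : realType} (HF Delta K s r e t beta : R) :
  0 < HF -> 0 <= Delta -> 0 <= K -> 1 <= r -> 0 < e -> e <= 1 -> 0 < t ->
  s = 1 + 4 * (480 * Delta * HF + 8 * Delta + 8 * K) ->
  s * r ^+ 5 <= t * e ^+ 2 ->
  beta = Num.min (1 / (12 * (r ^+ 4 + 4) * HF)) (1 / (t * r ^+ 3)) ->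
  8 * (Delta / (beta * t ^+ 2) + (431 / 16384 * e ^+ 2 + K * r ^+ 8 * beta)) <= e ^+ 2.
Proof.
move=> HF0 D0 K0 r1 e0 e1 t0 sE st betaE.
have r0 : 0 < r by exact: lt_le_trans r1.
have HF0' := ltW HF0; have r0' := ltW r0.
have DH : 0 <= Delta * HF by exact: mulr_ge0.
have s1 : 1 <= s by rewrite sE; lra.
have s0 : 0 < s by exact: lt_le_trans s1.
pose q := e ^+ 2; rewrite -/q in st; rewrite -/q.
have q0 : 0 < q by rewrite exprn_gt0.
have q1 : q <= 1 by rewrite expr_le1// ltW.
(* This is d^(5/4) / sqrt (T + 1), and it controls every term that decreases with T: r^8 beta <=
   rho, r^3 / t <= rho and r^4 / t^2 <= rho^2 <= rho. The lower bound on t says that rho <= q /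
   s. *)
pose rho := r ^+ 5 / t.
have rho0 : 0 <= rho by rewrite divr_ge0// ?exprn_ge0// ltW.
have rhoq : rho <= q / s.
  by rewrite /rho ler_pdivrMr// mulrAC ler_pdivlMr// mulrC [q * t]mulrC.
have qs0 : 0 <= q / s by rewrite divr_ge0 ?ltW.
have qs1 : q / s <= 1 by rewrite ler_pdivrMr// mul1r (le_trans q1).
have A0 : 0 < 1 / (12 * (r ^+ 4 + 4) * HF).
  by rewrite divr_gt0// !mulr_gt0// addr_gt0// exprn_gt0.
have B0 : 0 < 1 / (t * r ^+ 3) by rewrite divr_gt0// mulr_gt0// exprn_gt0.
have beta0 : 0 < beta by rewrite betaE lt_min A0 B0.
have betaB : beta <= 1 / (t * r ^+ 3) by rewrite betaE ge_min lexx orbT.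
have i1 : K * r ^+ 8 * beta <= K * (q / s).
  rewrite -mulrA ler_wpM2l//; apply: le_trans rhoq.
  apply: (@le_trans _ _ (r ^+ 8 * (1 / (t * r ^+ 3)))).
    by rewrite ler_wpM2l// exprn_ge0.
  rewrite le_eqVlt; apply/orP; left; apply/eqP; rewrite /rho.
  by field; rewrite ?gt_eqF.
have r4 : 1 <= r ^+ 4 by rewrite exprn_ege1.
(* 60 = 12 * 5, from r^4 + 4 <= 5 r^4. *)
have binv : beta^-1 <= 60 * r ^+ 4 * HF + t * r ^+ 3.
  rewrite betaE; apply: (le_trans (inv_min_le A0 B0)); rewrite !div1r !invrK lerD2r.
  by rewrite ler_wpM2r//; lra.
have i2 : Delta / (beta * t ^+ 2) <= Delta * (60 * HF * (q / s) + q / s).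
  rewrite ler_wpM2l// invfM.
  apply: (@le_trans _ _ ((60 * r ^+ 4 * HF + t * r ^+ 3) * t ^- 2)).
    by rewrite ler_wpM2r// invr_ge0 sqr_ge0.
  have -> : (60 * r ^+ 4 * HF + t * r ^+ 3) * t ^- 2 =
      60 * HF * (r ^+ 4 / t ^+ 2) + r ^+ 3 / t.
    by field; rewrite gt_eqF.
  apply: lerD.
    rewrite ler_wpM2l ?mulr_ge0//.
    apply: (@le_trans _ _ (rho ^+ 2)).
      rewrite /rho expr_div_n ler_wpM2r ?invr_ge0 ?sqr_ge0// -exprM.
      exact: ler_weXn2l.
    rewrite expr2; apply: (@le_trans _ _ (rho * 1)); last by rewrite mulr1.
    by rewrite ler_wpM2l// (le_trans rhoq).
  apply: le_trans rhoq; apply: ler_wpM2r; first by rewrite invr_ge0 ltW.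
  exact: ler_weXn2l.
(* 480 = 8 * 60. The value of [s] is chosen so that these terms use at most a quarter of q; the
   smoothing bias gets the other three quarters, 8 * (3 / 32). *)
have i3 : (480 * Delta * HF + 8 * Delta + 8 * K) * (q / s) <= 1 / 4 * q.
  have -> : 480 * Delta * HF + 8 * Delta + 8 * K = (s - 1) / 4 by rewrite sE; field.
  rewrite mulrA ler_pdivrMr//.
  have : 0 <= q * s by rewrite mulr_ge0 ?ltW.
  by lra.
have i4 : 431 / 16384 * q <= 3 / 32 * q by lra.
have e2 : (480 * Delta * HF + 8 * Delta + 8 * K) * (q / s) =
   8 * (Delta * (60 * HF * (q / s) + q / s) + K * (q / s)) by ring.
rewrite e2 in i3; move: i1 i2 i3 i4; rewrite -/q.
move: (K * r ^+ 8 * beta) (Delta / _) (Delta * (_ + _)) (K * (q / s)) => Y X Z W.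
move: (431 / 16384 * q) => c i1 i2 i3 i4.
lra.
Qed.

Lemma smoothing_bounds {R : realType} (mu0 mumin gamma : R) (k : nat) :
  0 < gamma -> gamma < 1 -> 0 < mumin -> mumin <= mu0 ->
  mumin <= smoothing mu0 mumin gamma k <= mu0.
Proof.
move=> g0 g1 m0 mm; elim: k => [|k /andP[IH1 IH2]] /=; first by rewrite mm lexx.
rewrite le_max lexx orbT /= ge_max mm andbT.
by apply: le_trans IH2; rewrite ger_pMl ?ltW// (lt_le_trans m0).
Qed.

(** A factor [beta] is taken out of both errors, because the telescoped sum is divided by beta / 8
    afterwards; the variance term keeps a second one, which decreases with T. *)
Lemma step_error_le {R : realType} (HF sigma a1 b1 r e mu M beta : R) :
  0 < HF -> 0 < a1 -> 0 < b1 -> 1 <= r -> 0 < e -> 0 < beta ->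
  a1 * (e * r ^- 6) <= mu -> mu <= 1 / (128 * HF) * (e * r ^- 6) ->
  b1 * (e ^- 2 * r ^+ 8) <= M ->
  431 * beta * HF ^+ 2 * mu ^+ 2 * r ^+ 8 +
    3 * HF * beta ^+ 2 * r ^+ 4 * (sigma ^+ 2 / (2 * mu ^+ 2 * M)) <=
  beta * (431 / 16384 * e ^+ 2 +
    3 * HF * sigma ^+ 2 / (2 * a1 ^+ 2 * b1) * r ^+ 8 * beta).
Proof.
move=> HF0 a10 b10 r1 e0 beta0 mu1 mu2 M1.
have r0 : 0 < r by exact: lt_le_trans r1.
have HF0' := ltW HF0; have r0' := ltW r0; have beta0' := ltW beta0.
have er0 : 0 < e * r ^- 6 by rewrite mulr_gt0// invr_gt0 exprn_gt0.
have mu0 : 0 < mu by apply: lt_le_trans mu1; rewrite mulr_gt0.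
have M0 : 0 < M by apply: lt_le_trans M1; rewrite !mulr_gt0// ?invr_gt0 exprn_gt0.
have i1 : (HF * mu * r ^+ 4) ^+ 2 <= e ^+ 2 / 16384.
  have -> : e ^+ 2 / 16384 = (e / 128) ^+ 2 by field.
  rewrite lerXn2r ?nnegrE ?divr_ge0 ?(ltW e0)//.
    by rewrite !mulr_ge0// ?exprn_ge0// ltW.
  apply: (@le_trans _ _ (HF * (1 / (128 * HF) * (e * r ^- 6)) * r ^+ 4)).
    by rewrite ler_wpM2r ?exprn_ge0// ler_wpM2l.
  have -> : HF * (1 / (128 * HF) * (e * r ^- 6)) * r ^+ 4 = e / 128 * r ^- 2.
    have rr : r ^- 6 * r ^+ 4 = r ^- 2.
      by rewrite (exprD r 2 4) invfM -mulrA mulVf ?mulr1// gt_eqF// exprn_gt0.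
    have -> : HF * (1 / (128 * HF) * (e * r ^- 6)) = e / 128 * r ^- 6.
      by move: (r ^- 6) => z; field; rewrite ?gt_eqF.
    by rewrite -mulrA rr.
  rewrite ler_piMr ?divr_ge0 ?(ltW e0)// invf_le1 ?exprn_gt0//.
  exact: exprn_ege1.
(* The exponents prescribed for mu and m balance here: (e r^-6)^2 (e^-2 r^8) r^4 = 1, so sigma^2 /
   (mu^2 m) is at most a constant times r^4 = d, whatever the accuracy. *)
have i2 : a1 ^+ 2 * b1 <= mu ^+ 2 * M * r ^+ 4.
  have -> : a1 ^+ 2 * b1 = (a1 * (e * r ^- 6)) ^+ 2 * (b1 * (e ^- 2 * r ^+ 8)) * r ^+ 4.
    by field; rewrite ?gt_eqF.
  rewrite ler_wpM2r ?exprn_ge0//; apply: ler_pM => //.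
  - exact: sqr_ge0.
  - by rewrite !mulr_ge0 ?invr_ge0 ?exprn_ge0// ltW.
  - by rewrite lerXn2r// nnegrE ltW// mulr_gt0.
have ab0 : 0 < a1 ^+ 2 * b1 by rewrite mulr_gt0 ?exprn_gt0.
have mM0 : 0 < mu ^+ 2 * M by rewrite mulr_gt0 ?exprn_gt0.
have i3 : sigma ^+ 2 / (2 * mu ^+ 2 * M) <= sigma ^+ 2 / (2 * a1 ^+ 2 * b1) * r ^+ 4.
  rewrite -[leRHS]mulrA; apply: ler_wpM2l; first exact: sqr_ge0.
  have -> : (2 * mu ^+ 2 * M)^-1 = 2^-1 * (mu ^+ 2 * M)^-1 by rewrite -mulrA invfM.
  have -> : (2 * a1 ^+ 2 * b1)^-1 * r ^+ 4 = 2^-1 * ((a1 ^+ 2 * b1)^-1 * r ^+ 4).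
    by rewrite -(mulrA 2) invfM mulrA.
  rewrite ler_wpM2l// -[(mu ^+ 2 * M)^-1]mul1r ler_pdivrMr//.
  by rewrite -mulrA mulrC ler_pdivlMr// mul1r [r ^+ 4 * _]mulrC.
have i4 := ler_wpM2l beta0' i1.
have c0 : 0 <= 3 * HF * beta ^+ 2 * r ^+ 4.
  by apply: mulr_ge0; [apply: mulr_ge0; [exact: mulr_ge0|exact: sqr_ge0]|exact: exprn_ge0].
have i5 := ler_wpM2l c0 i3.
have -> : 431 * beta * HF ^+ 2 * mu ^+ 2 * r ^+ 8 =
    431 * (beta * (HF * mu * r ^+ 4) ^+ 2) by ring.
have -> : beta * (431 / 16384 * e ^+ 2 +
    3 * HF * sigma ^+ 2 / (2 * a1 ^+ 2 * b1) * r ^+ 8 * beta) =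
  431 * (beta * (e ^+ 2 / 16384)) +
  3 * HF * beta ^+ 2 * r ^+ 4 * (sigma ^+ 2 / (2 * a1 ^+ 2 * b1) * r ^+ 4).
  rewrite mulrDr; congr (_ + _).
    by rewrite [431 / 16384 * _]mulrAC -(mulrA 431) [LHS]mulrCA.
  by rewrite (_ : r ^+ 8 = r ^+ 4 * r ^+ 4); [ring|rewrite -exprD].
apply: lerD i5; apply: ler_wpM2l i4; exact: ler0n.
Qed.

(** Each Theta is a pair of constants fixed before [C1] and [C2], so these serve every dimension,
    accuracy, objective and starting point whose gap is at most [Delta]. The smoothing bias, of
    order HF^2 mu^2 d^2, does not decrease with T; this is why [cbar] caps the upper constant of mu.
    The accuracy holds for every run of at least [N] iterations, and the samples are counted for
    exactly [N]. *)
Theorem theorem2 (R : realType) (sigma alpha Lxi Lx HF Delta : R)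
    (sigma_ge0 : 0 <= sigma) (alpha_ge0 : 0 <= alpha) (Lxi_ge0 : 0 <= Lxi)
    (Lx_ge0 : 0 <= Lx) (HF_gt0 : 0 < HF) (Delta_ge0 : 0 <= Delta) :
  exists2 cbar : R, 0 < cbar &
  forall a1 a2 b1 b2 : R, 0 < a1 -> a1 <= a2 -> a2 <= cbar ->
    0 < b1 -> b1 <= b2 ->
  exists C1 C2 : R, 0 < C1 /\ 0 < C2 /\
  forall (d : nat) (eps : R), (0 < d)%N -> 0 < eps -> eps <= 1 ->
  exists N : nat, (0 < N)%N /\ N%:R <= C1 * (d%:R `^ (5 / 2) * eps ^- 4) /\
  forall (p : nat) (f : 'rV[R]_d -> 'rV[R]_p -> R)
    (D : 'rV[R]_d -> probability (borelRV R p) R),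
    assumptions f D sigma alpha Lxi Lx HF ->
  forall (x0 : 'rV[R]_d) (gamma mu0 mumin : R) (T : nat) (m : nat -> nat),
    (forall x, objective f D x0 - objective f D x <= Delta) ->
    0 < gamma -> gamma < 1 ->
    a1 * (eps * d%:R `^ (- (3 / 2))) <= mumin <= a2 * (eps * d%:R `^ (- (3 / 2))) ->
    a1 * (eps * d%:R `^ (- (3 / 2))) <= mu0 <= a2 * (eps * d%:R `^ (- (3 / 2))) ->
    mumin <= mu0 ->
    (forall k, (k <= T)%N ->
      b1 * (eps ^- 2 * d%:R ^+ 2) <= (m k)%:R <= b2 * (eps ^- 2 * d%:R ^+ 2)) ->
    (N <= T.+1)%N ->
  let mu := smoothing mu0 mumin gamma in
  let beta := Num.min (1 / (12 * (d%:R + 4) * HF))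
                      (1 / (T.+1%:R `^ (1 / 2) * d%:R `^ (3 / 4))) in
  (forall (dO : measure_display) (Omega : measurableType dO)
     (P : probability Omega R) (S : run R d p Omega),
     algorithm2 P f D mu beta m T x0 S ->
     ('E_P[fun w => (enorm (gradient (objective f D)
        (run_iterate f mu beta m x0 S (idx S w) w)) ^+ 2)%R] <= (eps ^+ 2)%:E)%E)
  /\ (T.+1 = N ->
      (num_samples m T)%:R <= C2 * (d%:R `^ (9 / 2) * eps ^- 6)).
Proof.
exists (1 / (128 * HF)); first by rewrite divr_gt0// mulr_gt0.
move=> a1 a2 b1 b2 a10 a12 a2c b10 b12.
(* Coefficient that [step_error_le] leaves in front of d^2 beta in the variance term. *)
pose K := 3 * HF * sigma ^+ 2 / (2 * a1 ^+ 2 * b1).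
have K0 : 0 <= K.
  apply: divr_ge0; first by rewrite mulr_ge0 ?sqr_ge0// mulr_ge0// ltW.
  by rewrite mulr_ge0 ?(ltW b10)// mulr_ge0// sqr_ge0.
pose s := 1 + 4 * (480 * Delta * HF + 8 * Delta + 8 * K).
have s1 : 1 <= s.
  have DH : 0 <= Delta * HF by rewrite mulr_ge0// ltW.
  by rewrite /s; lra.
have s0 : 0 < s by exact: lt_le_trans s1.
have C10 : 0 < s ^+ 2 + 1 by rewrite ltr_wpDl// sqr_ge0.
have b20 : 0 < b2 by exact: lt_le_trans b12.
(* The number of iterations is at most (s^2 + 1) d^(5/2) eps^-4, and each draws 2 m_k <= 2 b2 eps^-2
   d^2 samples. *)
exists (s ^+ 2 + 1), (2 * (s ^+ 2 + 1) * b2).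
split; first exact: C10.
split; first by rewrite mulr_gt0// mulr_gt0.
move=> d eps d0 e0 e1.
(* All powers of d in the statement are integral powers of r. *)
pose r : R := d%:R `^ (1 / 4).
have dR1 : 1 <= d%:R :> R by rewrite ler1n.
have rX n : r ^+ n = d%:R `^ (1 / 4 * n%:R).
  by rewrite powRrM powR_mulrn// powR_ge0.
have r1 : 1 <= r by rewrite (_ : 1 = 1 `^ (1 / 4)) ?ge0_ler_powR ?nnegrE ?divr_ge0 ?powR1.
have r0 : 0 < r by exact: lt_le_trans r1.
have rd : d%:R = r ^+ 4 by rewrite rX -mulrA mulVf ?mulr1 ?powRr1.
have r52 : d%:R `^ (5 / 2) = r ^+ 10 by rewrite rX; congr (_ `^ _); field.
have r92 : d%:R `^ (9 / 2) = r ^+ 18 by rewrite rX; congr (_ `^ _); field.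
have r34 : d%:R `^ (3 / 4) = r ^+ 3 by rewrite rX; congr (_ `^ _); field.
have r32 : d%:R `^ (- (3 / 2)) = r ^- 6.
  by rewrite powRN rX; congr (_ ^-1); congr (_ `^ _); field.
rewrite r52 r92 r34 r32.
have d2 : d%:R ^+ 2 = r ^+ 8 by rewrite rd -exprM.
pose z := r ^+ 10 * eps ^- 4.
have z1 : 1 <= z.
  have : 1 * 1 <= r ^+ 10 * eps ^- 4.
    apply: ler_pM => //; first exact: exprn_ege1.
    by rewrite invf_ge1 ?exprn_gt0// exprn_ile1// ltW.
  by rewrite mulr1.
have z0 : 0 < z by exact: lt_le_trans z1.
(* The successor of the integer part lies between s^2 z and (s^2 + 1) z; the upper bound uses 1 <=
   z, hence eps <= 1. *)
pose N := (Num.truncn (s ^+ 2 * z)).+1.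
have sz0 : 0 <= s ^+ 2 * z by rewrite mulr_ge0 ?sqr_ge0// ltW.
have NC : N%:R <= (s ^+ 2 + 1) * z.
  rewrite /N -natr1 mulrDl mul1r; apply: lerD => //.
  by rewrite truncn_le.
have Nlow : s ^+ 2 * z <= N%:R by apply/ltW; exact: truncnS_gt.
exists N; split => //; split => //.
move=> p f D fD x0 gamma mu0 mumin T m FD g0 g1 mmin mm0 mmm mk NT mu beta.
have er0 : 0 < eps * r ^- 6 by rewrite mulr_gt0// invr_gt0 exprn_gt0.
have mumin0 : 0 < mumin by case/andP: mmin => + _; apply: lt_le_trans; rewrite mulr_gt0.
have muk k : mumin <= mu k <= mu0 by exact: smoothing_bounds.
have mulow k : a1 * (eps * r ^- 6) <= mu k.
  by case/andP: mmin => h _; apply: (le_trans h); case/andP: (muk k).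
have muhigh k : mu k <= 1 / (128 * HF) * (eps * r ^- 6).
  case/andP: (muk k) => _ h; apply: (le_trans h); case/andP: mm0 => _ h'.
  by apply: (le_trans h'); rewrite ler_wpM2r// ltW.
have er8 : 0 < eps ^- 2 * r ^+ 8 by rewrite mulr_gt0 ?invr_gt0 ?exprn_gt0.
rewrite d2 in mk.
split; last first.
  move=> TN; rewrite /num_samples natr_sum.
  have -> : eps ^- 6 = eps ^- 4 * eps ^- 2 by rewrite (exprD eps 4 2) invfM.
  apply: (@le_trans _ _ (\sum_(k < T.+1) 2 * (b2 * (eps ^- 2 * r ^+ 8)))).
    apply: ler_sum => k _; rewrite natrD.
    have /andP[_] := mk _ (ltnSE (ltn_ord k)).
    by set M := (m k)%:R; lra.
  rewrite sumr_const card_ord -[_ *+ T.+1]mulr_natr TN.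
  have -> : 2 * (s ^+ 2 + 1) * b2 * (r ^+ 18 * (eps ^- 4 * eps ^- 2)) =
    2 * (b2 * (eps ^- 2 * r ^+ 8)) * ((s ^+ 2 + 1) * z).
    rewrite /z (exprD r 8 10).
    move: (eps ^- 4) (eps ^- 2) (r ^+ 8) (r ^+ 10) (s ^+ 2) => ? ? ? ? ?; ring.
  apply: ler_wpM2l => //; apply: mulr_ge0 => //; apply: mulr_ge0; exact: ltW.
move=> dO Omega P S alg.
pose t : R := Num.sqrt T.+1%:R.
have T0 : 0 < T.+1%:R :> R by rewrite ltr0n.
have t0 : 0 < t by rewrite sqrtr_gt0.
have t2 : t ^+ 2 = T.+1%:R by rewrite sqr_sqrtr// ltW.
have betaE : beta = Num.min (1 / (12 * (r ^+ 4 + 4) * HF)) (1 / (t * r ^+ 3)).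
  by rewrite /beta rd (_ : T.+1%:R `^ (1 / 2) = t)// div1r powR12_sqrt// ltW.
have A0 : 0 < 12 * (r ^+ 4 + 4) * HF.
  by rewrite mulr_gt0// mulr_gt0// addr_gt0// exprn_gt0.
have beta0 : 0 < beta.
  by rewrite betaE lt_min !divr_gt0// mulr_gt0// exprn_gt0.
have betaHF : 12 * (d%:R + 4) * HF * beta <= 1.
  rewrite rd mulrC -ler_pdivlMr//; rewrite betaE ge_min; apply/orP; left.
  exact: lexx.
(* The square root of s^2 z <= N <= T + 1. *)
have st : s * r ^+ 5 <= t * eps ^+ 2.
  have l0 : 0 <= s * r ^+ 5 by rewrite mulr_ge0 ?exprn_ge0 ?ltW.
  have l1 : 0 <= t * eps ^+ 2 by rewrite mulr_ge0 ?sqr_ge0// ltW.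
  rewrite -ler_sqr ?nnegrE//.
  have -> : (s * r ^+ 5) ^+ 2 = s ^+ 2 * r ^+ 10 by rewrite exprMn -exprM.
  have -> : (t * eps ^+ 2) ^+ 2 = T.+1%:R * eps ^+ 4 by rewrite exprMn t2 -exprM.
  have h : s ^+ 2 * z <= T.+1%:R by apply: (le_trans Nlow); rewrite ler_nat.
  rewrite -ler_pdivrMr ?exprn_gt0//; apply: le_trans h.
  by rewrite /z mulrA.
have mk0 k : (k <= T)%N -> (0 < m k)%N.
  move=> kT; have /andP[h _] := mk _ kT.
  by rewrite -(ltr_nat R); apply: lt_le_trans h; rewrite mulr_gt0.
have Fm0 x : objective f D x0 - Delta <= objective f D x by rewrite lerBlDr -lerBlDl.
pose E := beta * (431 / 16384 * eps ^+ 2 + K * r ^+ 8 * beta).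
have E0 : 0 <= E.
  apply: mulr_ge0; first exact: ltW.
  have c1 : 0 <= 431 / 16384 :> R by apply: divr_ge0; exact: ler0n.
  apply: addr_ge0; first exact: mulr_ge0 c1 (sqr_ge0 _).
  by rewrite mulr_ge0 ?(ltW beta0)// mulr_ge0// exprn_ge0// ltW.
have step k : (k <= T)%N -> 431 * beta * HF ^+ 2 * mu k ^+ 2 * d%:R ^+ 2 +
     3 * HF * beta ^+ 2 * d%:R * (sigma ^+ 2 / (2 * mu k ^+ 2 * (m k)%:R)) <= E.
  move=> kT; rewrite d2 rd; apply: step_error_le => //.
  by case/andP: (mk _ kT).
have mupos k : (k <= T)%N -> 0 < mu k.
  by move=> _; apply: lt_le_trans mumin0 _; case/andP: (muk k).
have := sum_gradient_le fD alg HF_gt0 Fm0 beta0 mupos mk0 betaHF E0 step.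
rewrite (expected_gradient_idx fD alg).
set I := (\sum_(k < T.+1) _)%E => hI.
have rate := rate_le HF_gt0 Delta_ge0 K0 r1 e0 e1 t0 erefl st betaE.
have c0 : 0 <= T.+1%:R^-1 * (8 / beta) by rewrite mulr_ge0 ?invr_ge0// divr_ge0// ltW.
(* The average is written as 8 / (beta (T + 1)) times the quantity bounded by the telescoping. *)
have -> : ((T.+1%:R^-1)%:E * I = (T.+1%:R^-1 * (8 / beta))%:E * ((beta / 8)%:E * I))%E.
  rewrite muleA -EFinM; congr (_%:E * _)%E.
  by field; rewrite ?gt_eqF ?pnatr_eq0.
apply: (le_trans (lee_wpmul2l _ hI)); first by rewrite lee_fin.
rewrite -EFinM lee_fin; apply: le_trans rate.
rewrite t2 le_eqVlt; apply/orP; left; apply/eqP.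
rewrite subKr /E.
move: (431 / 16384 * eps ^+ 2 + K * r ^+ 8 * beta) => Y.
by field; rewrite ?gt_eqF ?pnatr_eq0.
Qed.
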